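(* Let $H^2_\beta$ be the weighted Hardy space induced by a weight sequence $w=\{w_k\}_{k=1}^\infty$ with $w_k\to1$. Let $h\in\mathrm{Hol}(\overline{\mathbb{D}})$ and let $\Omega$ be a domain in $h(\mathbb{D})\setminus\left(h(\mathbb{T})\cup h(\mathcal{Z}(h'))\right)$. Then $E_{h(S_\beta)}(\Omega)$ is a push-forwards Hermitian holomorphic vector bundle induced by $h$ from the vector bundle $E_{S_\beta}(\mathbb{D})$.
   Context: $\mathbb{D}$ is the open unit disk, $\mathbb{T}=\partial\mathbb{D}$; $\mathrm{Hol}(\overline{\mathbb{D}})$ is the set of functions analytic on (a neighborhood of) $\overline{\mathbb{D}}$. A domain is a nonempty connected open subset of $\mathbb{C}$. $\mathcal{Z}(h')=\{\lambda\in\mathbb{D}:h'(\lambda)=0\}$. $\beta=\{\beta_k\}_{k\ge0}$ is a sequence of positive numbers with $\beta_0=1$ and $w_k=\beta_k/\beta_{k-1}$. $H^2_\beta=\{f(z)=\sum_{k\ge0}\widehat f(k)z^k:\ \sum_k|\widehat f(k)|^2\beta_k^2<\infty\}$ with $\langle f,g\rangle=\sum_k\beta_k^2\,\widehat f(k)\overline{\widehat g(k)}$. $S_\beta$ is the bounded operator on $H^2_\beta$ given by $S_\beta f(z)=(f(z)-f(0))/z$; its spectrum is $\overline{\mathbb{D}}$ and $h(S_\beta)$ is defined by the holomorphic functional calculus. A Hermitian holomorphic vector bundle over a domain $\Omega$ (of rank $n$, in a Hilbert space $\mathcal{H}$) is $E(\Omega)=\{(\lambda,\mathbf{x}):\lambda\in\Omega,\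 \mathbf{x}\in E(\lambda)\}$ with $n$-dimensional fibres $E(\lambda)\subseteq\mathcal{H}$ such that every $\lambda_0\in\Omega$ has a neighborhood $\Delta$ and $\mathcal{H}$-valued holomorphic functions $\gamma_1,\dots,\gamma_n$ on $\Delta$ for which $\gamma_1(\lambda),\dots,\gamma_n(\lambda)$ is a basis of $E(\lambda)$ for every $\lambda\in\Delta$. $E_{S_\beta}(\mathbb{D})$ has fibres $\mathrm{Ker}(S_\beta-\lambda\mathbf{I})$, $\lambda\in\mathbb{D}$; $E_{h(S_\beta)}(\Omega)$ has fibres $\mathrm{Ker}(h(S_\beta)-\omega\mathbf{I})$, $\omega\in\Omega$. Push-forward: let $\Lambda$ be a domain, $h$ a non-constant analytic function on $\Lambda$, $\Omega$ a domain in $h(\Lambda)$, and $E(\Lambda)$, $E(\Omega)$ Hermitian holomorphic vector bundles over $\Lambda$, $\Omega$. $E(\Omega)$ is the push-forwards Hermitian holomorphic vector bundle induced by $h$ from $E(\Lambda)$ if for each $\omega\in\Omega$, $E(\omega)=\mathrm{span}\{E(\lambda):\lambda\in h^{-1}(\omega)\}$ (with $h^{-1}(\omega)\subseteq\Lambda$; here $\Lambda=\mathbb{D}$). *)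

(* Defs.v *)
From Stdlib Require Import Reals Lra Lia Psatz.
From Stdlib Require Import ClassicalEpsilon ProofIrrelevance FunctionalExtensionality PropExtensionality.
From Coquelicot Require Import Coquelicot.

Set Implicit Arguments.
Unset Strict Implicit.
Unset Printing Implicit Defensive.

Local Open Scope R_scope.

(** * Complex Hilbert spaces *)

(* The inner product is linear in its first argument. *)
Record HilbertSpace := {
  hilb_space :> CompleteNormedModule C_AbsRing;
  inner : hilb_space -> hilb_space -> C;
  inner_sym : forall x y, inner y x = Cconj (inner x y);
  inner_plus_l : forall x y z, inner (plus x y) z = (inner x z + inner y z)%C;
  inner_scal_l : forall (c : C) x y, inner (scal c x) y = (c * inner x y)%C;
  inner_norm : forall x, inner x x = RtoC (norm x ^ 2)
}.

(* The normed and complete structures attached to a positive definite inner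
   product for which Cauchy sequences converge. *)
Section InnerProduct.

Variable V : ModuleSpace C_Ring.
Variable ip : V -> V -> C.
Hypothesis ip_sym : forall x y, ip y x = Cconj (ip x y).
Hypothesis ip_plus : forall x y z, ip (plus x y) z = (ip x z + ip y z)%C.
Hypothesis ip_scal : forall (c : C) x y, ip (scal c x) y = (c * ip x y)%C.
Hypothesis ip_pos : forall x, 0 <= Re (ip x x).
Hypothesis ip_def : forall x, Re (ip x x) = 0 -> x = zero.

Definition ip_norm (x : V) : R := sqrt (Re (ip x x)).

Lemma ip_norm_sqr x : ip_norm x * ip_norm x = Re (ip x x).
Proof. apply sqrt_sqrt, ip_pos. Qed.

Lemma ip_norm_ge0 x : 0 <= ip_norm x.
Proof. apply sqrt_pos. Qed.

Lemma ip_re_sym x y : Re (ip y x) = Re (ip x y).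
Proof. rewrite ip_sym; apply re_conj. Qed.

Lemma ip_plus_r x y z : ip x (plus y z) = (ip x y + ip x z)%C.
Proof.
rewrite ip_sym, ip_plus, Cplus_conj, <- (ip_sym y x), <- (ip_sym z x); reflexivity.
Qed.

Lemma ip_scal_r (c : C) x y : ip x (scal c y) = (Cconj c * ip x y)%C.
Proof. rewrite ip_sym, ip_scal, Cmult_conj, <- (ip_sym y x); reflexivity. Qed.

Lemma ip_quad (x y : V) (t : R) :
  Re (ip (plus x (scal (RtoC t) y)) (plus x (scal (RtoC t) y)))
  = Re (ip x x) + 2 * t * Re (ip x y) + t * t * Re (ip y y).
Proof.
rewrite ip_plus, !ip_plus_r, !ip_scal, !ip_scal_r.
assert (E : Cconj (RtoC t) = RtoC t) by (unfold Cconj, RtoC; simpl; f_equal; ring).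
rewrite E, !re_plus, !re_scal_l, (ip_re_sym x y); ring.
Qed.

Lemma ip_CS x y : Re (ip x y) <= ip_norm x * ip_norm y.
Proof.
assert (Hx := ip_norm_ge0 x). assert (Hy := ip_norm_ge0 y).
assert (Ex := ip_norm_sqr x). assert (Ey := ip_norm_sqr y).
assert (Q : forall t, 0 <= Re (ip x x) + 2 * t * Re (ip x y) + t * t * Re (ip y y)).
{ intros t. rewrite <- ip_quad. apply ip_pos. }
destruct (Req_dec (ip_norm y) 0) as [Z | NZ].
- assert (Zy : Re (ip y y) = 0) by (rewrite <- Ey, Z; ring).
  destruct (Rle_dec (Re (ip x y)) 0) as [L | L].
  + rewrite Z; lra.
  + exfalso. assert (B : 0 < Re (ip x y)) by lra.
    specialize (Q (- (Re (ip x x) + 1) / (2 * Re (ip x y)))).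
    rewrite Zy in Q.
    replace (Re (ip x x) + 2 * (- (Re (ip x x) + 1) / (2 * Re (ip x y))) * Re (ip x y) + _)
      with (-1) in Q by (field; lra).
    lra.
- assert (P : 0 < ip_norm y) by lra.
  set (a := ip_norm x) in *. set (d := ip_norm y) in *.
  specialize (Q (- a / d)). rewrite <- Ex, <- Ey in Q.
  replace (a * a + 2 * (- a / d) * Re (ip x y) + - a / d * (- a / d) * (d * d))
    with (2 * a * (a - Re (ip x y) / d)) in Q by (field; lra).
  destruct (Req_dec a 0) as [A0 | A0].
  + assert (Zx : x = zero) by (apply ip_def; rewrite <- Ex, A0; ring).
    assert (E0 : ip x y = 0%C).
    { rewrite Zx, <- (scal_zero_l (zero : V)), ip_scal. apply Cmult_0_l. }
    rewrite E0, A0; simpl; lra.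
  + assert (Pa : 0 < a) by lra.
    assert (Q' : 0 <= a - Re (ip x y) / d) by nra.
    replace (Re (ip x y)) with (Re (ip x y) / d * d) by (field; lra). nra.
Qed.

Lemma ip_norm_triangle x y : ip_norm (plus x y) <= ip_norm x + ip_norm y.
Proof.
assert (Hx := ip_norm_ge0 x). assert (Hy := ip_norm_ge0 y).
apply Rsqr_incr_0_var; [ | lra].
unfold Rsqr. rewrite ip_norm_sqr, ip_plus, !ip_plus_r, !re_plus, (ip_re_sym x y).
rewrite <- !ip_norm_sqr. assert (C := ip_CS x y). nra.
Qed.

Lemma ip_norm_scal (c : C) x : ip_norm (scal c x) = Cmod c * ip_norm x.
Proof.
unfold ip_norm. rewrite ip_scal, ip_scal_r.
replace (Re (c * (Cconj c * ip x x))) with (Cmod c ^ 2 * Re (ip x x)).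
- rewrite sqrt_mult; [ | apply pow2_ge_0 | apply ip_pos].
  f_equal. apply sqrt_pow2, Cmod_ge_0.
- rewrite Cmod2_alt, !re_mult, im_mult, re_conj, im_conj. ring.
Qed.

Lemma ip_norm_zero : ip_norm zero = 0.
Proof.
rewrite <- (scal_zero_l (zero : V)), ip_norm_scal.
change (@zero C_Ring) with (RtoC 0). rewrite Cmod_0; ring.
Qed.

Lemma ip_norm_opp x : ip_norm (opp x) = ip_norm x.
Proof.
rewrite <- (scal_opp_one x), ip_norm_scal.
change (@opp C_Ring one) with (Copp 1). rewrite Cmod_m1; ring.
Qed.

Definition ip_ball (x : V) (e : R) (y : V) : Prop := ip_norm (minus y x) < e.

Lemma ip_ball_center (x : V) (e : posreal) : ip_ball x e x.
Proof. unfold ip_ball. rewrite minus_eq_zero. apply Rle_lt_trans with (1 := Req_le _ _ ip_norm_zero), cond_pos. Qed.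

Lemma ip_ball_sym (x y : V) (e : R) : ip_ball x e y -> ip_ball y e x.
Proof. unfold ip_ball. rewrite <- (opp_minus y x), ip_norm_opp. exact (fun H => H). Qed.

Lemma ip_ball_triangle (x y z : V) (e1 e2 : R) :
  ip_ball x e1 y -> ip_ball y e2 z -> ip_ball x (e1 + e2) z.
Proof.
unfold ip_ball. intros H1 H2. rewrite (minus_trans y z x), (Rplus_comm e1).
apply Rle_lt_trans with (1 := ip_norm_triangle _ _).
apply Rplus_lt_compat; assumption.
Qed.

Definition ip_UniformSpace_mixin : UniformSpace.mixin_of V :=
  UniformSpace.Mixin V zero ip_ball ip_ball_center ip_ball_sym ip_ball_triangle.

Definition ip_NormedModuleAux : NormedModuleAux C_AbsRing :=
  NormedModuleAux.Pack C_AbsRing V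
    (NormedModuleAux.Class C_AbsRing V (ModuleSpace.class C_Ring V)
       ip_UniformSpace_mixin) V.

Lemma ip_normed_scal (l : C) (x : V) : ip_norm (scal l x) <= Cmod l * ip_norm x.
Proof. rewrite ip_norm_scal; apply Rle_refl. Qed.

Lemma ip_normed_ball (x y : V) (eps : posreal) :
  ip_ball x eps y -> ip_norm (minus y x) < 1 * eps.
Proof. unfold ip_ball. rewrite Rmult_1_l. exact (fun H => H). Qed.

Lemma ip_normed_def (x : V) : ip_norm x = 0 -> x = zero.
Proof. intros H. apply ip_def. rewrite <- ip_norm_sqr, H; ring. Qed.

Definition ip_NormedModule_mixin : NormedModule.mixin_of C_AbsRing ip_NormedModuleAux :=
  NormedModule.Mixin C_AbsRing ip_NormedModuleAux ip_norm 1 ip_norm_triangle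
    ip_normed_scal (fun x y e H => H) ip_normed_ball ip_normed_def.

Definition ip_NormedModule : NormedModule C_AbsRing :=
  NormedModule.Pack C_AbsRing V
    (NormedModule.Class C_AbsRing V (NormedModuleAux.class C_AbsRing ip_NormedModuleAux)
       ip_NormedModule_mixin) V.

Hypothesis ip_complete : forall u : nat -> V,
  (forall eps : posreal, exists N, forall n m, (N <= n)%nat -> (N <= m)%nat ->
     ip_norm (minus (u n) (u m)) < eps) ->
  exists l : V, forall eps : posreal, exists N, forall n, (N <= n)%nat ->
     ip_norm (minus (u n) l) < eps.

Definition ip_lim (F : (ip_NormedModule -> Prop) -> Prop) : ip_NormedModule :=
  epsilon (inhabits zero) (fun l : ip_NormedModule => forall eps : posreal, F (ball l eps)).

Lemma ip_lim_ball (F : (ip_NormedModule -> Prop) -> Prop) :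
  ProperFilter F -> cauchy F -> forall eps : posreal, F (ball (ip_lim F) eps).
Proof.
intros PF HF. unfold ip_lim.
apply (epsilon_spec (inhabits (zero : ip_NormedModule))
         (fun l : ip_NormedModule => forall eps : posreal, F (ball l eps))).
assert (inv_pos : forall n : nat, 0 < / INR (S n)).
{ intros n. apply Rinv_0_lt_compat, lt_0_INR; lia. }
assert (ex : forall n : nat, {x : ip_NormedModule | F (ball x (/ INR (S n)))}).
{ intros n. apply constructive_indefinite_description.
  exact (HF (mkposreal _ (inv_pos n))). }
set (u := fun n => proj1_sig (ex n)).
assert (Hu : forall n, F (ball (u n) (/ INR (S n)))) by (intros n; exact (proj2_sig (ex n))).
assert (small : forall eps : posreal, exists N, forall n, (N <= n)%nat -> / INR (S n) < eps).
{ intros eps. destruct (archimed_cor1 eps (cond_pos eps)) as [N [HN HN0]].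
  exists N. intros n Hn. apply Rle_lt_trans with (2 := HN).
  apply Rinv_le_contravar; [apply lt_0_INR; lia | apply le_INR; lia]. }
assert (half : forall eps : posreal, 0 < eps / 2) by (intros e; destruct e; simpl; lra).
destruct (ip_complete (u := u)) as [l Hl].
- intros eps. destruct (small (mkposreal _ (half eps))) as [N HN]. cbn [pos] in HN.
  exists N. intros n m Hn Hm.
  destruct (filter_ex _ (filter_and _ _ (Hu n) (Hu m))) as [z [Hz1 Hz2]].
  change (ip_ball (u n) (/ INR (S n)) z) in Hz1.
  change (ip_ball (u m) (/ INR (S m)) z) in Hz2.
  specialize (HN n Hn) as A. specialize (HN m Hm) as B.
  refine (Rlt_trans _ _ _ (ip_ball_triangle Hz2 (ip_ball_sym Hz1)) _). lra.
- exists l. intros eps.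
  destruct (small (mkposreal _ (half eps))) as [N HN].
  destruct (Hl (mkposreal _ (half eps))) as [M HM]. cbn [pos] in HN, HM.
  set (n := (N + M)%nat).
  specialize (HN n ltac:(unfold n; lia)). specialize (HM n ltac:(unfold n; lia)).
  apply filter_imp with (2 := Hu n). intros z Hz.
  change (ip_ball (u n) (/ INR (S n)) z) in Hz.
  change (ip_ball l eps z).
  refine (Rlt_trans _ _ _ (ip_ball_triangle (HM : ip_ball l (eps / 2) (u n)) Hz) _). lra.
Qed.

Lemma ip_lim_close (F1 F2 : (ip_NormedModule -> Prop) -> Prop) :
  filter_le F1 F2 -> filter_le F2 F1 -> close (ip_lim F1) (ip_lim F2).
Proof.
intros H12 H21.
assert (E : F1 = F2).
{ apply functional_extensionality; intros P. apply propositional_extensionality.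
  split; [apply H21 | apply H12]. }
rewrite E. apply close_refl.
Qed.

Definition ip_CompleteNormedModule : CompleteNormedModule C_AbsRing :=
  CompleteNormedModule.Pack C_AbsRing V
    (CompleteNormedModule.Class C_AbsRing V (NormedModule.class C_AbsRing ip_NormedModule)
       (CompleteSpace.Mixin ip_NormedModule ip_lim ip_lim_ball ip_lim_close)) V.

Lemma ip_inner_norm (x : ip_CompleteNormedModule) : ip x x = RtoC (norm x ^ 2).
Proof.
change (norm x) with (ip_norm x). simpl. rewrite Rmult_1_r, ip_norm_sqr.
assert (I : Im (ip x x) = 0).
{ assert (E := f_equal Im (ip_sym x x)). rewrite im_conj in E. lra. }
destruct (ip x x) as [a b]; simpl in *. rewrite I; reflexivity.
Qed.

Definition ip_HilbertSpace : HilbertSpace :=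
  {| hilb_space := ip_CompleteNormedModule; inner := ip; inner_sym := ip_sym;
     inner_plus_l := ip_plus; inner_scal_l := ip_scal; inner_norm := ip_inner_norm |}.

End InnerProduct.

(** * Weighted Hardy spaces *)

Record weight_seq := {
  beta :> nat -> R;
  beta_pos : forall k, 0 < beta k;
  beta_0 : beta 0 = 1
}.

(* [w_k] is only meaningful for [1 <= k]. *)
Definition weight (b : weight_seq) (k : nat) : R := b k / b (pred k).

Lemma ex_series_Rscal (c : R) (u : nat -> R) : ex_series u -> ex_series (fun k => c * u k).
Proof. exact (ex_series_scal (K := R_AbsRing) (V := R_NormedModule) c u). Qed.

Section WeightedHardy.

Variable b : weight_seq.

Definition in_H2 (a : nat -> C) : Prop := ex_series (fun k => Cmod (a k) ^ 2 * b k ^ 2).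

(* A function in the space is represented by its sequence of Taylor
   coefficients. *)
Definition H2_carrier : Type := {a : nat -> C | in_H2 a}.

Definition coef (f : H2_carrier) : nat -> C := proj1_sig f.

Lemma H2_ext (f g : H2_carrier) : (forall k, coef f k = coef g k) -> f = g.
Proof.
destruct f as [f Hf], g as [g Hg]; simpl; intros H.
assert (E : f = g) by (apply functional_extensionality; exact H).
subst g. f_equal. apply proof_irrelevance.
Qed.

Lemma in_H2_plus (f g : nat -> C) : in_H2 f -> in_H2 g -> in_H2 (fun k => (f k + g k)%C).
Proof.
intros Hf Hg.
apply (ex_series_le (K := R_AbsRing) (V := R_CompleteNormedModule) _
         (fun k => 2 * (Cmod (f k) ^ 2 * b k ^ 2) + 2 * (Cmod (g k) ^ 2 * b k ^ 2))).
- intros k. change norm with Rabs.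
  assert (T := Cmod_triangle (f k) (g k)). assert (P := Cmod_ge_0 (f k + g k)).
  rewrite Rabs_pos_eq by (apply Rmult_le_pos; apply pow2_ge_0).
  assert (Cmod (f k + g k) ^ 2 <= 2 * Cmod (f k) ^ 2 + 2 * Cmod (g k) ^ 2).
  { assert (Q := pow2_ge_0 (Cmod (f k) - Cmod (g k))).
    assert (I := pow_incr _ _ 2 (conj P T)). lra. }
  assert (0 <= b k ^ 2) by apply pow2_ge_0. nra.
- apply (ex_series_plus (V := R_NormedModule)); apply ex_series_Rscal; assumption.
Qed.

Lemma in_H2_scal (c : C) (f : nat -> C) : in_H2 f -> in_H2 (fun k => (c * f k)%C).
Proof.
intros Hf. apply ex_series_ext with (fun k => Cmod c ^ 2 * (Cmod (f k) ^ 2 * b k ^ 2)).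
- intros k. rewrite Cmod_mult. change (Cmod c ^ 2 * (Cmod (f k) ^ 2 * b k ^ 2) =
    (Cmod c * Cmod (f k)) ^ 2 * b k ^ 2). ring.
- apply ex_series_Rscal; assumption.
Qed.

Lemma in_H2_opp (f : nat -> C) : in_H2 f -> in_H2 (fun k => (- f k)%C).
Proof. intros Hf. apply ex_series_ext with (2 := Hf). intros k; now rewrite Cmod_opp. Qed.

Lemma in_H2_zero : in_H2 (fun _ => 0%C).
Proof.
exists 0. apply is_series_ext with (fun _ => 0).
- intros k. rewrite Cmod_0. change (0 = 0 ^ 2 * b k ^ 2). ring.
- apply filterlim_ext with (fun _ => 0).
  + intros n. symmetry. apply (sum_n_m_const_zero (G := R_AbelianMonoid)).
  + apply filterlim_const.
Qed.

Definition H2_plus (f g : H2_carrier) : H2_carrier :=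
  exist _ _ (in_H2_plus (proj2_sig f) (proj2_sig g)).
Definition H2_opp (f : H2_carrier) : H2_carrier := exist _ _ (in_H2_opp (proj2_sig f)).
Definition H2_scal (c : C) (f : H2_carrier) : H2_carrier :=
  exist _ _ (in_H2_scal c (proj2_sig f)).
Definition H2_zero : H2_carrier := exist _ _ in_H2_zero.

Lemma H2_plus_comm f g : H2_plus f g = H2_plus g f.
Proof. apply H2_ext; intros k; apply Cplus_comm. Qed.
Lemma H2_plus_assoc f g h : H2_plus f (H2_plus g h) = H2_plus (H2_plus f g) h.
Proof. apply H2_ext; intros k; apply Cplus_assoc. Qed.
Lemma H2_plus_zero f : H2_plus f H2_zero = f.
Proof. apply H2_ext; intros k; apply Cplus_0_r. Qed.
Lemma H2_plus_opp f : H2_plus f (H2_opp f) = H2_zero.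
Proof. apply H2_ext; intros k; apply Cplus_opp_r. Qed.
Lemma H2_scal_assoc (x y : C) f : H2_scal x (H2_scal y f) = H2_scal (x * y)%C f.
Proof. apply H2_ext; intros k; apply Cmult_assoc. Qed.
Lemma H2_scal_one f : H2_scal 1%C f = f.
Proof. apply H2_ext; intros k; apply Cmult_1_l. Qed.
Lemma H2_scal_distr_l (x : C) f g :
  H2_scal x (H2_plus f g) = H2_plus (H2_scal x f) (H2_scal x g).
Proof. apply H2_ext; intros k; apply Cmult_plus_distr_l. Qed.
Lemma H2_scal_distr_r (x y : C) f :
  H2_scal (x + y)%C f = H2_plus (H2_scal x f) (H2_scal y f).
Proof. apply H2_ext; intros k; apply Cmult_plus_distr_r. Qed.

Definition H2_AbelianMonoid_mixin : AbelianMonoid.mixin_of H2_carrier :=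
  AbelianMonoid.Mixin H2_carrier H2_plus H2_zero H2_plus_comm H2_plus_assoc H2_plus_zero.
Definition H2_AbelianMonoid : AbelianMonoid :=
  AbelianMonoid.Pack H2_carrier H2_AbelianMonoid_mixin H2_carrier.
Definition H2_AbelianGroup_mixin : AbelianGroup.mixin_of H2_AbelianMonoid :=
  AbelianGroup.Mixin H2_AbelianMonoid H2_opp H2_plus_opp.
Definition H2_AbelianGroup : AbelianGroup :=
  AbelianGroup.Pack H2_carrier
    (AbelianGroup.Class H2_carrier H2_AbelianMonoid_mixin H2_AbelianGroup_mixin) H2_carrier.
Definition H2_ModuleSpace_mixin : ModuleSpace.mixin_of C_Ring H2_AbelianGroup :=
  ModuleSpace.Mixin C_Ring H2_AbelianGroup H2_scal H2_scal_assoc H2_scal_one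
    H2_scal_distr_l H2_scal_distr_r.
Definition H2_ModuleSpace : ModuleSpace C_Ring :=
  ModuleSpace.Pack C_Ring H2_carrier
    (ModuleSpace.Class C_Ring H2_carrier (AbelianGroup.class H2_AbelianGroup)
       H2_ModuleSpace_mixin) H2_carrier.

Definition H2_term (f g : H2_carrier) (k : nat) : C :=
  (RtoC (b k ^ 2) * (coef f k * Cconj (coef g k)))%C.

(* Complex series are summed through their real and imaginary parts. *)
Definition H2_inner (f g : H2_carrier) : C :=
  (Series (fun k => Re (H2_term f g k)), Series (fun k => Im (H2_term f g k))).

Lemma im_le_Cmod (z : C) : Rabs (Im z) <= Cmod z.
Proof. apply Rle_trans with (2 := Rmax_Cmod z). apply Rmax_r. Qed.

Lemma H2_term_bound f g k :
  Cmod (H2_term f g k)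
  <= Cmod (coef f k) ^ 2 * b k ^ 2 + Cmod (coef g k) ^ 2 * b k ^ 2.
Proof.
unfold H2_term. rewrite !Cmod_mult, Cmod_conj, Cmod_R.
rewrite Rabs_pos_eq by apply pow2_ge_0.
assert (0 <= Cmod (coef f k)) by apply Cmod_ge_0.
assert (0 <= Cmod (coef g k)) by apply Cmod_ge_0.
assert (0 <= b k ^ 2) by apply pow2_ge_0.
assert (Cmod (coef f k) * Cmod (coef g k) <= Cmod (coef f k) ^ 2 + Cmod (coef g k) ^ 2) by nra.
nra.
Qed.

Lemma H2_dominated (f g : H2_carrier) (u : nat -> R) :
  (forall k, Rabs (u k) <= Cmod (H2_term f g k)) -> ex_series u.
Proof.
intros H.
apply (ex_series_le (K := R_AbsRing) (V := R_CompleteNormedModule) u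
  (fun k => Cmod (coef f k) ^ 2 * b k ^ 2 + Cmod (coef g k) ^ 2 * b k ^ 2)).
- intros k. apply Rle_trans with (1 := H k). apply H2_term_bound.
- apply (ex_series_plus (V := R_NormedModule)); [exact (proj2_sig f) | exact (proj2_sig g)].
Qed.

Lemma ex_H2_re f g : ex_series (fun k => Re (H2_term f g k)).
Proof. apply (H2_dominated (f := f) (g := g)); intros k; apply re_le_Cmod. Qed.
Lemma ex_H2_im f g : ex_series (fun k => Im (H2_term f g k)).
Proof. apply (H2_dominated (f := f) (g := g)); intros k; apply im_le_Cmod. Qed.

Lemma H2_inner_sym f g : H2_inner g f = Cconj (H2_inner f g).
Proof.
assert (E : forall k, H2_term g f k = Cconj (H2_term f g k)).
{ intros k. unfold H2_term. rewrite !Cmult_conj, Cconj_conj.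
  replace (Cconj (RtoC (b k ^ 2))) with (RtoC (b k ^ 2))
    by (unfold Cconj, RtoC; simpl; f_equal; ring).
  rewrite (Cmult_comm (coef g k)). reflexivity. }
unfold H2_inner, Cconj; cbn [fst snd]. f_equal.
- apply Series_ext; intros k. rewrite E; apply re_conj.
- rewrite <- (Series_opp (fun k => Im (H2_term f g k))).
  apply Series_ext; intros k. rewrite E; apply im_conj.
Qed.

Lemma H2_inner_plus f g h : H2_inner (H2_plus f g) h = (H2_inner f h + H2_inner g h)%C.
Proof.
assert (E : forall k, H2_term (H2_plus f g) h k = (H2_term f h k + H2_term g h k)%C).
{ intros k. unfold H2_term. simpl. unfold coef. ring. }
unfold H2_inner, Cplus; cbn [fst snd]. f_equal.
- rewrite <- Series_plus by apply ex_H2_re. apply Series_ext; intros k. rewrite E; apply re_plus.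
- rewrite <- Series_plus by apply ex_H2_im. apply Series_ext; intros k. rewrite E; apply im_plus.
Qed.

Lemma H2_inner_scal (c : C) f g : H2_inner (H2_scal c f) g = (c * H2_inner f g)%C.
Proof.
assert (E : forall k, H2_term (H2_scal c f) g k = (c * H2_term f g k)%C).
{ intros k. unfold H2_term. simpl. unfold coef. ring. }
assert (S : forall (x : R) u, ex_series u -> ex_series (fun k => x * u k)).
{ intros x u Hu. apply ex_series_Rscal; assumption. }
assert (Hr := ex_H2_re f g). assert (Hi := ex_H2_im f g).
unfold H2_inner, Cmult; cbn [fst snd]. f_equal.
- rewrite <- !Series_scal_l, <- Series_minus by (apply S; assumption).
  apply Series_ext; intros k. rewrite E; apply re_mult.
- rewrite <- !Series_scal_l, <- Series_plus by (apply S; assumption).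
  apply Series_ext; intros k. rewrite E; apply im_mult.
Qed.

Lemma H2_term_diag f k : Re (H2_term f f k) = Cmod (coef f k) ^ 2 * b k ^ 2.
Proof.
unfold H2_term. rewrite re_scal_l, re_mult, re_conj, im_conj, Cmod2_alt. ring.
Qed.

Lemma H2_inner_diag f :
  Re (H2_inner f f) = Series (fun k => Cmod (coef f k) ^ 2 * b k ^ 2).
Proof. unfold H2_inner; simpl. apply Series_ext, H2_term_diag. Qed.

Lemma H2_term_pos (a : nat -> C) k : 0 <= Cmod (a k) ^ 2 * b k ^ 2.
Proof. apply Rmult_le_pos; apply pow2_ge_0. Qed.

Lemma partial_sum_le (u : nat -> R) (n : nat) :
  (forall j, 0 <= u j) -> ex_series u -> sum_n u n <= Series u.
Proof.
intros U E.
assert (L : is_lim_seq (sum_n u) (Series u)) by exact (Series_correct u E).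
apply (is_lim_seq_incr_compare _ _ L).
intros k. rewrite sum_Sn. change plus with Rplus. specialize (U (S k)). lra.
Qed.

Lemma term_le_sum (u : nat -> R) (n : nat) : (forall j, 0 <= u j) -> u n <= sum_n u n.
Proof.
intros U. destruct n as [ | n]; [rewrite sum_O; apply Rle_refl | ].
rewrite sum_Sn. change plus with Rplus.
enough (0 <= sum_n u n) by lra.
rewrite sum_n_Reals. apply cond_pos_sum, U.
Qed.

Lemma H2_coef_le f k : Cmod (coef f k) ^ 2 * b k ^ 2 <= Re (H2_inner f f).
Proof.
rewrite H2_inner_diag.
assert (U := H2_term_pos (coef f)).
apply Rle_trans with (1 := term_le_sum k U).
apply partial_sum_le; [exact U | exact (proj2_sig f)].
Qed.

Lemma H2_inner_pos f : 0 <= Re (H2_inner f f).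
Proof. apply Rle_trans with (2 := H2_coef_le f 0). apply H2_term_pos. Qed.

Lemma H2_inner_def f : Re (H2_inner f f) = 0 -> f = H2_zero.
Proof.
intros H. apply H2_ext; intros k. simpl. apply Cmod_eq_0.
assert (L := H2_coef_le f k). rewrite H in L. assert (P := beta_pos b k).
assert (0 < b k ^ 2) by (apply pow_lt; exact P).
assert (0 <= Cmod (coef f k)) by apply Cmod_ge_0.
destruct (Req_dec (Cmod (coef f k)) 0) as [Z | Z]; [exact Z | exfalso].
assert (0 < Cmod (coef f k) ^ 2) by (apply pow_lt; lra). nra.
Qed.

Definition H2_norm : H2_carrier -> R := @ip_norm H2_ModuleSpace H2_inner.

Lemma H2_coef_norm f k : Cmod (coef f k) * b k <= H2_norm f.
Proof.
assert (P := beta_pos b k). assert (0 <= Cmod (coef f k)) by apply Cmod_ge_0.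
apply Rsqr_incr_0_var; [ | apply sqrt_pos].
unfold H2_norm, ip_norm. rewrite Rsqr_sqrt by apply H2_inner_pos.
apply Rle_trans with (2 := H2_coef_le f k). unfold Rsqr. nra.
Qed.

Lemma H2_complete (u : nat -> H2_ModuleSpace) :
  (forall eps : posreal, exists N, forall n m, (N <= n)%nat -> (N <= m)%nat ->
     H2_norm (minus (u n) (u m)) < eps) ->
  exists l : H2_ModuleSpace, forall eps : posreal, exists N, forall n, (N <= n)%nat ->
     H2_norm (minus (u n) l) < eps.
Proof.
intros Hc.
assert (Hk : forall k (eps : posreal), exists N, forall n m, (N <= n)%nat -> (N <= m)%nat ->
   Cmod (coef (u n) k - coef (u m) k) < eps).
{ intros k eps. assert (P := beta_pos b k).
  assert (Q : 0 < eps * b k) by (apply Rmult_lt_0_compat; [apply cond_pos | exact P]).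
  destruct (Hc (mkposreal _ Q)) as [N HN]. simpl in HN. exists N. intros n m Hn Hm.
  specialize (HN n m Hn Hm).
  assert (L := H2_coef_norm (minus (u n) (u m)) k).
  change (coef (minus (u n) (u m)) k) with (coef (u n) k - coef (u m) k)%C in L.
  apply Rmult_lt_reg_r with (1 := P). lra. }
assert (Hre : forall k, ex_finite_lim_seq (fun n => Re (coef (u n) k))).
{ intros k. apply ex_lim_seq_cauchy_corr. intros eps. destruct (Hk k eps) as [N HN].
  exists N. intros n m Hn Hm. apply Rle_lt_trans with (2 := HN n m Hn Hm).
  replace (Re (coef (u n) k) - Re (coef (u m) k)) with (Re (coef (u n) k - coef (u m) k))
    by (unfold Cminus; rewrite re_plus, re_opp; ring).
  apply re_le_Cmod. }
assert (Him : forall k, ex_finite_lim_seq (fun n => Im (coef (u n) k))).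
{ intros k. apply ex_lim_seq_cauchy_corr. intros eps. destruct (Hk k eps) as [N HN].
  exists N. intros n m Hn Hm. apply Rle_lt_trans with (2 := HN n m Hn Hm).
  replace (Im (coef (u n) k) - Im (coef (u m) k)) with (Im (coef (u n) k - coef (u m) k))
    by (unfold Cminus; rewrite im_plus, im_opp; ring).
  apply im_le_Cmod. }
set (a := fun k : nat => ((real (Lim_seq (fun n => Re (coef (u n) k))),
                           real (Lim_seq (fun n => Im (coef (u n) k)))) : C)).
assert (La : forall n k, is_lim_seq (fun m => Cmod (coef (u n) k - coef (u m) k) ^ 2 * b k ^ 2)
               (Cmod (coef (u n) k - a k) ^ 2 * b k ^ 2)).
{ intros n k.
  assert (L1 := Lim_seq_correct' _ (Hre k)). assert (L2 := Lim_seq_correct' _ (Him k)).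
  assert (E : forall c : C, Cmod (coef (u n) k - c) ^ 2 * b k ^ 2 =
     ((Re (coef (u n) k) - Re c) * (Re (coef (u n) k) - Re c)
      + (Im (coef (u n) k) - Im c) * (Im (coef (u n) k) - Im c)) * b k ^ 2).
  { intros c. rewrite Cmod2_alt. unfold Cminus. rewrite re_plus, re_opp, im_plus, im_opp. ring. }
  rewrite (E (a k)). apply is_lim_seq_ext with (1 := fun m => eq_sym (E (coef (u m) k))).
  apply is_lim_seq_mult'; [ | apply is_lim_seq_const].
  apply is_lim_seq_plus'; apply is_lim_seq_mult'; apply is_lim_seq_minus';
    first [apply is_lim_seq_const | exact L1 | exact L2]. }
assert (Ls : forall n K, is_lim_seq
   (fun m => sum_n (fun k => Cmod (coef (u n) k - coef (u m) k) ^ 2 * b k ^ 2) K)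
   (sum_n (fun k => Cmod (coef (u n) k - a k) ^ 2 * b k ^ 2) K)).
{ intros n K. induction K as [ | K IH].
  - rewrite sum_O.
    apply is_lim_seq_ext with (fun m => Cmod (coef (u n) 0 - coef (u m) 0) ^ 2 * b 0%nat ^ 2).
    + intros m. rewrite sum_O. reflexivity.
    + apply (La n 0%nat).
  - rewrite sum_Sn.
    apply is_lim_seq_ext with
      (fun m => sum_n (fun k => Cmod (coef (u n) k - coef (u m) k) ^ 2 * b k ^ 2) K
                + Cmod (coef (u n) (S K) - coef (u m) (S K)) ^ 2 * b (S K) ^ 2).
    + intros m. rewrite sum_Sn. reflexivity.
    + apply is_lim_seq_plus'; [exact IH | apply La]. }
assert (Bd : forall eps : posreal, exists N, forall n K, (N <= n)%nat ->
   sum_n (fun k => Cmod (coef (u n) k - a k) ^ 2 * b k ^ 2) K <= eps ^ 2).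
{ intros eps. destruct (Hc eps) as [N HN]. exists N. intros n K Hn.
  refine (is_lim_seq_le_loc _ _ (Finite _) (Finite (eps ^ 2)) _ (Ls n K) (is_lim_seq_const _)).
  exists N. intros m Hm. specialize (HN n m Hn Hm).
  apply Rle_trans with (Re (H2_inner (minus (u n) (u m)) (minus (u n) (u m)))).
  - rewrite H2_inner_diag. apply partial_sum_le.
    + intros j. apply (H2_term_pos (coef (minus (u n) (u m)))).
    + exact (proj2_sig (minus (u n) (u m))).
  - assert (Q := sqrt_sqrt _ (H2_inner_pos (minus (u n) (u m)))).
    assert (Q0 := sqrt_pos (Re (H2_inner (minus (u n) (u m)) (minus (u n) (u m))))).
    rewrite <- Q. simpl. rewrite Rmult_1_r.
    apply Rmult_le_compat; [exact Q0 | exact Q0 | apply Rlt_le; exact HN | apply Rlt_le; exact HN]. }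
assert (Hd : forall n (M : R),
   (forall K, sum_n (fun k => Cmod (coef (u n) k - a k) ^ 2 * b k ^ 2) K <= M) ->
   ex_series (fun k => Cmod (coef (u n) k - a k) ^ 2 * b k ^ 2)).
{ intros n M HM.
  destruct (ex_finite_lim_seq_incr
     (sum_n (fun k => Cmod (coef (u n) k - a k) ^ 2 * b k ^ 2)) M) as [l Hl].
  - intros K. rewrite sum_Sn. change plus with Rplus.
    assert (T := H2_term_pos (fun k => (coef (u n) k - a k)%C) (S K)). simpl in *. lra.
  - exact HM.
  - exists l. exact Hl. }
assert (Ha : in_H2 a).
{ destruct (Bd (mkposreal 1 Rlt_0_1)) as [N HN].
  assert (D := Hd N _ (fun K => HN N K (le_n N))).
  apply ex_series_ext with
    (fun k => Cmod (coef (u N) k + - (coef (u N) k - a k)) ^ 2 * b k ^ 2).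
  - intros k. do 3 f_equal. ring.
  - apply (in_H2_plus (proj2_sig (u N)) (in_H2_opp D)). }
exists (exist _ a Ha). intros eps.
assert (half : 0 < eps / 2) by (destruct eps; simpl; lra).
destruct (Bd (mkposreal _ half)) as [N HN]. exists N. intros n Hn.
specialize (fun K => HN n K Hn). simpl pos in HN.
set (d := minus (u n) (exist _ a Ha : H2_ModuleSpace)).
apply Rle_lt_trans with (eps / 2); [ | lra].
unfold H2_norm, ip_norm.
rewrite <- (sqrt_pow2 (eps / 2)) by lra.
apply sqrt_le_1_alt. rewrite H2_inner_diag.
assert (D := Hd n _ HN).
refine (is_lim_seq_le _ _ (Finite _) (Finite ((eps / 2) ^ 2)) HN
          (Series_correct _ D) (is_lim_seq_const _)).
Qed.

Definition H2 : HilbertSpace :=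
  @ip_HilbertSpace H2_ModuleSpace H2_inner H2_inner_sym H2_inner_plus H2_inner_scal
    H2_inner_pos H2_inner_def H2_complete.

End WeightedHardy.

Lemma in_H2_shift (b : weight_seq) (a : nat -> C) :
  is_lim_seq (weight b) 1 -> in_H2 b a -> in_H2 b (PS_decr_1 (V := C_NormedModule) a).
Proof.
intros Hw Ha.
assert (H : eventually (fun k => / 2 < weight b k)).
{ assert (h : 0 < / 2) by lra.
  destruct (proj2 (is_lim_seq_spec _ _) Hw (mkposreal _ h)) as [N HN]. exists N. intros k Hk.
  specialize (HN k Hk). simpl in HN. apply Rabs_def2 in HN. lra. }
destruct H as [N HN].
unfold in_H2, PS_decr_1.
apply (ex_series_incr_n (K := R_AbsRing) (V := R_NormedModule) _ N).
apply (ex_series_le (K := R_AbsRing) (V := R_CompleteNormedModule) _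
         (fun k => 4 * (Cmod (a (S N + k)%nat) ^ 2 * b (S N + k)%nat ^ 2))).
- intros k. change norm with Rabs. rewrite Rabs_pos_eq by (apply Rmult_le_pos; apply pow2_ge_0).
  specialize (HN (S (N + k)) ltac:(lia)). unfold weight in HN. simpl pred in HN.
  assert (P := beta_pos b (N + k)). assert (P' := beta_pos b (S (N + k))).
  assert (b (N + k)%nat < 2 * b (S (N + k))).
  { apply Rmult_lt_reg_r with (/ b (N + k)%nat); [now apply Rinv_0_lt_compat | ].
    rewrite Rinv_r by lra. unfold Rdiv in HN. lra. }
  change (S N + k)%nat with (S (N + k)).
  assert (0 <= Cmod (a (S (N + k))) ^ 2) by apply pow2_ge_0.
  assert (b (N + k)%nat ^ 2 <= 4 * b (S (N + k)) ^ 2) by (simpl; nra).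
  nra.
- apply ex_series_Rscal.
  apply (ex_series_incr_n (K := R_AbsRing) (V := R_NormedModule) (fun k => Cmod (a k) ^ 2 * b k ^ 2) (S N)). exact Ha.
Qed.

(* [PS_decr_1 a] is the coefficient sequence of [(f(z) - f(0)) / z] when [a] is
   that of [f]; see [is_pseries_decr_1]. *)
Definition S_beta (b : weight_seq) (Hw : is_lim_seq (weight b) 1) (f : H2 b) : H2 b :=
  exist _ _ (in_H2_shift Hw (proj2_sig f)).

(** * Subsets of the plane and holomorphic functions *)

Definition unit_disk (z : C) : Prop := Cmod z < 1.
Definition unit_circle (z : C) : Prop := Cmod z = 1.

Definition image (h : C -> C) (A : C -> Prop) (w : C) : Prop := exists z, A z /\ h z = w.

Definition connected_set (A : C -> Prop) : Prop :=
  forall U W : C -> Prop, open (T := C_UniformSpace) U -> open (T := C_UniformSpace) W ->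
  (forall z, A z -> U z \/ W z) ->
  (exists z, A z /\ U z) -> (exists z, A z /\ W z) -> exists z, A z /\ U z /\ W z.

Definition planar_domain (A : C -> Prop) : Prop :=
  (exists z, A z) /\ open (T := C_UniformSpace) A /\ connected_set A.

Definition holomorphic_on (V : NormedModule C_AbsRing) (U : C -> Prop) (f : C -> V) : Prop :=
  forall z, U z -> ex_derive (K := C_AbsRing) f z.

Definition hol_closed_disk (r : R) (h : C -> C) : Prop :=
  exists U : C -> Prop, open (T := C_UniformSpace) U /\ (forall z, Cmod z <= r -> U z) /\
    holomorphic_on (V := C_NormedModule) U h.

Definition critical_points (h : C -> C) (z : C) : Prop := unit_disk z /\ C_derive h z = 0%C.

(** * Holomorphic functional calculus *)

Section RestrictScalars.

Variable V : CompleteNormedModule C_AbsRing.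

Let rscal (t : R) (x : V) : V := scal (RtoC t) x.

Lemma rscal_assoc (s t : R) x : rscal s (rscal t x) = rscal (s * t) x.
Proof. unfold rscal. rewrite scal_assoc, RtoC_mult. reflexivity. Qed.
Lemma rscal_one x : rscal 1 x = x.
Proof. exact (scal_one x). Qed.
Lemma rscal_distr_l (t : R) x y : rscal t (plus x y) = plus (rscal t x) (rscal t y).
Proof. exact (scal_distr_l (RtoC t) x y). Qed.
Lemma rscal_distr_r (s t : R) x : rscal (s + t) x = plus (rscal s x) (rscal t x).
Proof. unfold rscal. rewrite RtoC_plus. exact (scal_distr_r (RtoC s) (RtoC t) x). Qed.
Lemma rscal_norm (t : R) x : norm (rscal t x) <= Rabs t * norm x.
Proof. rewrite <- Cmod_R. apply (norm_scal (RtoC t) x). Qed.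

Definition restrict_ModuleSpace : ModuleSpace R_Ring :=
  ModuleSpace.Pack R_Ring V
    (ModuleSpace.Class R_Ring V (AbelianGroup.class V)
       (ModuleSpace.Mixin R_Ring V rscal rscal_assoc rscal_one rscal_distr_l rscal_distr_r)) V.

Definition restrict_NormedModuleAux : NormedModuleAux R_AbsRing :=
  NormedModuleAux.Pack R_AbsRing V
    (NormedModuleAux.Class R_AbsRing V (ModuleSpace.class R_Ring restrict_ModuleSpace)
       (UniformSpace.class V)) V.

Definition restrict_NormedModule_mixin :
  NormedModule.mixin_of R_AbsRing restrict_NormedModuleAux :=
  NormedModule.Mixin R_AbsRing restrict_NormedModuleAux (norm : V -> R)
    (norm_factor (V := V)) norm_triangle rscal_norm norm_compat1 norm_compat2 norm_eq_zero.

(* The real complete normed space underlying a complex one, over which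
   Coquelicot integrates functions of a real variable. *)
Definition restrict_scalars : CompleteNormedModule R_AbsRing :=
  CompleteNormedModule.Pack R_AbsRing V
    (CompleteNormedModule.Class R_AbsRing V
       (NormedModule.Class R_AbsRing V
          (NormedModuleAux.class R_AbsRing restrict_NormedModuleAux)
          restrict_NormedModule_mixin)
       (CompleteSpace.class V)) V.

End RestrictScalars.

Section FunctionalCalculus.

Variable V : CompleteNormedModule C_AbsRing.
Variable T : V -> V.

Definition is_resolvent (z : C) (Rz : V -> V) : Prop :=
  is_linear Rz /\
  (forall x, Rz (minus (scal z x) (T x)) = x) /\
  (forall x, minus (scal z (Rz x)) (T (Rz x)) = x).

Definition spectrum (z : C) : Prop := ~ exists Rz, is_resolvent z Rz.

(* [(z I - T)^-1] outside the spectrum. *)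
Definition resolvent (z : C) : V -> V := epsilon (inhabits (fun x => x)) (is_resolvent z).

Definition circle (r t : R) : C := (r * cos t, r * sin t).

(* [1 / (2 i pi)] times the integral of [h(z) (z I - T)^-1 x dz] over the circle
   of radius [r] centred at [0]. *)
Definition cauchy_integral (h : C -> C) (r : R) (x : V) : V :=
  scal (/ (2 * PI * Ci))%C
    (RInt (V := restrict_scalars V)
       (fun t => scal (h (circle r t) * (Ci * circle r t))%C (resolvent (circle r t) x))
       0 (2 * PI)).

Definition admissible_radius (h : C -> C) (r : R) : Prop :=
  0 < r /\ (forall z, spectrum z -> Cmod z < r) /\ hol_closed_disk r h.

(* The Riesz-Dunford operator [h(T)], with a circle centred at [0] as contour: this
   covers every [T] and [h] such that [h] is holomorphic on a closed disk centred
   at [0] whose interior contains the spectrum of [T].  The value does not depend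
   on the circle chosen. *)
Definition hol_calculus (h : C -> C) : V -> V :=
  cauchy_integral h (epsilon (inhabits 0) (admissible_radius h)).

End FunctionalCalculus.

(** * Hermitian holomorphic vector bundles *)

Section Bundles.

Variable H : HilbertSpace.

Definition lin_comb (n : nat) (c : nat -> C) (v : nat -> H) : H :=
  sum_n_m (fun i => scal (c i) (v i)) 1 n.

Definition span (A : H -> Prop) (x : H) : Prop :=
  exists n c v, (forall i, (1 <= i <= n)%nat -> A (v i)) /\ x = lin_comb n c v.

Definition is_basis (n : nat) (v : nat -> H) (E : H -> Prop) : Prop :=
  (forall x, E x <-> exists c, x = lin_comb n c v) /\
  (forall c, lin_comb n c v = zero -> forall i, (1 <= i <= n)%nat -> c i = 0%C).

(* [E] gives the fibres, as subsets of [H]; the Hermitian metric on each of them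
   is the restriction of the inner product of [H]. *)
Definition hermitian_bundle (n : nat) (Omega : C -> Prop) (E : C -> H -> Prop) : Prop :=
  (1 <= n)%nat /\ planar_domain Omega /\
  forall l0, Omega l0 ->
  exists (Delta : C -> Prop) (gamma : nat -> C -> H),
    open (T := C_UniformSpace) Delta /\ Delta l0 /\ (forall l, Delta l -> Omega l) /\
    (forall i, (1 <= i <= n)%nat -> holomorphic_on Delta (gamma i)) /\
    (forall l, Delta l -> is_basis n (fun i => gamma i l) (E l)).

Definition ker_bundle (T : H -> H) (l : C) (x : H) : Prop := minus (T x) (scal l x) = zero.

Definition push_forward (Lambda : C -> Prop) (h : C -> C) (Omega : C -> Prop)
    (EL EO : C -> H -> Prop) : Prop :=
  planar_domain Lambda /\
  holomorphic_on (V := C_NormedModule) Lambda h /\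
  ~ (exists c, forall z, Lambda z -> h z = c) /\
  planar_domain Omega /\ (forall w, Omega w -> image h Lambda w) /\
  (exists m, hermitian_bundle m Lambda EL) /\
  (exists n, hermitian_bundle n Omega EO) /\
  forall w, Omega w -> forall x,
    EO w x <-> span (fun y => exists l, Lambda l /\ h l = w /\ EL l y) x.

End Bundles.

(* Main.v *)
Require Import Defs.
From Stdlib Require Import Reals Lra Lia List.
From Stdlib Require Import Classical ClassicalEpsilon.
From Coquelicot Require Import Coquelicot.

(* Let [y_k(z)] be the coefficients of [(z - S)^-1 x]; then [z y_k = x_k + y_(k+1)].  By
   Cauchy's theorem the [k]-th coefficient of [h(S) x] is the mean of [z^k h(z) z y_0(z)]
   over a circle of radius [> 1], and the mean of [z^k z y_0(z)] is [x_k].  So [h(S) x = w x]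
   says that the functional [f |-> mean (f(z) z y_0(z))] kills every [z^k (h - w)], hence
   every [F (h - w)] with [F] holomorphic near the closed disk.  As [h - w] has only finitely
   many zeros [l_i] near the closed disk, all simple and in the open disk, [z^k] minus its
   Lagrange interpolant at the [l_i] is such a product, whence [x_k = sum_i c_i l_i^k]: the
   kernel is spanned by the eigenvectors [k_(l_i)] of [S].  The [l_i] are locally holomorphic
   in [w] by the inverse function theorem, which gives holomorphic frames, and their number
   is locally constant, hence constant on [Omega].

   Since [h] is only assumed to be complex differentiable at each point, Cauchy's theorem is
   obtained from Goursat's bisection argument. *)

Local Open Scope R_scope.

(** * Complex differentiability *)

(** Every contour is a circle centred at 0 and is integrated in the angle: [dz = i z dt] accounts
    for the extra factor [z] in all the Cauchy formulas. Circles are compared only by changing their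
    radius, which the exponential reduces to rectangles. The contour of the calculus has radius
    greater than 1, because 1 lies in the spectrum, while the fibre lies in the open unit disc; the
    integrals are therefore first moved to a circle so close to the unit circle that it encloses no
    zero of [h - w] outside the fibre. The quotient by [h - w] is only known to be continuous at the
    zeros, so Cauchy's theorem is proved for continuous functions that are differentiable off a
    finite list. Continuity of [h'] is not at hand either: the inverse function theorem runs on
    strict differentiability, read off Cauchy's formula. The limit [w_k -> 1] acts through
    comparisons of the weights up to factors [s ^ m], for each [s > 1]; they give the resolvent for
    [|z| > 1] and put the power sequence of [l] in the space for [|l| < 1]. *)

Lemma is_derive_eps (V : NormedModule C_AbsRing) (f : C -> V) (z : C) (l : V) :
  is_derive (K := C_AbsRing) f z l <->
  forall eps, 0 < eps -> exists delta, 0 < delta /\ forall w : C, Cmod (w - z) < delta ->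
    norm (minus (minus (f w) (f z)) (scal (w - z)%C l)) <= eps * Cmod (w - z).
Proof.
split.
- intros [_ H] eps He.
  destruct (H z (fun P HP => HP) (mkposreal eps He)) as [d Hd].
  exists d; split; [apply cond_pos | intros w Hw]. exact (Hd w Hw).
- intros H. split; [apply is_linear_scal_l | ].
  intros x Hx. apply (@is_filter_lim_locally_unique C_AbsRing (AbsRing_NormedModule C_AbsRing)) in Hx.
  subst x. intros eps. destruct (H eps (cond_pos eps)) as [d [Hd H']].
  exists (mkposreal d Hd). intros w Hw. exact (H' w Hw).
Qed.

Definition ccont (f : C -> C) (z : C) : Prop :=
  forall eps, 0 < eps -> exists delta, 0 < delta /\
    forall w : C, Cmod (w - z) < delta -> Cmod (f w - f z) < eps.

(** The source is [C] as an absolute value ring, whose balls are discs; the target [C_NormedModule]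
    has squares as balls. The epsilon form below hides the difference. *)
Definition cdiff (f : C -> C) (z d : C) : Prop :=
  is_derive (K := C_AbsRing) (V := C_NormedModule) f z d.

Definition ex_cdiff (f : C -> C) (z : C) : Prop :=
  ex_derive (K := C_AbsRing) (V := C_NormedModule) f z.

Lemma cdiff_eps (f : C -> C) (z d : C) :
  cdiff f z d <->
  forall eps, 0 < eps -> exists delta, 0 < delta /\ forall w : C, Cmod (w - z) < delta ->
    Cmod (f w - f z - d * (w - z)) <= eps * Cmod (w - z).
Proof.
unfold cdiff. rewrite is_derive_eps.
split; intros H eps He; destruct (H eps He) as [d' [Hd H']]; exists d'; (split; [exact Hd | ]);
  intros w Hw; specialize (H' w Hw);
  (replace (f w - f z - d * (w - z))%C with (f w - f z - (w - z) * d)%C by ring) ||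
  (replace (f w - f z - d * (w - z))%C with (f w - f z - (w - z) * d)%C in H' by ring);
  exact H'.
Qed.

Lemma Cmod_minus_sym (x y : C) : Cmod (x - y) = Cmod (y - x).
Proof. rewrite <- Cmod_opp. f_equal. ring. Qed.

Lemma Cmod_sub (x y z : C) : Cmod (x - z) <= Cmod (x - y) + Cmod (y - z).
Proof. replace (x - z)%C with ((x - y) + (y - z))%C by ring. apply Cmod_triangle. Qed.

Lemma Cmod_sub_le (x y : C) : Cmod x - Cmod y <= Cmod (x - y).
Proof.
assert (H := Cmod_triangle (x - y) y). replace (x - y + y)%C with x in H by ring. lra.
Qed.

Lemma Cmod_le_sub (x y : C) : Cmod x <= Cmod y + Cmod (x - y).
Proof. assert (H := Cmod_sub_le x y). lra. Qed.

Lemma Cmod_sub_add (x y : C) : Cmod (x - y) <= Cmod x + Cmod y.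
Proof. assert (H := Cmod_triangle x (- y)). rewrite Cmod_opp in H. exact H. Qed.

Lemma Csub_neq0 (x y : C) : x <> y -> (x - y)%C <> 0%C.
Proof. intros H E. apply H. replace x with (x - y + y)%C by ring. rewrite E. ring. Qed.

Lemma Csub_eq0 (x y : C) : (x - y)%C = 0%C -> x = y.
Proof. intros E. replace x with (x - y + y)%C by ring. rewrite E. ring. Qed.

Lemma cdiff_ccont (f : C -> C) (z d : C) : cdiff f z d -> ccont f z.
Proof.
intros H eps He. destruct (proj1 (cdiff_eps f z d) H 1 Rlt_0_1) as [e [He' H']].
assert (P := Cmod_ge_0 d). set (k := Cmod d + 1).
assert (Pk : 0 < k) by (unfold k; lra).
exists (Rmin e (eps / k)). split.
- apply Rmin_pos; [lra | apply Rdiv_lt_0_compat; lra].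
- intros w Hw. assert (A := Rmin_l e (eps / k)). assert (B := Rmin_r e (eps / k)).
  specialize (H' w ltac:(lra)).
  assert (T := Cmod_triangle (f w - f z - d * (w - z)) (d * (w - z))).
  replace (f w - f z - d * (w - z) + d * (w - z))%C with (f w - f z)%C in T by ring.
  rewrite Cmod_mult in T.
  assert (Cmod (f w - f z) <= k * Cmod (w - z)) by (unfold k; lra).
  apply Rle_lt_trans with (1 := H0).
  apply Rlt_le_trans with (k * (eps / k)).
  + apply Rmult_lt_compat_l; lra.
  + right. field. lra.
Qed.

Lemma ex_cdiff_ccont f z : ex_cdiff f z -> ccont f z.
Proof. intros [d H]. apply cdiff_ccont with d; exact H. Qed.

Lemma ccont_const c z : ccont (fun _ => c) z.
Proof. intros eps He. exists 1; split; [lra | ]. intros w _. unfold Cminus. rewrite Cplus_opp_r, Cmod_0. exact He. Qed.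

Lemma ccont_id z : ccont (fun w => w) z.
Proof. intros eps He. exists eps; split; [exact He | ]. intros w H; exact H. Qed.

Lemma ccont_ext_loc f g z e : 0 < e -> (forall w, Cmod (w - z) < e -> f w = g w) -> ccont f z -> ccont g z.
Proof.
intros He E H eps Heps. destruct (H eps Heps) as [d [Hd H']].
exists (Rmin d e). split; [apply Rmin_pos; assumption | ].
intros w Hw. assert (A := Rmin_l d e). assert (B := Rmin_r d e).
rewrite <- !E; [apply H'; lra | | lra].
unfold Cminus. rewrite Cplus_opp_r, Cmod_0. exact He.
Qed.

Lemma ccont_plus f g z : ccont f z -> ccont g z -> ccont (fun w => f w + g w)%C z.
Proof.
intros Hf Hg eps He. destruct (Hf (eps / 2) ltac:(lra)) as [d1 [H1 K1]].
destruct (Hg (eps / 2) ltac:(lra)) as [d2 [H2 K2]].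
exists (Rmin d1 d2). split; [apply Rmin_pos; assumption | ].
intros w Hw. assert (A := Rmin_l d1 d2). assert (B := Rmin_r d1 d2).
specialize (K1 w ltac:(lra)). specialize (K2 w ltac:(lra)).
replace (f w + g w - (f z + g z))%C with ((f w - f z) + (g w - g z))%C by ring.
apply Rle_lt_trans with (1 := Cmod_triangle _ _). lra.
Qed.

Lemma ccont_opp f z : ccont f z -> ccont (fun w => - f w)%C z.
Proof.
intros Hf eps He. destruct (Hf eps He) as [d [Hd H]]. exists d; split; [exact Hd | ].
intros w Hw. replace (- f w - - f z)%C with (- (f w - f z))%C by ring. rewrite Cmod_opp. auto.
Qed.

Lemma ccont_minus f g z : ccont f z -> ccont g z -> ccont (fun w => f w - g w)%C z.
Proof. intros Hf Hg. apply ccont_plus; [exact Hf | apply ccont_opp; exact Hg]. Qed.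

Lemma ccont_mult f g z : ccont f z -> ccont g z -> ccont (fun w => f w * g w)%C z.
Proof.
intros Hf Hg eps He.
assert (Pf := Cmod_ge_0 (f z)). assert (Pg := Cmod_ge_0 (g z)).
set (k := Cmod (f z) + Cmod (g z) + 1). assert (Pk : 0 < k) by (unfold k; lra).
assert (Q : 0 < Rmin 1 (eps / k)) by (apply Rmin_pos; [lra | apply Rdiv_lt_0_compat; lra]).
destruct (Hf _ Q) as [d1 [H1 K1]]. destruct (Hg _ Q) as [d2 [H2 K2]].
exists (Rmin d1 d2). split; [apply Rmin_pos; assumption | ].
intros w Hw. assert (A := Rmin_l d1 d2). assert (B := Rmin_r d1 d2).
specialize (K1 w ltac:(lra)). specialize (K2 w ltac:(lra)).
set (m := Rmin 1 (eps / k)) in *.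
assert (m1 : m <= 1) by apply Rmin_l. assert (m2 : m <= eps / k) by apply Rmin_r.
replace (f w * g w - f z * g z)%C with
  ((f w - f z) * (g w - g z) + f z * (g w - g z) + (f w - f z) * g z)%C by ring.
assert (T := Cmod_triangle ((f w - f z) * (g w - g z) + f z * (g w - g z)) ((f w - f z) * g z)).
assert (T2 := Cmod_triangle ((f w - f z) * (g w - g z)) (f z * (g w - g z))).
rewrite !Cmod_mult in *.
assert (P1 := Cmod_ge_0 (f w - f z)). assert (P2 := Cmod_ge_0 (g w - g z)).
set (x := Cmod (f w - f z)) in *. set (y := Cmod (g w - g z)) in *.
set (u := Cmod (f z)) in *. set (v := Cmod (g z)) in *.
assert (x * y + u * y + x * v < k * m).
{ unfold k. assert (x * y <= x * m) by (apply Rmult_le_compat_l; lra).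
  assert (x * m <= x * 1) by (apply Rmult_le_compat_l; lra).
  assert (u * y <= u * m) by (apply Rmult_le_compat_l; lra).
  assert (x * v <= m * v) by (apply Rmult_le_compat_r; lra). lra. }
assert (k * m <= k * (eps / k)) by (apply Rmult_le_compat_l; lra).
replace (k * (eps / k)) with eps in H0 by (field; lra). lra.
Qed.

Lemma ccont_inv f z : ccont f z -> f z <> 0%C -> ccont (fun w => / f w)%C z.
Proof.
intros Hf Hz eps He.
assert (Pz := proj1 (Cmod_gt_0 _) Hz). set (u := Cmod (f z)) in *.
assert (Q : 0 < Rmin (u / 2) (eps * (u * u / 2))).
{ apply Rmin_pos; [lra | ]. apply Rmult_lt_0_compat; [lra | ].
  apply Rdiv_lt_0_compat; [apply Rmult_lt_0_compat; lra | lra]. }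
destruct (Hf _ Q) as [d [Hd H]]. exists d; split; [exact Hd | ].
intros w Hw. specialize (H w Hw).
assert (A := Rmin_l (u / 2) (eps * (u * u / 2))). assert (B := Rmin_r (u / 2) (eps * (u * u / 2))).
assert (T := Cmod_sub_le (f z) (f w)). rewrite (Cmod_minus_sym (f z)) in T. fold u in T.
assert (W : u / 2 < Cmod (f w)) by lra.
assert (Nw : f w <> 0%C) by (apply Cmod_gt_0; lra).
replace (/ f w - / f z)%C with (- ((f w - f z) / (f w * f z)))%C by (field; split; assumption).
rewrite Cmod_opp, Cmod_div, Cmod_mult by (apply Cmult_neq_0; assumption). fold u.
assert (0 < Cmod (f w) * u) by (apply Rmult_lt_0_compat; lra).
apply Rmult_lt_reg_r with (Cmod (f w) * u); [assumption | ].
unfold Rdiv. rewrite Rmult_assoc, Rinv_l, Rmult_1_r by lra.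
assert (u * u / 2 <= Cmod (f w) * u).
{ replace (u * u / 2) with (u / 2 * u) by field. apply Rmult_le_compat_r; lra. }
assert (eps * (u * u / 2) <= eps * (Cmod (f w) * u)) by (apply Rmult_le_compat_l; lra).
lra.
Qed.

Lemma ccont_comp f g z : ccont g z -> ccont f (g z) -> ccont (fun w => f (g w)) z.
Proof.
intros Hg Hf eps He. destruct (Hf eps He) as [d [Hd H]].
destruct (Hg d Hd) as [d' [Hd' H']]. exists d'; split; [exact Hd' | ].
intros w Hw. apply H, H', Hw.
Qed.

Lemma ccont_pow n z : ccont (fun w => w ^ n)%C z.
Proof.
induction n as [ | n IH]; [exact (ccont_const 1 z) | ].
exact (ccont_mult _ _ _ (ccont_id z) IH).
Qed.

Lemma ex_cdiff_const c z : ex_cdiff (fun _ => c) z.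
Proof. exists zero. apply (is_derive_const (K := C_AbsRing) (V := C_NormedModule)). Qed.

Lemma ex_cdiff_id z : ex_cdiff (fun w => w) z.
Proof.
exists (RtoC 1). apply cdiff_eps. intros eps He. exists 1; split; [lra | ]. intros w _.
replace (w - z - 1 * (w - z))%C with (RtoC 0) by ring. rewrite Cmod_0.
apply Rmult_le_pos; [lra | apply Cmod_ge_0].
Qed.

Lemma ex_cdiff_plus f g z : ex_cdiff f z -> ex_cdiff g z -> ex_cdiff (fun w => f w + g w)%C z.
Proof. apply (ex_derive_plus (K := C_AbsRing) (V := C_NormedModule)). Qed.

Lemma ex_cdiff_minus f g z : ex_cdiff f z -> ex_cdiff g z -> ex_cdiff (fun w => f w - g w)%C z.
Proof. apply (ex_derive_minus (K := C_AbsRing) (V := C_NormedModule)). Qed.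

(* Differentiability at [z] is continuity of the slope (Caratheodory). *)
Lemma ex_cdiff_slope f z :
  ex_cdiff f z <-> exists q, ccont q z /\ forall w, (f w - f z = (w - z) * q w)%C.
Proof.
split.
- intros [d Hd]. change (cdiff f z d) in Hd. rewrite cdiff_eps in Hd.
  exists (fun w => if excluded_middle_informative (w = z) then d else (f w - f z) / (w - z))%C.
  split.
  + intros eps He. destruct (Hd (eps / 2) ltac:(lra)) as [e [He' H]].
    exists e; split; [exact He' | ]. intros w Hw.
    destruct (excluded_middle_informative (z = z)) as [_ | N]; [ | now destruct N].
    destruct (excluded_middle_informative (w = z)) as [-> | N].
    * unfold Cminus. rewrite Cplus_opp_r, Cmod_0. exact He.
    * specialize (H w Hw). apply Csub_neq0 in N.
      assert (P := proj1 (Cmod_gt_0 _) N).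
      replace ((f w - f z) / (w - z) - d)%C with ((f w - f z - d * (w - z)) / (w - z))%C
        by (field; exact N).
      rewrite Cmod_div by exact N. apply Rmult_lt_reg_r with (Cmod (w - z)); [exact P | ].
      unfold Rdiv. rewrite Rmult_assoc, Rinv_l, Rmult_1_r by lra.
      apply Rle_lt_trans with (1 := H). apply Rmult_lt_compat_r; lra.
  + intros w. destruct (excluded_middle_informative (w = z)) as [-> | N]; [ring | ].
    field. apply Csub_neq0; exact N.
- intros [q [Hq E]]. exists (q z). apply cdiff_eps. intros eps He.
  destruct (Hq eps He) as [d [Hd H]]. exists d; split; [exact Hd | ].
  intros w Hw. rewrite E. replace ((w - z) * q w - q z * (w - z))%C with ((q w - q z) * (w - z))%C by ring.
  rewrite Cmod_mult. apply Rmult_le_compat_r; [apply Cmod_ge_0 | ]. apply Rlt_le, H, Hw.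
Qed.

Lemma ex_cdiff_mult f g z : ex_cdiff f z -> ex_cdiff g z -> ex_cdiff (fun w => f w * g w)%C z.
Proof.
intros Hf Hg. assert (Cg := ex_cdiff_ccont _ _ Hg).
apply ex_cdiff_slope in Hf. apply ex_cdiff_slope in Hg. apply ex_cdiff_slope.
destruct Hf as [p [Hp Ep]], Hg as [q [Hq Eq]].
exists (fun w => p w * g w + f z * q w)%C. split.
- apply ccont_plus; apply ccont_mult; try assumption. apply ccont_const.
- intros w. transitivity ((f w - f z) * g w + f z * (g w - g z))%C; [ring | ].
  rewrite Ep, Eq. ring.
Qed.

(** The slope criterion asks for an identity at every [w], including those where [f w = 0], so the
    estimate is made directly near [z], where [f] does not vanish. *)
Lemma ex_cdiff_inv f z : ex_cdiff f z -> f z <> 0%C -> ex_cdiff (fun w => / f w)%C z.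
Proof.
intros Hf Hz. assert (Cf := ex_cdiff_ccont _ _ Hf).
destruct (proj1 (ex_cdiff_slope _ _) Hf) as [p [Hp Ep]].
assert (Pz := proj1 (Cmod_gt_0 _) Hz).
destruct (Cf _ Pz) as [e [He H]].
assert (N : forall w, Cmod (w - z) < e -> f w <> 0%C).
{ intros w Hw E. specialize (H w Hw). rewrite E in H.
  rewrite Cmod_minus_sym in H. unfold Cminus in H. rewrite Copp_0, Cplus_0_r in H. lra. }
exists (- p z / (f z * f z))%C. apply cdiff_eps. intros eps Heps.
assert (Cq : ccont (fun w => - (p w * / (f w * f z)))%C z).
{ apply ccont_opp, ccont_mult; [exact Hp | ]. apply ccont_inv.
  - apply ccont_mult; [exact Cf | apply ccont_const].
  - apply Cmult_neq_0; exact Hz. }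
destruct (Cq eps Heps) as [d [Hd K]].
exists (Rmin d e). split; [apply Rmin_pos; assumption | ].
intros w Hw. assert (A := Rmin_l d e). assert (B := Rmin_r d e).
specialize (K w ltac:(lra)). specialize (N w ltac:(lra)).
replace (/ f w - / f z)%C with (- ((f w - f z) / (f w * f z)))%C by (field; split; assumption).
rewrite Ep.
replace (- ((w - z) * p w / (f w * f z)) - - p z / (f z * f z) * (w - z))%C
  with ((- (p w * / (f w * f z)) - - (p z * / (f z * f z))) * (w - z))%C by (field; split; assumption).
rewrite Cmod_mult. apply Rmult_le_compat_r; [apply Cmod_ge_0 | lra].
Qed.

Lemma ex_cdiff_pow n z : ex_cdiff (fun w => w ^ n)%C z.
Proof.
induction n as [ | n IH]; [exact (ex_cdiff_const 1 z) | ].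
exact (ex_cdiff_mult _ _ _ (ex_cdiff_id z) IH).
Qed.

Lemma ex_cdiff_comp f g z : ex_cdiff f (g z) -> ex_cdiff g z -> ex_cdiff (fun w => f (g w)) z.
Proof.
intros Hf Hg. assert (Cg := ex_cdiff_ccont _ _ Hg).
apply ex_cdiff_slope in Hf. apply ex_cdiff_slope in Hg. apply ex_cdiff_slope.
destruct Hf as [p [Hp Ep]], Hg as [q [Hq Eq]].
exists (fun w => q w * p (g w))%C. split.
- apply ccont_mult; [exact Hq | apply ccont_comp; assumption].
- intros w. rewrite Ep, Eq. ring.
Qed.

Lemma ex_cdiff_ext_loc f g z e : 0 < e -> (forall w, Cmod (w - z) < e -> f w = g w) ->
  ex_cdiff f z -> ex_cdiff g z.
Proof.
intros He E. apply (ex_derive_ext_loc (K := C_AbsRing) (V := C_NormedModule)).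
exists (mkposreal e He). intros w Hw. apply E. exact Hw.
Qed.

Lemma open_C_ball (U : C -> Prop) : open (T := C_UniformSpace) U <->
  forall z, U z -> exists d, 0 < d /\ forall w, Cmod (w - z) < d -> U w.
Proof.
split.
- intros H z Hz. destruct (H z Hz) as [e He]. exists e; split; [apply cond_pos | ].
  intros w Hw. apply He. apply C_NormedModule_mixin_compat1. exact Hw.
- intros H z Hz. destruct (H z Hz) as [d [Hd K]].
  (* The balls of [C_UniformSpace] are squares; the one of half-side [d / sqrt 2] fits in the disc
     of radius [d]. *)
  assert (P : 0 < d / sqrt 2) by (apply Rdiv_lt_0_compat; [exact Hd | apply sqrt_lt_R0; lra]).
  exists (mkposreal _ P). intros w Hw. apply K.
  assert (Q := C_NormedModule_mixin_compat2 z w (mkposreal _ P) Hw). simpl in Q.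
  replace (sqrt 2 * (d / sqrt 2)) with d in Q by (field; apply Rgt_not_eq, sqrt_lt_R0; lra).
  exact Q.
Qed.

(** * Integrals of complex functions and bisection *)

Lemma Riemann_sum_linear (U V : NormedModule R_AbsRing) (l : U -> V) (f : R -> U) (ptd : SF_seq) :
  is_linear l -> Riemann_sum (fun t => l (f t)) ptd = l (Riemann_sum f ptd).
Proof.
intros Hl. apply (SF_cons_ind (fun ptd => Riemann_sum (fun t => l (f t)) ptd = l (Riemann_sum f ptd))).
- intros x0. symmetry. exact (linear_zero l Hl).
- intros h0 s IH. rewrite !Riemann_sum_cons, IH, (linear_plus l Hl), (linear_scal l Hl). reflexivity.
Qed.

(** Serves twice: complex constants leave integrals taken over real scalars, and coefficient
    functionals pass through vector-valued integrals. *)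
Lemma is_RInt_linear (U V : NormedModule R_AbsRing) (l : U -> V) (f : R -> U) (a b : R) (I : U) :
  is_linear l -> is_RInt f a b I -> is_RInt (fun t => l (f t)) a b (l I).
Proof.
intros Hl HI. unfold is_RInt.
apply filterlim_ext with (fun ptd => l (scal (sign (b - a)) (Riemann_sum f ptd))).
- intros ptd. rewrite (linear_scal l Hl), (Riemann_sum_linear U V l f ptd Hl). reflexivity.
- apply filterlim_comp with (1 := HI). exact (linear_cont l I Hl).
Qed.

Definition rcont (f : R -> C) (t : R) : Prop :=
  forall eps, 0 < eps -> exists delta, 0 < delta /\
    forall s, Rabs (s - t) < delta -> Cmod (f s - f t) < eps.

Definition rcont_on (f : R -> C) (a b : R) : Prop := forall t, a <= t <= b -> rcont f t.

Lemma rcont_continuous (f : R -> C) t :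
  rcont f t -> continuous (T := R_UniformSpace) (U := C_R_CompleteNormedModule) f t.
Proof.
intros H P [e He]. destruct (H e (cond_pos e)) as [d [Hd K]].
exists (mkposreal d Hd). intros s Hs. apply He.
apply (C_NormedModule_mixin_compat1 (f t) (f s)). apply K. exact Hs.
Qed.

Lemma rcont_comp (f : C -> C) (g : R -> C) t : rcont g t -> ccont f (g t) -> rcont (fun s => f (g s)) t.
Proof.
intros Hg Hf eps He. destruct (Hf eps He) as [d [Hd H]].
destruct (Hg d Hd) as [d' [Hd' H']]. exists d'; split; [exact Hd' | ].
intros s Hs. apply H, H', Hs.
Qed.

Lemma rcont_pair (f g : R -> R) t : continuity_pt f t -> continuity_pt g t ->
  rcont (fun s => (f s, g s)) t.
Proof.
intros Hf Hg eps He.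
assert (P : 0 < eps / 2) by lra.
rewrite continuity_pt_locally in Hf, Hg.
destruct (Hf (mkposreal _ P)) as [d1 K1]. destruct (Hg (mkposreal _ P)) as [d2 K2].
exists (Rmin d1 d2). split; [apply Rmin_pos; apply cond_pos | ].
intros s Hs. assert (A := Rmin_l d1 d2). assert (B := Rmin_r d1 d2).
assert (E1 : Rabs (s - t) < d1) by lra. assert (E2 : Rabs (s - t) < d2) by lra.
specialize (K1 s E1). specialize (K2 s E2). simpl in K1, K2.
replace ((f s, g s) - (f t, g t))%C with (RtoC (f s - f t) + Ci * RtoC (g s - g t))%C
  by (unfold Cminus, Cplus, Copp, Cmult, Ci, RtoC; simpl; f_equal; ring).
apply Rle_lt_trans with (1 := Cmod_triangle _ _).
rewrite Cmod_mult, Cmod_Ci, !Cmod_R. lra.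
Qed.

Lemma rcont_minus f g t : rcont f t -> rcont g t -> rcont (fun s => f s - g s)%C t.
Proof.
intros Hf Hg eps He. destruct (Hf (eps / 2) ltac:(lra)) as [d1 [H1 K1]].
destruct (Hg (eps / 2) ltac:(lra)) as [d2 [H2 K2]].
exists (Rmin d1 d2). split; [apply Rmin_pos; assumption | ].
intros w Hw. assert (A := Rmin_l d1 d2). assert (B := Rmin_r d1 d2).
specialize (K1 w ltac:(lra)). specialize (K2 w ltac:(lra)).
replace (f w - g w - (f t - g t))%C with ((f w - f t) - (g w - g t))%C by ring.
apply Rle_lt_trans with (1 := Cmod_sub_add _ _). lra.
Qed.

Definition CI (f : R -> C) (a b : R) : C := RInt (V := C_R_CompleteNormedModule) f a b.

Lemma CI_correct f a b : a <= b -> rcont_on f a b ->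
  is_RInt (V := C_R_CompleteNormedModule) f a b (CI f a b).
Proof.
intros L H. apply RInt_correct, ex_RInt_continuous.
rewrite Rmin_left, Rmax_right by exact L. intros t Ht. apply rcont_continuous, H, Ht.
Qed.

Lemma CI_unique f a b l : is_RInt (V := C_R_CompleteNormedModule) f a b l -> CI f a b = l.
Proof. exact (is_RInt_unique (V := C_R_CompleteNormedModule) f a b l). Qed.

Lemma CI_ext f g a b : a <= b -> (forall t, a < t < b -> f t = g t) -> CI f a b = CI g a b.
Proof.
intros L H. apply (RInt_ext (V := C_R_CompleteNormedModule)). rewrite Rmin_left, Rmax_right by exact L. exact H.
Qed.

Lemma CI_plus f g a b : a <= b -> rcont_on f a b -> rcont_on g a b ->
  CI (fun t => f t + g t)%C a b = (CI f a b + CI g a b)%C.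
Proof.
intros L Hf Hg. apply CI_unique.
apply (is_RInt_plus (V := C_R_CompleteNormedModule)); apply CI_correct; assumption.
Qed.

Lemma CI_minus f g a b : a <= b -> rcont_on f a b -> rcont_on g a b ->
  CI (fun t => f t - g t)%C a b = (CI f a b - CI g a b)%C.
Proof.
intros L Hf Hg. apply CI_unique.
apply (is_RInt_minus (V := C_R_CompleteNormedModule)); apply CI_correct; assumption.
Qed.

Lemma Cmult_linear (c : C) : is_linear (K := R_AbsRing) (U := C_R_NormedModule) (V := C_R_NormedModule)
  (fun z : C => Cmult c z).
Proof.
split.
- intros x y. apply Cmult_plus_distr_l.
- intros k x. destruct x as [x1 x2], c as [c1 c2].
  unfold Cmult; simpl. unfold scal; simpl. unfold prod_scal; simpl.
  unfold scal; simpl. unfold mult; simpl. f_equal; ring.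
- exists (Cmod c + 1). assert (P := Cmod_ge_0 c). split; [lra | ].
  intros x. rewrite <- !Cmod_norm, Cmod_mult.
  apply Rmult_le_compat_r; [apply Cmod_ge_0 | lra].
Qed.

Lemma CI_scal c f a b : a <= b -> rcont_on f a b ->
  CI (fun t => c * f t)%C a b = (c * CI f a b)%C.
Proof.
intros L Hf. apply CI_unique.
apply (is_RInt_linear C_R_NormedModule C_R_NormedModule (fun z : C => Cmult c z)).
- apply Cmult_linear.
- apply CI_correct; assumption.
Qed.

Lemma CI_const c a b : CI (fun _ => c) a b = (RtoC (b - a) * c)%C.
Proof.
unfold CI. rewrite RInt_const. destruct c as [c1 c2].
unfold scal; simpl. unfold prod_scal, scal; simpl. unfold mult; simpl.
unfold RtoC, Cmult; simpl. f_equal; ring.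
Qed.

Lemma CI_Chasles f a b c : a <= b -> b <= c -> rcont_on f a c ->
  CI f a c = (CI f a b + CI f b c)%C.
Proof.
intros L1 L2 H. symmetry. apply (RInt_Chasles (V := C_R_CompleteNormedModule)).
- eexists. apply CI_correct; [exact L1 | ]. intros t Ht. apply H. lra.
- eexists. apply CI_correct; [exact L2 | ]. intros t Ht. apply H. lra.
Qed.

Lemma CI_bound f a b M : a <= b -> rcont_on f a b ->
  (forall t, a <= t <= b -> Cmod (f t) <= M) -> Cmod (CI f a b) <= (b - a) * M.
Proof.
intros L H B. rewrite Cmod_norm.
apply (norm_RInt_le_const (V := C_R_CompleteNormedModule) f a b); [exact L | | ].
- intros t Ht. assert (Q := B t Ht). rewrite Cmod_norm in Q. exact Q.
- apply CI_correct; assumption.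
Qed.

(** The supremum of the left ends works, since every right end is an upper bound of them. *)
Lemma nested_point (x w : nat -> R) :
  (forall n, x n <= x (S n)) -> (forall n, x (S n) + w (S n) <= x n + w n) -> (forall n, 0 <= w n) ->
  exists p, forall n, x n <= p <= x n + w n.
Proof.
intros Hx Hw Hp.
assert (I : forall n k, x n <= x (n + k)%nat).
{ intros n k. induction k as [ | k IH]; [rewrite Nat.add_0_r; lra | ].
  rewrite Nat.add_succ_r. specialize (Hx (n + k)%nat). lra. }
assert (D : forall n k, x (n + k)%nat + w (n + k)%nat <= x n + w n).
{ intros n k. induction k as [ | k IH]; [rewrite Nat.add_0_r; lra | ].
  rewrite Nat.add_succ_r. specialize (Hw (n + k)%nat). lra. }
assert (B : forall n m, x n <= x m + w m).
{ intros n m. apply Rle_trans with (1 := I n m).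
  rewrite (Nat.add_comm n m). specialize (D m n). specialize (Hp (m + n)%nat). lra. }
destruct (completeness (fun r => exists n, r = x n)) as [p [U L]].
- exists (x O + w O). intros r [n ->]. apply B.
- exists (x O), O. reflexivity.
- exists p. intros n. split; [apply U; exists n; reflexivity | ].
  apply L. intros r [m ->]. apply B.
Qed.

(* [Q x y n] is a property of the rectangle with lower left corner [(x, y)] and
   sides [W / 2 ^ n] and [L / 2 ^ n]. *)
Lemma bisection_2d (W L : R) (Q : R -> R -> nat -> Prop) :
  0 <= W -> 0 <= L ->
  (forall x y n, Q x y (S n) -> Q (x + W / 2 ^ S n) y (S n) ->
     Q x (y + L / 2 ^ S n) (S n) -> Q (x + W / 2 ^ S n) (y + L / 2 ^ S n) (S n) -> Q x y n) ->
  forall x0 y0,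
  (forall p q, x0 <= p <= x0 + W -> y0 <= q <= y0 + L ->
     exists N, forall n x y, (N <= n)%nat -> x <= p <= x + W / 2 ^ n -> y <= q <= y + L / 2 ^ n -> Q x y n) ->
  Q x0 y0 O.
Proof.
(* A rectangle without [Q] has a quarter without [Q]; the nested bad rectangles shrink to a point,
   where the local hypothesis contradicts them. *)
intros HW HL Split x0 y0 Loc. apply NNPP. intros N0.
assert (P2 : forall n, 0 < / 2 ^ n) by (intros n; apply Rinv_0_lt_compat, pow_lt; lra).
assert (H2 : forall X n, X / 2 ^ n = X / 2 ^ S n + X / 2 ^ S n).
{ intros X n. simpl. field. apply pow_nonzero; lra. }
assert (Pos : forall X n, 0 <= X -> 0 <= X / 2 ^ n).
{ intros X n HX. apply Rmult_le_pos; [exact HX | apply Rlt_le, P2]. }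
assert (Step : forall n (c : {c : R * R | ~ Q (fst c) (snd c) n}),
  {c' : {c' : R * R | ~ Q (fst c') (snd c') (S n)} |
    (fst (proj1_sig c) <= fst (proj1_sig c') <= fst (proj1_sig c) + W / 2 ^ S n) /\
    (snd (proj1_sig c) <= snd (proj1_sig c') <= snd (proj1_sig c) + L / 2 ^ S n)}).
{ intros n [[x y] Hc]. simpl in Hc. apply constructive_indefinite_description. cbn [proj1_sig fst snd].
  assert (PW := Pos W (S n) HW). assert (PL := Pos L (S n) HL).
  destruct (classic (Q x y (S n))) as [Q1 | Q1];
    [ | exists (exist _ (x, y) Q1); cbn [proj1_sig fst snd]; lra].
  destruct (classic (Q (x + W / 2 ^ S n) y (S n))) as [Q2 | Q2];
    [ | exists (exist _ (x + W / 2 ^ S n, y) Q2); cbn [proj1_sig fst snd]; lra].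
  destruct (classic (Q x (y + L / 2 ^ S n) (S n))) as [Q3 | Q3];
    [ | exists (exist _ (x, y + L / 2 ^ S n) Q3); cbn [proj1_sig fst snd]; lra].
  destruct (classic (Q (x + W / 2 ^ S n) (y + L / 2 ^ S n) (S n))) as [Q4 | Q4];
    [ | exists (exist _ (x + W / 2 ^ S n, y + L / 2 ^ S n) Q4); cbn [proj1_sig fst snd]; lra].
  exfalso. apply Hc, Split; assumption. }
set (s := nat_rect (fun n => {c : R * R | ~ Q (fst c) (snd c) n})
            (exist _ (x0, y0) N0) (fun n c => proj1_sig (Step n c))).
set (x := fun n => fst (proj1_sig (s n))). set (y := fun n => snd (proj1_sig (s n))).
assert (Hs : forall n, (x n <= x (S n) <= x n + W / 2 ^ S n) /\ (y n <= y (S n) <= y n + L / 2 ^ S n))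
  by (intros n; exact (proj2_sig (Step n (s n)))).
destruct (nested_point x (fun n => W / 2 ^ n)) as [p Hp].
{ intros n. apply Hs. }
{ intros n. rewrite (H2 W n). specialize (Hs n). lra. }
{ intros n. apply Pos, HW. }
destruct (nested_point y (fun n => L / 2 ^ n)) as [q Hq].
{ intros n. apply Hs. }
{ intros n. rewrite (H2 L n). specialize (Hs n). lra. }
{ intros n. apply Pos, HL. }
assert (Hp0 := Hp O). assert (Hq0 := Hq O). cbv beta in Hp0, Hq0.
unfold x in Hp0; unfold y in Hq0; simpl in Hp0, Hq0.
destruct (Loc p q) as [N HN]; [lra | lra | ].
apply (proj2_sig (s N)). apply HN; [lia | apply Hp | apply Hq].
Qed.

Lemma small_pow2 (X d : R) : 0 < d -> exists N, forall n, (N <= n)%nat -> X / 2 ^ n < d.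
Proof.
intros Hd. destruct (Rle_dec X 0) as [L | L].
{ exists O. intros n _. apply Rle_lt_trans with 0; [ | exact Hd].
  assert (P : 0 < / 2 ^ n) by (apply Rinv_0_lt_compat, pow_lt; lra). unfold Rdiv. nra. }
destruct (Pow_x_infinity 2 ltac:(rewrite Rabs_pos_eq; lra) (X / d + 1)) as [N HN].
exists N. intros n Hn. specialize (HN n Hn).
assert (P : 0 < 2 ^ n) by (apply pow_lt; lra). rewrite Rabs_pos_eq in HN by lra.
apply Rmult_lt_reg_r with (2 ^ n); [exact P | ]. unfold Rdiv. rewrite Rmult_assoc, Rinv_l, Rmult_1_r by lra.
apply Rlt_le_trans with (d * (X / d + 1)); [ | apply Rmult_le_compat_l; lra].
replace (d * (X / d + 1)) with (X + d) by (field; lra). lra.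
Qed.

(** * The theorem of Goursat *)

(* Opposite sides of the rectangle are paired, so that the affine part of [F] only
   contributes constant integrands. *)
Definition rect_int (F : C -> C) (a b c d : R) : C :=
  (CI (fun x => F (x, c) - F (x, d)) a b + Ci * CI (fun y => F (b, y) - F (a, y)) c d)%C.

Definition in_rect (a b c d : R) (z : C) : Prop := a <= fst z <= b /\ c <= snd z <= d.

Lemma rcont_hslice F x y : ccont F (x, y) -> rcont (fun t => F (t, y)) x.
Proof.
intros H. apply (rcont_comp F (fun t => (t, y))); [ | exact H].
apply rcont_pair; [apply continuity_pt_id | apply continuity_pt_const; now intros ? ?].
Qed.

Lemma rcont_vslice F x y : ccont F (x, y) -> rcont (fun t => F (x, t)) y.
Proof.
intros H. apply (rcont_comp F (fun t => (x, t))); [ | exact H].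
apply rcont_pair; [apply continuity_pt_const; now intros ? ? | apply continuity_pt_id].
Qed.

Lemma rect_int_sides F a b c d : a <= b -> c <= d ->
  (forall z, in_rect a b c d z -> ccont F z) ->
  rect_int F a b c d =
  (CI (fun x => F (x, c)) a b - CI (fun x => F (x, d)) a b
   + Ci * (CI (fun y => F (b, y)) c d - CI (fun y => F (a, y)) c d))%C.
Proof.
intros L1 L2 H. unfold rect_int. rewrite !CI_minus; try assumption; [reflexivity | | | | ];
  intros t Ht; first [apply rcont_hslice | apply rcont_vslice]; apply H; split; simpl; lra.
Qed.

Lemma rect_int_split F a m b c k d : a <= m <= b -> c <= k <= d ->
  (forall z, in_rect a b c d z -> ccont F z) ->
  rect_int F a b c d =
  (rect_int F a m c k + rect_int F m b c k + rect_int F a m k d + rect_int F m b k d)%C.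
Proof.
intros L1 L2 H.
rewrite !rect_int_sides; try lra; try (intros z [A B]; apply H; split; lra).
assert (Hh : forall y, c <= y <= d ->
  CI (fun x => F (x, y)) a b = (CI (fun x => F (x, y)) a m + CI (fun x => F (x, y)) m b)%C).
{ intros y Hy. apply CI_Chasles; [lra | lra | ]. intros t Ht. apply rcont_hslice, H; split; simpl; lra. }
assert (Hv : forall x, a <= x <= b ->
  CI (fun y => F (x, y)) c d = (CI (fun y => F (x, y)) c k + CI (fun y => F (x, y)) k d)%C).
{ intros x Hx. apply CI_Chasles; [lra | lra | ]. intros t Ht. apply rcont_vslice, H; split; simpl; lra. }
rewrite (Hh c), (Hh d), (Hv a), (Hv b) by lra. ring.
Qed.

Lemma Cmod_pair (x y : R) : Cmod (x, y) <= Rabs x + Rabs y.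
Proof.
replace ((x, y) : C) with (RtoC x + Ci * RtoC y)%C
  by (unfold Cplus, Cmult, Ci, RtoC; simpl; f_equal; ring).
apply Rle_trans with (1 := Cmod_triangle _ _). rewrite Cmod_mult, Cmod_Ci, !Cmod_R. lra.
Qed.

(* Affine functions have a vanishing boundary integral, so only the remainder of
   the first order expansion at [z0] contributes. *)
Lemma rect_int_small F a b c d z0 A eta :
  a <= b -> c <= d -> in_rect a b c d z0 -> 0 <= eta ->
  (forall z, in_rect a b c d z -> ccont F z) ->
  (forall z, in_rect a b c d z -> Cmod (F z - F z0 - A * (z - z0)) <= eta * Cmod (z - z0)) ->
  Cmod (rect_int F a b c d) <= eta * (2 * (b - a + (d - c)) ^ 2).
Proof.
intros L1 L2 Hz0 He Hc H.
set (s := b - a + (d - c)).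
assert (Bd : forall z, in_rect a b c d z -> Cmod (F z - F z0 - A * (z - z0)) <= eta * s).
{ intros z Hz. apply Rle_trans with (1 := H z Hz). apply Rmult_le_compat_l; [exact He | ].
  destruct z as [x y], z0 as [p q]. destruct Hz as [Z1 Z2], Hz0 as [Y1 Y2]. simpl in *.
  apply Rle_trans with (1 := Cmod_pair _ _). unfold s.
  apply Rplus_le_compat; apply Rabs_le; simpl; lra. }
(* The increments of the affine part between opposite sides are constants whose integrals cancel:
   [(b - a) * Ci * (c - d)] against [Ci * (d - c) * (b - a)]. *)
assert (E : rect_int F a b c d =
  (CI (fun x => F (x, c) - F (x, d) - A * (Ci * RtoC (c - d))) a b
   + Ci * CI (fun y => F (b, y) - F (a, y) - A * RtoC (b - a)) c d)%C).
{ unfold rect_int.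
  assert (R1 : rcont_on (fun x => F (x, c) - F (x, d))%C a b).
  { intros t Ht. apply rcont_minus; apply rcont_hslice, Hc; split; simpl; lra. }
  assert (R2 : rcont_on (fun y => F (b, y) - F (a, y))%C c d).
  { intros t Ht. apply rcont_minus; apply rcont_vslice, Hc; split; simpl; lra. }
  assert (K : forall k x y, rcont_on (fun _ => k) x y).
  { intros k x y t _ eps Heps. exists 1; split; [lra | ]. intros ? _.
    unfold Cminus. rewrite Cplus_opp_r, Cmod_0. exact Heps. }
  rewrite (CI_minus (fun x => F (x, c) - F (x, d))%C (fun _ => A * (Ci * RtoC (c - d)))%C) by auto.
  rewrite (CI_minus (fun y => F (b, y) - F (a, y))%C (fun _ => A * RtoC (b - a))%C) by auto.
  rewrite !CI_const, !RtoC_minus. ring. }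
rewrite E. clear E.
apply Rle_trans with (1 := Cmod_triangle _ _). rewrite Cmod_mult, Cmod_Ci, Rmult_1_l.
assert (B1 : Cmod (CI (fun x => F (x, c) - F (x, d) - A * (Ci * RtoC (c - d)))%C a b)
   <= (b - a) * (2 * (eta * s))).
{ apply CI_bound; [exact L1 | | ].
  - intros t Ht. apply rcont_minus; [apply rcont_minus; apply rcont_hslice, Hc; split; simpl; lra | ].
    intros eps Heps. exists 1; split; [lra | ]. intros ? _.
    unfold Cminus. rewrite Cplus_opp_r, Cmod_0. exact Heps.
  - intros t Ht.
    replace (F (t, c) - F (t, d) - A * (Ci * RtoC (c - d)))%C with
      ((F (t, c) - F z0 - A * ((t, c) - z0)) - (F (t, d) - F z0 - A * ((t, d) - z0)))%C.
    + apply Rle_trans with (1 := Cmod_sub_add _ _).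
      assert (X := Bd (t, c) ltac:(split; simpl; lra)). assert (Y := Bd (t, d) ltac:(split; simpl; lra)). lra.
    + replace (Ci * RtoC (c - d))%C with (((t, c) : C) - (t, d))%C; [ring | ].
      unfold Cminus, Cplus, Copp, Cmult, Ci, RtoC; simpl; f_equal; ring. }
assert (B2 : Cmod (CI (fun y => F (b, y) - F (a, y) - A * RtoC (b - a))%C c d)
   <= (d - c) * (2 * (eta * s))).
{ apply CI_bound; [exact L2 | | ].
  - intros t Ht. apply rcont_minus; [apply rcont_minus; apply rcont_vslice, Hc; split; simpl; lra | ].
    intros eps Heps. exists 1; split; [lra | ]. intros ? _.
    unfold Cminus. rewrite Cplus_opp_r, Cmod_0. exact Heps.
  - intros t Ht.
    replace (F (b, t) - F (a, t) - A * RtoC (b - a))%C with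
      ((F (b, t) - F z0 - A * ((b, t) - z0)) - (F (a, t) - F z0 - A * ((a, t) - z0)))%C.
    + apply Rle_trans with (1 := Cmod_sub_add _ _).
      assert (X := Bd (b, t) ltac:(split; simpl; lra)). assert (Y := Bd (a, t) ltac:(split; simpl; lra)). lra.
    + replace (RtoC (b - a))%C with (((b, t) : C) - (a, t))%C; [ring | ].
      unfold Cminus, Cplus, Copp, RtoC; simpl; f_equal; ring. }
replace (eta * (2 * s ^ 2)) with ((b - a) * (2 * (eta * s)) + (d - c) * (2 * (eta * s)))
  by (unfold s; ring).
lra.
Qed.

Lemma Cmod_le_eps_0 (z : C) : (forall eps, 0 < eps -> Cmod z <= eps) -> z = 0%C.
Proof.
intros H. apply Cmod_eq_0. apply Rle_antisym; [ | apply Cmod_ge_0].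
apply le_epsilon. intros e He. rewrite Rplus_0_l. apply H, He.
Qed.

(** The bisected property is the bound [eps / 4 ^ n]. It adds up over four quarters, and near a
    point of differentiability a remainder of order [2 ^ -n] is integrated over sides of order
    [2 ^ -n]. *)
Theorem Goursat F a c W L : 0 <= W -> 0 <= L ->
  (forall z, in_rect a (a + W) c (c + L) z -> ex_cdiff F z) ->
  rect_int F a (a + W) c (c + L) = 0%C.
Proof.
intros HW HL HF. apply Cmod_le_eps_0. intros eps He.
assert (Fc : forall z, in_rect a (a + W) c (c + L) z -> ccont F z)
  by (intros z Hz; apply ex_cdiff_ccont, HF, Hz).
assert (P4 : forall n, 0 < 4 ^ n) by (intros n; apply pow_lt; lra).
assert (P2 : forall n, 0 < 2 ^ n) by (intros n; apply pow_lt; lra).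
assert (Pos : forall X n, 0 <= X -> 0 <= X / 2 ^ n).
{ intros X n HX. apply Rmult_le_pos; [exact HX | apply Rlt_le, Rinv_0_lt_compat, P2]. }
assert (H2 : forall X n, X / 2 ^ n = X / 2 ^ S n + X / 2 ^ S n).
{ intros X n. simpl. field. apply pow_nonzero; lra. }
(* Containment in the initial rectangle is part of the property, because [F] is controlled only
   there. *)
assert (G := bisection_2d W L (fun x y n => a <= x -> x + W / 2 ^ n <= a + W ->
  c <= y -> y + L / 2 ^ n <= c + L ->
  Cmod (rect_int F x (x + W / 2 ^ n) y (y + L / 2 ^ n)) <= eps / 4 ^ n) HW HL).
assert (Q : Cmod (rect_int F a (a + W / 2 ^ 0) c (c + L / 2 ^ 0)) <= eps / 4 ^ 0).
{ apply G; try (simpl; lra); clear G.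
  - intros x y n Q1 Q2 Q3 Q4 A1 A2 B1 B2.
    assert (PW := Pos W (S n) HW). assert (PL := Pos L (S n) HL).
    rewrite (H2 W n) in A2 |- *. rewrite (H2 L n) in B2 |- *.
    set (w := W / 2 ^ S n) in *. set (l := L / 2 ^ S n) in *.
    rewrite (rect_int_split F x (x + w) (x + (w + w)) y (y + l) (y + (l + l))); try lra.
    2: { intros z [Z1 Z2]. apply Fc; split; lra. }
    specialize (Q1 ltac:(lra) ltac:(lra) ltac:(lra) ltac:(lra)).
    specialize (Q2 ltac:(lra) ltac:(lra) ltac:(lra) ltac:(lra)).
    specialize (Q3 ltac:(lra) ltac:(lra) ltac:(lra) ltac:(lra)).
    specialize (Q4 ltac:(lra) ltac:(lra) ltac:(lra) ltac:(lra)).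
    rewrite (Rplus_assoc x) in Q2, Q4. rewrite (Rplus_assoc y) in Q3, Q4.
    replace (eps / 4 ^ n) with (eps / 4 ^ S n + eps / 4 ^ S n + eps / 4 ^ S n + eps / 4 ^ S n)
      by (simpl; field; apply pow_nonzero; lra).
    eapply Rle_trans; [apply Cmod_triangle | ]. apply Rplus_le_compat; [ | exact Q4].
    eapply Rle_trans; [apply Cmod_triangle | ]. apply Rplus_le_compat; [ | exact Q3].
    eapply Rle_trans; [apply Cmod_triangle | ]. apply Rplus_le_compat; [exact Q1 | exact Q2].
  - intros p q Hp Hq.
    destruct (HF (p, q)) as [A HA]; [split; simpl; lra | ].
    set (s := 2 * (W + L) ^ 2 + 1). assert (Ps : 0 < s) by (unfold s; nra).
    destruct (proj1 (cdiff_eps _ _ _) HA (eps / s)) as [d [Hd K]]; [apply Rdiv_lt_0_compat; lra | ].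
    destruct (small_pow2 (W + L) d Hd) as [N HN]. exists N.
    intros n x y Hn Hx Hy A1 A2 B1 B2. specialize (HN n Hn).
    assert (PW := Pos W n HW). assert (PL := Pos L n HL).
    apply Rle_trans with (eps / s * (2 * (x + W / 2 ^ n - x + (y + L / 2 ^ n - y)) ^ 2)).
    + apply rect_int_small with (z0 := (p, q)) (A := A); try lra.
      * split; simpl; lra.
      * apply Rlt_le, Rdiv_lt_0_compat; lra.
      * intros z [Z1 Z2]. apply Fc; split; lra.
      * intros [u v] [Z1 Z2]. simpl in Z1, Z2. apply K.
        apply Rle_lt_trans with (1 := Cmod_pair _ _). simpl.
        apply Rle_lt_trans with ((W + L) / 2 ^ n); [ | exact HN].
        unfold Rdiv. rewrite Rmult_plus_distr_r. fold (W / 2 ^ n) (L / 2 ^ n).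
        apply Rplus_le_compat; apply Rabs_le; lra.
    + replace (eps / s * (2 * (x + W / 2 ^ n - x + (y + L / 2 ^ n - y)) ^ 2))
        with (eps / 4 ^ n * (2 * (W + L) ^ 2 / s)).
      * rewrite <- (Rmult_1_r (eps / 4 ^ n)) at 2. apply Rmult_le_compat_l.
        -- apply Rlt_le, Rdiv_lt_0_compat; [lra | apply P4].
        -- apply Rmult_le_reg_r with s; [exact Ps | ].
           unfold Rdiv. rewrite Rmult_assoc, Rinv_l by lra. unfold s. lra.
      * replace (4 ^ n) with (2 ^ n * 2 ^ n) by (rewrite <- Rpow_mult_distr; f_equal; lra).
        field. split; first [lra | apply pow_nonzero; lra]. }
simpl in Q. unfold Rdiv in Q. rewrite Rinv_1, !Rmult_1_r in Q. exact Q.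
Qed.

(** * Compactness and circle integrals *)

Section Compactness.

Variable Q : (C -> Prop) -> Prop.
Hypothesis Q_sub : forall A B : C -> Prop, (forall z, A z -> B z) -> Q B -> Q A.
Hypothesis Q_union : forall A B : C -> Prop, Q A -> Q B -> Q (fun z => A z \/ B z).

(** Bisection turns local validity into validity on the whole rectangle. In this form it replaces
    the extraction of finite subcovers. *)
Lemma compact_rect (a c W L : R) : 0 <= W -> 0 <= L ->
  (forall z, in_rect a (a + W) c (c + L) z -> exists d, 0 < d /\ Q (fun w => Cmod (w - z) < d)) ->
  Q (in_rect a (a + W) c (c + L)).
Proof.
intros HW HL Loc.
assert (P2 : forall n, 0 < 2 ^ n) by (intros n; apply pow_lt; lra).
assert (H2 : forall X n, X / 2 ^ n = X / 2 ^ S n + X / 2 ^ S n).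
{ intros X n. simpl. field. apply pow_nonzero; lra. }
assert (G := bisection_2d W L
  (fun x y n => Q (in_rect x (x + W / 2 ^ n) y (y + L / 2 ^ n))) HW HL).
assert (E : Q (in_rect a (a + W / 2 ^ 0) c (c + L / 2 ^ 0))).
{ apply G; clear G.
  - intros x y n Q1 Q2 Q3 Q4.
    refine (Q_sub _ _ _ (Q_union _ _ (Q_union _ _ Q1 Q2) (Q_union _ _ Q3 Q4))).
    intros [u v] [Z1 Z2]. unfold in_rect. simpl fst in *. simpl snd in *.
    rewrite (H2 W n) in Z1. rewrite (H2 L n) in Z2.
    destruct (Rle_dec u (x + W / 2 ^ S n)), (Rle_dec v (y + L / 2 ^ S n));
      [left; left | right; left | left; right | right; right]; lra.
  - intros p q Hp Hq. destruct (Loc (p, q)) as [d [Hd Hb]]; [split; simpl; lra | ].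
    destruct (small_pow2 (W + L) d Hd) as [N HN]. exists N.
    intros n x y Hn Hx Hy. specialize (HN n Hn).
    apply Q_sub with (2 := Hb). intros [u v] [Z1 Z2]. simpl in Z1, Z2.
    apply Rle_lt_trans with (1 := Cmod_pair _ _). simpl.
    apply Rle_lt_trans with ((W + L) / 2 ^ n); [ | exact HN].
    unfold Rdiv. rewrite Rmult_plus_distr_r. fold (W / 2 ^ n) (L / 2 ^ n).
    apply Rplus_le_compat; apply Rabs_le; lra. }
simpl in E. unfold Rdiv in E. rewrite Rinv_1, !Rmult_1_r in E. exact E.
Qed.

End Compactness.

Lemma compact_disc (Q : (C -> Prop) -> Prop) (r : R) :
  (forall A B : C -> Prop, (forall z, A z -> B z) -> Q B -> Q A) ->
  (forall A B : C -> Prop, Q A -> Q B -> Q (fun z => A z \/ B z)) ->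
  0 <= r -> (forall z, Cmod z <= r -> exists d, 0 < d /\ Q (fun w => Cmod (w - z) < d)) ->
  Q (fun z => Cmod z <= r).
Proof.
intros Q1 Q2 Hr Loc.
assert (G := compact_rect (fun A => Q (fun z => A z /\ Cmod z <= r))).
apply Q1 with (fun z => in_rect (- r) (- r + 2 * r) (- r) (- r + 2 * r) z /\ Cmod z <= r).
- intros z Hz. split; [ | exact Hz].
  assert (X := re_le_Cmod z). assert (Y := im_le_Cmod z).
  assert (X' : Rabs (Re z) <= r) by lra. assert (Y' : Rabs (Im z) <= r) by lra.
  apply Rabs_le_between in X'. apply Rabs_le_between in Y'.
  unfold Re, Im in *. split; lra.
- apply G; try lra.
  + intros A B S. apply Q1. intros z [Z1 Z2]. split; auto.
  + intros A B HA HB. apply Q1 with (2 := Q2 _ _ HA HB). intros z [[Z1 | Z1] Z2]; auto.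
  + intros z _. destruct (Rle_dec (Cmod z) r) as [L | L].
    * destruct (Loc z L) as [d [Hd H]]. exists d; split; [exact Hd | ].
      apply Q1 with (2 := H). intros w [W _]; exact W.
    * exists (Cmod z - r); split; [lra | ].
      (* A small disc about an outside point misses the given disc, so [Q] is needed for the empty
         set; any instance of [Q] provides it, here the one at 0. *)
      destruct (Loc 0%C ltac:(rewrite Cmod_0; exact Hr)) as [d [_ H]].
      apply Q1 with (2 := H). intros w [W1 W2]. exfalso.
      assert (T := Cmod_sub_le z w). rewrite Cmod_minus_sym in T. lra.
Qed.

(** One statement for several uses: Lebesgue numbers, positive lower bounds and, through [/ d],
    upper bounds. *)
Lemma compact_disc_uniform (P : C -> R -> Prop) (r : R) :
  (forall z d d', 0 < d' -> d' <= d -> P z d -> P z d') ->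
  0 <= r ->
  (forall z, Cmod z <= r -> exists d, 0 < d /\ forall w, Cmod (w - z) < d -> P w d) ->
  exists d, 0 < d /\ forall z, Cmod z <= r -> P z d.
Proof.
intros Mono Hr Loc.
apply (compact_disc (fun A => exists d, 0 < d /\ forall z, A z -> P z d)).
- intros A B S [d [Hd H]]. exists d; split; auto.
- intros A B [d1 [H1 K1]] [d2 [H2 K2]]. exists (Rmin d1 d2). split; [apply Rmin_pos; assumption | ].
  intros z [Z | Z].
  + apply Mono with d1; [apply Rmin_pos; assumption | apply Rmin_l | auto].
  + apply Mono with d2; [apply Rmin_pos; assumption | apply Rmin_r | auto].
- exact Hr.
- intros z Hz. destruct (Loc z Hz) as [d [Hd H]]. exists d; split; [exact Hd | ].
  exists d; split; assumption.
Qed.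

Lemma compact_interval_uniform (P : R -> R -> Prop) (a b : R) :
  (forall t d d', 0 < d' -> d' <= d -> P t d -> P t d') ->
  a <= b ->
  (forall t, a <= t <= b -> exists d, 0 < d /\ forall s, Rabs (s - t) < d -> P s d) ->
  exists d, 0 < d /\ forall t, a <= t <= b -> P t d.
Proof.
intros Mono Hab Loc.
(* The interval is taken as a rectangle of height zero. *)
destruct (compact_rect (fun A => exists d, 0 < d /\ forall z, A z -> P (fst z) d)) with
  (a := a) (c := 0) (W := b - a) (L := 0) as [d [Hd H]].
- intros A B S [d [Hd H]]. exists d; split; auto.
- intros A B [d1 [H1 K1]] [d2 [H2 K2]]. exists (Rmin d1 d2). split; [apply Rmin_pos; assumption | ].
  intros z [Z | Z].
  + apply Mono with d1; [apply Rmin_pos; assumption | apply Rmin_l | auto].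
  + apply Mono with d2; [apply Rmin_pos; assumption | apply Rmin_r | auto].
- lra.
- lra.
- intros [t y] [Z1 Z2]. simpl in Z1.
  destruct (Loc t) as [d [Hd H]]; [lra | ]. exists d; split; [exact Hd | ].
  exists d; split; [exact Hd | ]. intros z Hz. apply H.
  apply Rle_lt_trans with (2 := Hz).
  apply Rle_trans with (2 := re_le_Cmod _). apply Req_le. reflexivity.
- exists d; split; [exact Hd | ]. intros t Ht. apply (H (t, 0)). split; simpl; lra.
Qed.

(** * The complex exponential and integrals over circles *)

Definition cexp (z : C) : C := circle (exp (fst z)) (snd z).

Lemma derivable_pt_lim_remainder (f : R -> R) (l eta : R) : derivable_pt_lim f 0 l -> 0 < eta ->
  exists d, 0 < d /\ forall t, Rabs t < d -> Rabs (f t - f 0 - l * t) <= eta * Rabs t.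
Proof.
intros H He. destruct (H eta He) as [d Hd]. exists d; split; [apply cond_pos | ].
intros t Ht. destruct (Req_dec t 0) as [-> | N].
- replace (f 0 - f 0 - l * 0) with 0 by ring. rewrite Rabs_R0. lra.
- specialize (Hd t N Ht). rewrite Rplus_0_l in Hd.
  replace (f t - f 0 - l * t) with (((f t - f 0) / t - l) * t) by (field; exact N).
  rewrite Rabs_mult. apply Rmult_le_compat_r; [apply Rabs_pos | lra].
Qed.

Lemma cexp_remainder eps : 0 < eps -> exists d, 0 < d /\ forall u : C, Cmod u < d ->
  Cmod (cexp u - 1 - u) <= eps * Cmod u.
Proof.
(* Nine units of [eta]: one from the real exponential, three each from cosine and sine, as
   [exp s <= 3], and two from the product of [exp s - 1] and [t]. *)
intros He. set (eta := Rmin 1 (eps / 9)).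
assert (E0 : 0 < eta) by (apply Rmin_pos; lra).
assert (E1 : eta <= 1) by apply Rmin_l. assert (E9 : eta <= eps / 9) by apply Rmin_r.
destruct (derivable_pt_lim_remainder exp _ eta (derivable_pt_lim_exp 0) E0) as [d1 [D1 K1]].
destruct (derivable_pt_lim_remainder cos _ eta (derivable_pt_lim_cos 0) E0) as [d2 [D2 K2]].
destruct (derivable_pt_lim_remainder sin _ eta (derivable_pt_lim_sin 0) E0) as [d3 [D3 K3]].
rewrite exp_0 in K1. rewrite cos_0, sin_0 in K2. rewrite sin_0, cos_0 in K3.
exists (Rmin eta (Rmin d1 (Rmin d2 d3))). split.
{ apply Rmin_pos; [assumption | apply Rmin_pos; [ | apply Rmin_pos]; assumption]. }
intros [s t] Hu.
assert (M1 := Rmin_l eta (Rmin d1 (Rmin d2 d3))). assert (M2 := Rmin_r eta (Rmin d1 (Rmin d2 d3))).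
assert (M3 := Rmin_l d1 (Rmin d2 d3)). assert (M4 := Rmin_r d1 (Rmin d2 d3)).
assert (M5 := Rmin_l d2 d3). assert (M6 := Rmin_r d2 d3).
assert (Hs : Rabs s <= Cmod (s, t)) by exact (re_le_Cmod (s, t)).
assert (Ht : Rabs t <= Cmod (s, t)) by exact (im_le_Cmod (s, t)).
set (m := Cmod (s, t)) in *.
specialize (K1 s ltac:(lra)). specialize (K2 t ltac:(lra)). specialize (K3 t ltac:(lra)).
replace (cexp (s, t) - 1 - (s, t))%C with
  ((exp s - 1 - 1 * s + exp s * (cos t - 1 - - 0 * t),
    exp s * (sin t - 0 - 1 * t) + (exp s - 1 - 1 * s + s) * t) : C)
  by (unfold cexp, circle, Cminus, Cplus, Copp, RtoC; simpl; f_equal; ring).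
apply Rle_trans with (1 := Cmod_pair _ _).
set (x := exp s - 1 - 1 * s) in *. set (y := cos t - 1 - - 0 * t) in *. set (z := sin t - 0 - 1 * t) in *.
assert (Ps := Rabs_pos s). assert (Pt := Rabs_pos t). assert (P0 : 0 < exp s) by apply exp_pos.
assert (Hx : Rabs x <= Rabs s) by nra.
assert (X3 : exp s <= 3).
{ replace (exp s) with (1 + s + x) by (unfold x; ring).
  assert (A := Rle_abs s). assert (B := Rle_abs x). lra. }
assert (T1 := Rabs_triang x (exp s * y)).
assert (T2 := Rabs_triang (exp s * z) ((x + s) * t)).
assert (T3 := Rabs_triang x s).
rewrite !Rabs_mult in *. rewrite (Rabs_pos_eq (exp s)) in * by lra.
assert (Py := Rabs_pos y). assert (Pz := Rabs_pos z).
assert (A1 : exp s * Rabs y <= 3 * (eta * Rabs t)) by (apply Rmult_le_compat; lra).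
assert (A2 : exp s * Rabs z <= 3 * (eta * Rabs t)) by (apply Rmult_le_compat; lra).
assert (A3 : Rabs (x + s) * Rabs t <= (2 * eta) * Rabs t) by (apply Rmult_le_compat_r; lra).
assert (A4 : eta * Rabs s <= eta * m) by (apply Rmult_le_compat_l; lra).
assert (A5 : eta * Rabs t <= eta * m) by (apply Rmult_le_compat_l; lra).
assert (A6 : 9 * (eta * m) <= eps * m).
{ rewrite <- Rmult_assoc. apply Rmult_le_compat_r; lra. }
lra.
Qed.

Lemma cexp_plus z u : cexp (z + u) = (cexp z * cexp u)%C.
Proof.
destruct z as [a b], u as [c d]. unfold cexp, circle, Cplus, Cmult. cbn [fst snd].
rewrite exp_plus, cos_plus, sin_plus. f_equal; ring.
Qed.

Lemma ex_cdiff_cexp z : ex_cdiff cexp z.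
Proof.
exists (cexp z). apply cdiff_eps. intros eps He.
assert (P := Cmod_ge_0 (cexp z)).
destruct (cexp_remainder (eps / (Cmod (cexp z) + 1))) as [d [Hd K]].
{ apply Rdiv_lt_0_compat; lra. }
exists d; split; [exact Hd | ]. intros w Hw. specialize (K _ Hw).
replace (cexp w) with (cexp z * cexp (w - z))%C by (rewrite <- cexp_plus; f_equal; ring).
replace (cexp z * cexp (w - z) - cexp z - cexp z * (w - z))%C with
  (cexp z * (cexp (w - z) - 1 - (w - z)))%C by ring.
rewrite Cmod_mult. apply Rle_trans with (Cmod (cexp z) * (eps / (Cmod (cexp z) + 1) * Cmod (w - z))).
- apply Rmult_le_compat_l; assumption.
- rewrite <- Rmult_assoc. apply Rmult_le_compat_r; [apply Cmod_ge_0 | ].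
  apply Rmult_le_reg_r with (Cmod (cexp z) + 1); [lra | ].
  unfold Rdiv. rewrite !Rmult_assoc, Rinv_l by lra. nra.
Qed.

Lemma Cmod_circle r t : 0 <= r -> Cmod (circle r t) = r.
Proof.
intros Hr. unfold Cmod, circle; simpl.
replace (r * cos t * (r * cos t * 1) + r * sin t * (r * sin t * 1))
  with (r ^ 2 * (Rsqr (sin t) + Rsqr (cos t))) by (unfold Rsqr; ring).
rewrite sin2_cos2, Rmult_1_r. apply sqrt_pow2, Hr.
Qed.

Lemma rcont_circle r t : rcont (circle r) t.
Proof.
apply rcont_pair; apply continuity_pt_mult.
- apply continuity_pt_const; now intros ? ?.
- apply continuity_cos.
- apply continuity_pt_const; now intros ? ?.
- apply continuity_sin.
Qed.

(** This is the contour integral of [G(z) / (i z) dz]; an ordinary contour integral of [G] is thus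
    [Ci] times the [J] of [z * G z]. *)
Definition J (r : R) (G : C -> C) : C := CI (fun t => G (circle r t)) 0 (2 * PI).

Definition ccont_circle (G : C -> C) (r : R) : Prop := forall z, Cmod z = r -> ccont G z.

Lemma two_PI_pos : 0 < 2 * PI.
Proof. assert (H := PI_RGT_0). lra. Qed.

Lemma ccont_circle_rcont G r : 0 <= r -> ccont_circle G r ->
  rcont_on (fun t => G (circle r t)) 0 (2 * PI).
Proof.
intros Hr H t _. apply (rcont_comp G (circle r)); [apply rcont_circle | ].
apply H, Cmod_circle, Hr.
Qed.

Lemma J_ext r F G : 0 <= r -> (forall z, Cmod z = r -> F z = G z) -> J r F = J r G.
Proof.
intros Hr H. apply CI_ext; [apply Rlt_le, two_PI_pos | ].
intros t _. apply H, Cmod_circle, Hr.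
Qed.

Lemma J_plus r F G : 0 <= r -> ccont_circle F r -> ccont_circle G r ->
  J r (fun z => F z + G z)%C = (J r F + J r G)%C.
Proof.
intros Hr HF HG. apply (CI_plus (fun t => F (circle r t)) (fun t => G (circle r t)));
  [apply Rlt_le, two_PI_pos | | ]; apply ccont_circle_rcont; assumption.
Qed.

Lemma J_minus r F G : 0 <= r -> ccont_circle F r -> ccont_circle G r ->
  J r (fun z => F z - G z)%C = (J r F - J r G)%C.
Proof.
intros Hr HF HG. apply (CI_minus (fun t => F (circle r t)) (fun t => G (circle r t)));
  [apply Rlt_le, two_PI_pos | | ]; apply ccont_circle_rcont; assumption.
Qed.

Lemma J_scal r c F : 0 <= r -> ccont_circle F r -> J r (fun z => c * F z)%C = (c * J r F)%C.
Proof.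
intros Hr HF. apply (CI_scal c (fun t => F (circle r t)));
  [apply Rlt_le, two_PI_pos | ]; apply ccont_circle_rcont; assumption.
Qed.

Lemma J_const r c : J r (fun _ => c) = (RtoC (2 * PI) * c)%C.
Proof. unfold J. rewrite CI_const. do 2 f_equal. ring. Qed.

Lemma J_bound r G M : 0 <= r -> ccont_circle G r -> (forall z, Cmod z = r -> Cmod (G z) <= M) ->
  Cmod (J r G) <= 2 * PI * M.
Proof.
intros Hr HG HM. replace (2 * PI * M) with ((2 * PI - 0) * M) by ring.
apply CI_bound; [apply Rlt_le, two_PI_pos | apply ccont_circle_rcont; assumption | ].
intros t _. apply HM, Cmod_circle, Hr.
Qed.

(* Goursat for [G o exp] on a rectangle of height [2 PI]. *)
Lemma J_annulus G r1 r2 : 0 < r1 -> r1 <= r2 ->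
  (forall z, r1 <= Cmod z <= r2 -> ex_cdiff G z) -> J r1 G = J r2 G.
Proof.
intros H1 H2 HG.
set (F := fun z => G (cexp z)).
assert (L : ln r1 <= ln r2).
{ destruct (Req_dec r1 r2) as [-> | N]; [lra | ]. apply Rlt_le, ln_increasing; lra. }
assert (HF : forall z, in_rect (ln r1) (ln r1 + (ln r2 - ln r1)) 0 (0 + 2 * PI) z -> ex_cdiff F z).
{ intros z [Z1 Z2]. apply (ex_cdiff_comp G cexp); [ | apply ex_cdiff_cexp]. apply HG.
  unfold cexp. rewrite Cmod_circle by apply Rlt_le, exp_pos.
  rewrite <- (exp_ln r1) at 1 by exact H1. rewrite <- (exp_ln r2) by lra.
  assert (Mono : forall x y, x <= y -> exp x <= exp y).
  { intros x y [X | ->]; [apply Rlt_le, exp_increasing, X | lra]. }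
  split; apply Mono; lra. }
assert (G0 := Goursat F (ln r1) 0 (ln r2 - ln r1) (2 * PI) ltac:(lra) ltac:(apply Rlt_le, two_PI_pos) HF).
rewrite rect_int_sides in G0; try lra.
2: { assert (T := two_PI_pos). lra. }
2: { intros z Hz. apply ex_cdiff_ccont, HF, Hz. }
replace (ln r1 + (ln r2 - ln r1)) with (ln r2) in G0 by ring. rewrite Rplus_0_l in G0.
assert (E1 : forall r, 0 < r -> CI (fun y => F (ln r, y)) 0 (2 * PI) = J r G).
{ intros r Hr. unfold J, F, cexp. cbn [fst snd]. rewrite exp_ln by exact Hr. reflexivity. }
rewrite !E1 in G0 by lra.
(* The horizontal sides cancel because [cexp] has period [2 PI] in the imaginary direction. *)
assert (E2 : CI (fun x => F (x, 0)) (ln r1) (ln r2) = CI (fun x => F (x, 2 * PI)) (ln r1) (ln r2)).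
{ apply CI_ext; [exact L | ]. intros t _. unfold F, cexp, circle. cbn [fst snd].
  rewrite cos_2PI, sin_2PI, cos_0, sin_0. reflexivity. }
rewrite E2 in G0. symmetry. apply Csub_eq0.
assert (CiN : Ci <> 0%C) by (apply Cmod_gt_0; rewrite Cmod_Ci; lra).
replace (J r2 G - J r1 G)%C with (/ Ci * (Ci * (J r2 G - J r1 G)))%C by (field; exact CiN).
replace (Ci * (J r2 G - J r1 G))%C with (RtoC 0); [ring | ].
rewrite <- G0. ring.
Qed.

(** * Cauchy's formula *)

Lemma circle_scal r t : circle r t = (RtoC r * circle 1 t)%C.
Proof. unfold circle, RtoC, Cmult; simpl. f_equal; ring. Qed.

Lemma Cmod_circle_minus r s t : Cmod (circle r t - circle s t) = Rabs (r - s).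
Proof.
rewrite (circle_scal r), (circle_scal s).
replace (RtoC r * circle 1 t - RtoC s * circle 1 t)%C with (RtoC (r - s) * circle 1 t)%C
  by (rewrite RtoC_minus; ring).
rewrite Cmod_mult, Cmod_R, Cmod_circle by lra. ring.
Qed.

Lemma J_continuous G r0 eps : 0 < r0 -> ccont_circle G r0 -> 0 < eps ->
  exists d, 0 < d /\ forall r, 0 < r -> Rabs (r - r0) < d -> ccont_circle G r ->
    Cmod (J r G - J r0 G) <= eps.
Proof.
intros H0 HG He. assert (TP := two_PI_pos).
set (e := eps / (2 * PI)). assert (Pe : 0 < e) by (apply Rdiv_lt_0_compat; lra).
destruct (compact_interval_uniform
  (fun t d => forall r, Rabs (r - r0) < d -> Cmod (G (circle r t) - G (circle r0 t)) <= e)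
  0 (2 * PI)) as [d [Hd H]].
- intros t d d' _ L K r Hr. apply K. lra.
- lra.
- intros t _.
  destruct (HG (circle r0 t) (Cmod_circle r0 t (Rlt_le _ _ H0)) (e / 2) ltac:(lra)) as [d1 [D1 K1]].
  destruct (rcont_circle r0 t (d1 / 2) ltac:(lra)) as [d2 [D2 K2]].
  exists (Rmin (d1 / 2) d2). split; [apply Rmin_pos; lra | ].
  assert (A := Rmin_l (d1 / 2) d2). assert (B := Rmin_r (d1 / 2) d2).
  intros s Hs r Hr. specialize (K2 s ltac:(lra)).
  assert (X := K1 (circle r0 s) ltac:(lra)).
  assert (Y : Cmod (G (circle r s) - G (circle r0 t)) < e / 2).
  { apply K1. apply Rle_lt_trans with (1 := Cmod_sub _ (circle r0 s) _).
    rewrite Cmod_circle_minus. lra. }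
  apply Rle_trans with (1 := Cmod_sub _ (G (circle r0 t)) _).
  rewrite (Cmod_minus_sym (G (circle r0 t))). lra.
- exists d; split; [exact Hd | ]. intros r Hr Hrd Hc.
  unfold J. rewrite <- CI_minus; [ | lra | | ].
  2, 3 : apply ccont_circle_rcont; [lra | assumption].
  replace eps with ((2 * PI - 0) * e) by (unfold e; field; assert (P := PI_RGT_0); lra).
  apply CI_bound; [lra | | ].
  + intros t Ht. apply rcont_minus; apply ccont_circle_rcont; try assumption; lra.
  + intros t Ht. apply H; assumption.
Qed.

(* Exceptional points only cost a continuity argument at their radii. *)
Lemma J_off_list G R L : forall r1 r2,
  (forall z, Cmod z < R -> ccont G z) -> 0 < r1 -> r1 <= r2 -> r2 < R ->
  (forall z, r1 < Cmod z < r2 -> ~ In z L -> ex_cdiff G z) -> J r1 G = J r2 G.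
Proof.
induction L as [ | e L IH]; intros r1 r2 HG H1 [H12 | ->] H2 HL; try reflexivity.
(* Differentiability holds in the open annulus only: it is shrunk by [m / 3] at both ends, and
   continuity in the radius costs [eps / 2] at each. *)
- apply Csub_eq0, Cmod_le_eps_0. intros eps He.
  destruct (J_continuous G r1 (eps / 2)) as [d1 [D1 K1]]; [lra | intros z Hz; apply HG; lra | lra | ].
  destruct (J_continuous G r2 (eps / 2)) as [d2 [D2 K2]]; [lra | intros z Hz; apply HG; lra | lra | ].
  set (m := Rmin (r2 - r1) (Rmin d1 d2)).
  assert (M0 : 0 < m) by (apply Rmin_pos; [lra | apply Rmin_pos; assumption]).
  assert (M1 : m <= r2 - r1) by apply Rmin_l.
  assert (M2 : m <= d1) by (apply Rle_trans with (2 := Rmin_l d1 d2); apply Rmin_r).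
  assert (M3 : m <= d2) by (apply Rle_trans with (2 := Rmin_r d1 d2); apply Rmin_r).
  specialize (K1 (r1 + m / 3)). specialize (K2 (r2 - m / 3)).
  assert (E : J (r1 + m / 3) G = J (r2 - m / 3) G).
  { apply J_annulus; [lra | lra | ]. intros z Hz. apply HL; [lra | intros []]. }
  rewrite Cmod_minus_sym in K1.
  assert (X := K1 ltac:(lra) ltac:(rewrite Rabs_pos_eq; lra) ltac:(intros z Hz; apply HG; lra)).
  assert (Y := K2 ltac:(lra) ltac:(rewrite Rabs_left; lra) ltac:(intros z Hz; apply HG; lra)).
  apply Rle_trans with (1 := Cmod_sub _ (J (r1 + m / 3) G) _). rewrite E in *. lra.
(* The radius of [e] cuts the annulus in two open annuli, neither of which contains [e]. *)
- destruct (classic (r1 < Cmod e < r2)) as [He | He].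
  + transitivity (J (Cmod e) G).
    * apply IH; try lra; [exact HG | ]. intros z Hz Hn. apply HL; [lra | ].
      intros [<- | I]; [lra | now apply Hn].
    * apply IH; try lra; [exact HG | ]. intros z Hz Hn. apply HL; [lra | ].
      intros [<- | I]; [lra | now apply Hn].
  + apply IH; try lra; [exact HG | ]. intros z Hz Hn. apply HL; [lra | ].
    intros [<- | I]; [now apply He | now apply Hn].
Qed.

(** The circle shrinks towards 0, where [z * G z] is small by continuity of [G]. The list [L] allows
    [G] to be a difference quotient, which is merely continuous at its base point. *)
Lemma Cauchy_disc G R L r :
  (forall z, Cmod z < R -> ccont G z) ->
  (forall z, Cmod z < R -> ~ In z L -> ex_cdiff G z) ->
  0 < r < R -> J r (fun z => z * G z)%C = 0%C.
Proof.
intros HG HL Hr. assert (TP := two_PI_pos).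
set (F := fun z => (z * G z)%C).
assert (HF : forall z, Cmod z < R -> ccont F z).
{ intros z Hz. apply ccont_mult; [apply ccont_id | apply HG, Hz]. }
apply Cmod_le_eps_0. intros eps He.
destruct (HF 0%C ltac:(rewrite Cmod_0; lra) (eps / (2 * PI))) as [d [Hd K]];
  [apply Rdiv_lt_0_compat; lra | ].
set (s := Rmin r (d / 2)). assert (S0 : 0 < s) by (apply Rmin_pos; lra).
assert (S1 : s <= r) by apply Rmin_l. assert (S2 : s <= d / 2) by apply Rmin_r.
rewrite <- (J_off_list F R L s r); try lra; [ | exact HF | ].
- replace eps with (2 * PI * (eps / (2 * PI))) by (field; assert (P := PI_RGT_0); lra).
  apply J_bound; [lra | intros z Hz; apply HF; lra | ].
  intros z Hz. specialize (K z).
  replace (z - 0)%C with z in K by ring.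
  replace (F z - F 0)%C with (F z) in K by (unfold F; ring).
  apply Rlt_le, K. lra.
- intros z Hz Hn. apply ex_cdiff_mult; [apply ex_cdiff_id | ]. apply HL; [lra | exact Hn].
Qed.

Lemma ccont_kernel a z : z <> a -> ccont (fun z => / (z - a))%C z.
Proof.
intros H. apply ccont_inv; [ | apply Csub_neq0, H].
apply ccont_minus; [apply ccont_id | apply ccont_const].
Qed.

Lemma ex_cdiff_kernel a z : z <> a -> ex_cdiff (fun z => / (z - a))%C z.
Proof.
intros H. apply ex_cdiff_inv; [ | apply Csub_neq0, H].
apply ex_cdiff_minus; [apply ex_cdiff_id | apply ex_cdiff_const].
Qed.

Lemma Cmod_neq (z a : C) : Cmod a < Cmod z -> z <> a.
Proof. intros H E. rewrite E in H. lra. Qed.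

(* The circle is pushed to infinity. *)
Lemma J_decay a r : Cmod a < r -> J r (fun z => a * / (z - a))%C = 0%C.
Proof.
intros Ha. assert (Pa := Cmod_ge_0 a). assert (TP := two_PI_pos).
apply Cmod_le_eps_0. intros eps He.
assert (Q : 0 <= 2 * PI * Cmod a / eps).
{ apply Rmult_le_pos; [apply Rmult_le_pos; lra | apply Rlt_le, Rinv_0_lt_compat, He]. }
set (rho := Cmod a + (2 * PI * Cmod a / eps + r)).
rewrite (J_annulus _ r rho).
- replace eps with (2 * PI * (eps / (2 * PI))) by (field; assert (P := PI_RGT_0); lra).
  apply J_bound; [unfold rho; lra | | ].
  + intros z Hz. apply ccont_mult; [apply ccont_const | ].
    apply ccont_kernel, Cmod_neq. unfold rho in Hz. lra.
  + intros z Hz. assert (N : z <> a) by (apply Cmod_neq; unfold rho in Hz; lra).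
    rewrite Cmod_mult, Cmod_inv by (apply Csub_neq0, N).
    assert (T := Cmod_sub_le z a). rewrite Hz in T. unfold rho in T.
    set (m := Cmod (z - a)) in *. assert (Pm : 0 < m) by lra.
    apply Rmult_le_reg_r with (m * (2 * PI)); [apply Rmult_lt_0_compat; lra | ].
    replace (Cmod a * / m * (m * (2 * PI))) with (2 * PI * Cmod a) by (field; lra).
    replace (eps / (2 * PI) * (m * (2 * PI))) with (eps * m) by (field; assert (P := PI_RGT_0); lra).
    replace (2 * PI * Cmod a) with (eps * (2 * PI * Cmod a / eps)) by (field; lra).
    apply Rmult_le_compat_l; lra.
- lra.
- unfold rho; lra.
- intros z Hz. apply ex_cdiff_mult; [apply ex_cdiff_const | ].
  apply ex_cdiff_kernel, Cmod_neq. lra.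
Qed.

Lemma J_kernel a r : Cmod a < r -> J r (fun z => z * / (z - a))%C = RtoC (2 * PI).
Proof.
intros Ha. assert (Pa := Cmod_ge_0 a).
rewrite (J_ext r _ (fun z => 1 + a * / (z - a))%C); [ | lra | ].
- rewrite J_plus; [ | lra | | ].
  + rewrite J_const, J_decay by exact Ha. ring.
  + intros z _. apply ccont_const.
  + intros z Hz. apply ccont_mult; [apply ccont_const | ]. apply ccont_kernel, Cmod_neq. lra.
- intros z Hz. field. apply Csub_neq0, Cmod_neq. lra.
Qed.

(** The slope [q] of [F] at [a] is continuous, and differentiable off [a] and [L], so [Cauchy_disc]
    kills it and [F a] times the kernel remains. The list [L] is kept for quotients with removable
    singularities. *)
Theorem Cauchy_formula F R L a r :
  (forall z, Cmod z < R -> ccont F z) ->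
  (forall z, Cmod z < R -> ~ In z L -> ex_cdiff F z) ->
  ex_cdiff F a -> Cmod a < r -> r < R ->
  J r (fun z => F z * (z * / (z - a)))%C = (RtoC (2 * PI) * F a)%C.
Proof.
intros HF HL Fa Ha Hr. assert (Pa := Cmod_ge_0 a).
destruct (proj1 (ex_cdiff_slope F a) Fa) as [q [Hq Eq]].
assert (Q : forall z, z <> a -> exists e, 0 < e /\
  forall w, Cmod (w - z) < e -> ((F w - F a) * / (w - a))%C = q w).
{ intros z Hz. exists (Cmod (z - a)).
  split; [apply Cmod_gt_0, Csub_neq0, Hz | ].
  intros w Hw. rewrite Eq. field. apply Csub_neq0. intros ->.
  rewrite Cmod_minus_sym in Hw. lra. }
assert (Z : J r (fun z => z * q z)%C = 0%C).
{ apply (Cauchy_disc q R (a :: L)); [ | | lra].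
  - intros z Hz. destruct (classic (z = a)) as [-> | N]; [exact Hq | ].
    destruct (Q z N) as [e [He E]]. apply ccont_ext_loc with (1 := He) (2 := E).
    apply ccont_mult; [ | apply ccont_kernel, N].
    apply ccont_minus; [apply HF, Hz | apply ccont_const].
  - intros z Hz Hn. assert (N : z <> a) by (intros ->; apply Hn; now left).
    destruct (Q z N) as [e [He E]]. apply ex_cdiff_ext_loc with (1 := He) (2 := E).
    apply ex_cdiff_mult; [ | apply ex_cdiff_kernel, N].
    apply ex_cdiff_minus; [ | apply ex_cdiff_const].
    apply HL; [exact Hz | intros I; apply Hn; now right]. }
assert (Cq : ccont_circle (fun z => z * q z)%C r).
{ intros z Hz. assert (N : z <> a) by (apply Cmod_neq; lra).
  apply ccont_mult; [apply ccont_id | ].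
  destruct (Q z N) as [e [He E]]. apply ccont_ext_loc with (1 := He) (2 := E).
  apply ccont_mult; [ | apply ccont_kernel, N].
  apply ccont_minus; [apply HF; lra | apply ccont_const]. }
rewrite (J_ext r _ (fun z => z * q z + F a * (z * / (z - a)))%C); [ | lra | ].
- rewrite J_plus, J_scal, J_kernel, Z; try assumption; try lra.
  + ring.
  + intros z Hz. apply ccont_mult; [apply ccont_id | apply ccont_kernel, Cmod_neq; lra].
  + intros z Hz. apply ccont_mult; [apply ccont_const | ].
    apply ccont_mult; [apply ccont_id | apply ccont_kernel, Cmod_neq; lra].
- intros z Hz. assert (N : (z - a)%C <> 0%C) by (apply Csub_neq0, Cmod_neq; lra).
  replace (q z) with ((z - a) * q z * / (z - a))%C by (field; exact N).
  rewrite <- Eq. field. exact N.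
Qed.

(** * Strict differentiability of holomorphic functions *)

Lemma ccont_circle_bounded G r : 0 <= r -> ccont_circle G r ->
  exists M, 0 < M /\ forall z, Cmod z = r -> Cmod (G z) <= M.
Proof.
intros Hr HG.
assert (E : exists d, 0 < d /\ forall z, Cmod z <= r -> Cmod z = r -> Cmod (G z) <= / d).
{ apply (compact_disc_uniform (fun z d => Cmod z = r -> Cmod (G z) <= / d)); [ | exact Hr | ].
  - intros z d d' Hd' L H E. apply Rle_trans with (1 := H E). apply Rinv_le_contravar; assumption.
  - intros z Hz. destruct (Req_dec (Cmod z) r) as [E | N].
    + destruct (HG z E 1 Rlt_0_1) as [d [Hd K]].
      assert (P := Cmod_ge_0 (G z)).
      exists (Rmin d (/ (Cmod (G z) + 1))).
      assert (Pi : 0 < / (Cmod (G z) + 1)) by (apply Rinv_0_lt_compat; lra).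
      split; [apply Rmin_pos; assumption | ].
      intros w Hw _. specialize (K w (Rlt_le_trans _ _ _ Hw (Rmin_l _ _))).
      apply Rle_trans with (Cmod (G z) + 1).
      * assert (T := Cmod_le_sub (G w) (G z)). lra.
      * apply Rle_trans with (/ / (Cmod (G z) + 1)); [rewrite Rinv_inv; lra | ].
        apply Rinv_le_contravar; [apply Rmin_pos; assumption | apply Rmin_r].
    + exists (r - Cmod z). split; [lra | ]. intros w Hw E.
      assert (T := Cmod_sub_le w z). lra. }
destruct E as [d [Hd H]]. exists (/ d). split; [apply Rinv_0_lt_compat, Hd | ].
intros z Hz. apply H; lra.
Qed.

(** Both points vary. This substitutes for continuity of the derivative in the inverse function
    theorem. *)
Definition strict_cdiff (h : C -> C) (l D : C) : Prop :=
  forall eps, 0 < eps -> exists d, 0 < d /\ forall z w, Cmod (z - l) < d -> Cmod (w - l) < d ->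
    Cmod (h z - h w - D * (z - w)) <= eps * Cmod (z - w).

Lemma strict_cdiff_cdiff h l D : strict_cdiff h l D -> cdiff h l D.
Proof.
intros H. apply cdiff_eps. intros eps He. destruct (H eps He) as [d [Hd K]].
exists d; split; [exact Hd | ]. intros w Hw. apply K; [exact Hw | ].
unfold Cminus. rewrite Cplus_opp_r, Cmod_0. exact Hd.
Qed.

(** Cauchy's formula expresses the remainder as [z - w] times an integral whose integrand tends to 0
    uniformly as [z] and [w] approach [l]. Half of the distance from [l] to the circle is reserved
    as [d], so that all kernels are bounded by [/ d]. *)
Lemma holomorphic_strict h R l :
  (forall z, Cmod z < R -> ex_cdiff h z) -> Cmod l < R -> exists D, strict_cdiff h l D.
Proof.
intros Hh Hl. assert (Pl := Cmod_ge_0 l). assert (TP := two_PI_pos).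
set (r := (Cmod l + R) / 2). set (d := (r - Cmod l) / 2).
assert (Hd : 0 < d) by (unfold d, r; lra).
assert (Hc : forall z, Cmod z < R -> ccont h z) by (intros z Hz; apply ex_cdiff_ccont, Hh, Hz).
assert (Hr : Cmod l < r < R) by (unfold r; lra).
destruct (ccont_circle_bounded h r) as [M [HM BM]]; [lra | intros z Hz; apply Hc; lra | ].
assert (TPC : RtoC (2 * PI) <> 0%C) by (apply Cmod_gt_0; rewrite Cmod_R, Rabs_pos_eq; lra).
assert (K0 : forall z zeta, Cmod (z - l) < d -> Cmod zeta = r -> d <= Cmod (zeta - z)).
{ intros z zeta Hz Hzeta. assert (T := Cmod_sub_le zeta z).
  assert (T' := Cmod_le_sub z l). unfold d in *. lra. }
assert (KN : forall z zeta, Cmod (z - l) < d -> Cmod zeta = r -> zeta <> z).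
{ intros z zeta Hz Hzeta E. assert (T := K0 z zeta Hz Hzeta).
  rewrite E in T. unfold Cminus in T. rewrite Cplus_opp_r, Cmod_0 in T. lra. }
assert (Ll : Cmod (l - l) < d) by (unfold Cminus; rewrite Cplus_opp_r, Cmod_0; exact Hd).
exists (/ RtoC (2 * PI) * J r (fun z => h z * z * (/ (z - l) * / (z - l))))%C.
intros eps He.
(* [M] bounds [h], [r] is the modulus of the variable, [4 * r * delta] bounds the numerator of the
   kernel and [d ^ 4] comes from its four denominators. *)
set (B := M * r * (4 * r / d ^ 4)).
assert (PB : 0 < B).
{ unfold B. apply Rmult_lt_0_compat; [apply Rmult_lt_0_compat; lra | ].
  apply Rdiv_lt_0_compat; [lra | apply pow_lt, Hd]. }
exists (Rmin d (eps / B)).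
split; [apply Rmin_pos; [exact Hd | apply Rdiv_lt_0_compat; assumption] | ].
intros z w Hz Hw.
assert (M1 := Rmin_l d (eps / B)). assert (M2 := Rmin_r d (eps / B)).
set (delta := Rmin d (eps / B)) in *.
assert (CF : forall a, Cmod (a - l) < d -> ccont_circle (fun z => h z * (z * / (z - a)))%C r).
{ intros a Ha zeta Hzeta. apply ccont_mult; [apply Hc; lra | ].
  apply ccont_mult; [apply ccont_id | apply ccont_kernel, KN; assumption]. }
assert (F : forall a, Cmod (a - l) < d ->
  h a = (/ RtoC (2 * PI) * J r (fun z => h z * (z * / (z - a))))%C).
{ intros a Ha. assert (T := Cmod_le_sub a l).
  assert (Lar : Cmod a < r) by (unfold d in *; lra).
  rewrite (Cauchy_formula h R nil a r); try tauto.
  - field. exact TPC.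
  - intros z' Hz' _. apply Hh, Hz'.
  - apply Hh. lra. }
assert (Hz' : Cmod (z - l) < d) by lra. assert (Hw' : Cmod (w - l) < d) by lra.
(* The numerator is [(x - l)^2 - (x - z)(x - w)], written so that each term contains [w - l] or
   [z - l]. *)
assert (E : (h z - h w - / RtoC (2 * PI) * J r (fun z => h z * z * (/ (z - l) * / (z - l))) * (z - w)
  = / RtoC (2 * PI) * ((z - w) * J r (fun x => h x * x *
     (((x - l) * (w - l) + (z - l) * (x - w)) * (/ (x - z) * / (x - w) * (/ (x - l) * / (x - l)))))))%C).
{ assert (C2 : ccont_circle (fun z => h z * z * (/ (z - l) * / (z - l)))%C r).
  { intros x Hx. apply ccont_mult; [apply ccont_mult; [apply Hc; lra | apply ccont_id] | ].
    apply ccont_mult; apply ccont_kernel, KN; assumption. }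
  assert (C3 : ccont_circle (fun z0 => h z0 * (z0 * / (z0 - z)) - h z0 * (z0 * / (z0 - w)))%C r).
  { intros x Hx. apply ccont_minus; [apply (CF z Hz' x Hx) | apply (CF w Hw' x Hx)]. }
  assert (C4 : ccont_circle (fun x => h x * x *
     (((x - l) * (w - l) + (z - l) * (x - w)) * (/ (x - z) * / (x - w) * (/ (x - l) * / (x - l)))))%C r).
  { intros x Hx. apply ccont_mult; [apply ccont_mult; [apply Hc; lra | apply ccont_id] | ].
    apply ccont_mult.
    - apply ccont_plus; apply ccont_mult; try apply ccont_const;
        (apply ccont_minus; [apply ccont_id | apply ccont_const]).
    - apply ccont_mult; apply ccont_mult; apply ccont_kernel, KN; assumption. }
  rewrite <- (J_scal r (z - w)%C _ ltac:(lra) C4).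
  rewrite (J_ext r (fun x => (z - w) * (h x * x *
      (((x - l) * (w - l) + (z - l) * (x - w)) * (/ (x - z) * / (x - w) * (/ (x - l) * / (x - l))))))%C
    (fun x => h x * (x * / (x - z)) - h x * (x * / (x - w))
     - (z - w) * (h x * x * (/ (x - l) * / (x - l))))%C).
  - rewrite (J_minus r (fun x => h x * (x * / (x - z)) - h x * (x * / (x - w)))%C
       (fun x => (z - w) * (h x * x * (/ (x - l) * / (x - l))))%C ltac:(lra) C3).
    + rewrite (J_minus r _ _ ltac:(lra) (CF z Hz') (CF w Hw')), (J_scal r (z - w)%C _ ltac:(lra) C2).
      rewrite (F z Hz'), (F w Hw'). ring.
    + intros x Hx. apply ccont_mult; [apply ccont_const | apply C2, Hx].
  - lra.
  - intros x Hx. field. repeat split; apply Csub_neq0, KN; assumption. }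
rewrite E. clear E.
rewrite !Cmod_mult, Cmod_inv, Cmod_R, (Rabs_pos_eq (2 * PI)) by (assumption || lra).
match goal with |- context [J r ?g] => assert (JB : Cmod (J r g) <= 2 * PI * (delta * B)) end.
{ apply J_bound; [lra | | ].
  - intros x Hx. apply ccont_mult; [apply ccont_mult; [apply Hc; lra | apply ccont_id] | ].
    apply ccont_mult.
    + apply ccont_plus; apply ccont_mult; try apply ccont_const;
        (apply ccont_minus; [apply ccont_id | apply ccont_const]).
    + apply ccont_mult; apply ccont_mult; apply ccont_kernel, KN; assumption.
  - intros x Hx.
    assert (Inv : forall a, Cmod (a - l) < d -> Cmod (/ (x - a)) <= / d).
    { intros a Ha. rewrite Cmod_inv by (apply Csub_neq0, KN; assumption).
      apply Rinv_le_contravar; [exact Hd | apply K0; assumption]. }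
    assert (Far : forall a, Cmod (a - l) < d -> Cmod (x - a) <= 2 * r).
    { intros a Ha. apply Rle_trans with (1 := Cmod_sub_add _ _). rewrite Hx.
      assert (T := Cmod_le_sub a l). unfold d in *. lra. }
    rewrite !Cmod_mult.
    replace (delta * B) with (M * r * (4 * r * delta * (/ d * / d * (/ d * / d))))
      by (unfold B; field; lra).
    assert (Pd : 0 < / d) by (apply Rinv_0_lt_compat, Hd).
    apply Rmult_le_compat; [apply Rmult_le_pos; apply Cmod_ge_0 | | | ].
    + apply Rmult_le_pos; [apply Cmod_ge_0 | repeat apply Rmult_le_pos; apply Cmod_ge_0].
    + apply Rmult_le_compat; try apply Cmod_ge_0; [apply BM, Hx | lra].
    + apply Rmult_le_compat; [apply Cmod_ge_0 | repeat apply Rmult_le_pos; apply Cmod_ge_0 | | ].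
      * apply Rle_trans with (1 := Cmod_triangle _ _). rewrite !Cmod_mult.
        replace (4 * r * delta) with (2 * r * delta + delta * (2 * r)) by ring.
        apply Rplus_le_compat; apply Rmult_le_compat; try apply Cmod_ge_0;
          first [apply Far; assumption | lra].
      * apply Rmult_le_compat; try (apply Rmult_le_pos; apply Cmod_ge_0);
          apply Rmult_le_compat; try apply Cmod_ge_0; apply Inv; assumption. }
apply Rle_trans with (/ (2 * PI) * (Cmod (z - w) * (2 * PI * (delta * B)))).
- apply Rmult_le_compat_l; [apply Rlt_le, Rinv_0_lt_compat, TP | ].
  apply Rmult_le_compat_l; [apply Cmod_ge_0 | exact JB].
- replace (/ (2 * PI) * (Cmod (z - w) * (2 * PI * (delta * B)))) with (delta * B * Cmod (z - w))
    by (field; assert (P := PI_RGT_0); lra).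
  apply Rmult_le_compat_r; [apply Cmod_ge_0 | ].
  apply Rle_trans with (eps / B * B); [apply Rmult_le_compat_r; lra | ].
  right. field. lra.
Qed.

(** * Fibres over regular values *)

Lemma Cmod_self (z : C) : Cmod (z - z) = 0.
Proof. unfold Cminus. rewrite Cplus_opp_r. apply Cmod_0. Qed.

Lemma radial_projection r d w : 0 <= r -> 0 < d -> Cmod w < r + d ->
  exists z, Cmod z <= r /\ Cmod (w - z) < d.
Proof.
intros Hr Hd Hw. destruct (Rle_dec (Cmod w) r) as [L | L].
- exists w. split; [exact L | rewrite Cmod_self; exact Hd].
- exists (RtoC (r / Cmod w) * w)%C. assert (P : 0 < Cmod w) by lra.
  assert (Q : 0 <= r / Cmod w) by (apply Rmult_le_pos; [exact Hr | apply Rlt_le, Rinv_0_lt_compat, P]).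
  split.
  + rewrite Cmod_mult, Cmod_R, Rabs_pos_eq by exact Q. right. field. lra.
  + replace (w - RtoC (r / Cmod w) * w)%C with (RtoC (1 - r / Cmod w) * w)%C
      by (rewrite RtoC_minus; ring).
    rewrite Cmod_mult, Cmod_R, Rabs_pos_eq.
    * replace ((1 - r / Cmod w) * Cmod w) with (Cmod w - r) by (field; lra). lra.
    * apply Rmult_le_reg_r with (Cmod w); [exact P | ].
      replace ((1 - r / Cmod w) * Cmod w) with (Cmod w - r) by (field; lra). lra.
Qed.

(** A Lebesgue number of [U] over the closed disc enlarges it to a concentric disc, the form of
    neighbourhood that radius changes require. *)
Lemma hol_closed_disk_extend r h : 0 < r -> hol_closed_disk r h ->
  exists R, r < R /\ forall z, Cmod z < R -> ex_cdiff h z.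
Proof.
intros Hr [U [HU [HD Hh]]]. rewrite open_C_ball in HU.
destruct (compact_disc_uniform (fun z d => forall w, Cmod (w - z) < d -> U w) r) as [d [Hd H]].
- intros z d d' _ L K w Hw. apply K. lra.
- lra.
- intros z Hz. destruct (HU z (HD z Hz)) as [d [Hd K]].
  exists (d / 2). split; [lra | ]. intros w Hw v Hv. apply K.
  apply Rle_lt_trans with (1 := Cmod_sub _ w _). lra.
- exists (r + d). split; [lra | ]. intros z Hz. apply Hh.
  destruct (radial_projection r d z) as [z0 [Z1 Z2]]; try lra. apply (H z0); assumption.
Qed.

Lemma list_uniform (A : Type) (P : A -> R -> Prop) (l : list A) :
  (forall x, In x l -> exists d, 0 < d /\ forall d', 0 < d' -> d' <= d -> P x d') ->
  exists d, 0 < d /\ forall x, In x l -> forall d', 0 < d' -> d' <= d -> P x d'.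
Proof.
induction l as [ | a l IH]; intros H.
- exists 1. split; [lra | intros x []].
- destruct IH as [d1 [D1 K1]]; [intros x Hx; apply H; now right | ].
  destruct (H a (or_introl eq_refl)) as [d2 [D2 K2]].
  exists (Rmin d1 d2). split; [apply Rmin_pos; assumption | ].
  assert (M1 := Rmin_l d1 d2). assert (M2 := Rmin_r d1 d2).
  intros x [<- | Hx] d' P0 L; [apply K2 | apply K1]; try assumption; lra.
Qed.

(* Newton's iteration with the fixed slope [D] makes [h u - w] as small as desired,
   so the minimum of [|h - w|] over a compact disc is zero. *)
Lemma local_inverse h l D R0 : strict_cdiff h l D -> D <> 0%C ->
  (forall z, Cmod z < R0 -> ccont h z) -> Cmod l < R0 ->
  exists d0, 0 < d0 /\ forall d, 0 < d -> d <= d0 ->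
    (forall z w, Cmod (z - l) < d -> Cmod (w - l) < d ->
       Cmod D / 2 * Cmod (z - w) <= Cmod (h z - h w)) /\
    exists eta, 0 < eta /\ forall w, Cmod (w - h l) < eta -> exists z, Cmod (z - l) < d /\ h z = w.
Proof.
intros HS HD Hc Hl. assert (PD := proj1 (Cmod_gt_0 _) HD).
destruct (HS (Cmod D / 2) ltac:(lra)) as [d1 [D1 K1]].
exists (Rmin d1 (R0 - Cmod l)). split; [apply Rmin_pos; lra | ].
intros d Hd Ld. assert (M1 := Rmin_l d1 (R0 - Cmod l)). assert (M2 := Rmin_r d1 (R0 - Cmod l)).
split.
- intros z w Hz Hw. specialize (K1 z w ltac:(lra) ltac:(lra)).
  assert (T := Cmod_le_sub (D * (z - w)) (h z - h w)).
  rewrite (Cmod_minus_sym (D * (z - w))), Cmod_mult in T. lra.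
(* Then [c < d / 8], and the iterates, whose steps are at most [c / 2 ^ n], stay within
   [2 * c < d / 4] of [l], inside the compact disc of radius [d / 2]. *)
- exists (Cmod D * d / 8). split; [assert (0 < Cmod D * d) by (apply Rmult_lt_0_compat; lra); lra | ].
  intros w Hw. apply NNPP. intros No.
  set (c := Cmod (w - h l) / Cmod D).
  assert (Pc : 0 <= c) by (apply Rmult_le_pos; [apply Cmod_ge_0 | apply Rlt_le, Rinv_0_lt_compat, PD]).
  assert (Lc : c < d / 8).
  { apply Rmult_lt_reg_r with (Cmod D); [exact PD | ].
    unfold c, Rdiv. rewrite Rmult_assoc, Rinv_l by lra. lra. }
  assert (HN : forall n, exists u, Cmod (u - l) <= 2 * c * (1 - / 2 ^ n) /\
     Cmod (h u - w) <= Cmod D * c / 2 ^ n).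
  { induction n as [ | n [u [U1 U2]]].
    - exists l. rewrite Cmod_self, Cmod_minus_sym. simpl. split; [lra | ].
      unfold c. right. field. lra.
    - assert (P2 : 0 < / 2 ^ n) by (apply Rinv_0_lt_compat, pow_lt; lra).
      exists (u - (h u - w) / D)%C.
      assert (Sm : Cmod ((h u - w) / D) <= c / 2 ^ n).
      { rewrite Cmod_div by exact HD. apply Rmult_le_reg_r with (Cmod D); [exact PD | ].
        unfold Rdiv at 1. rewrite Rmult_assoc, Rinv_l by lra.
        apply Rle_trans with (Cmod (h u - w)); [lra | ]. apply Rle_trans with (1 := U2).
        right. unfold Rdiv. ring. }
      assert (V1 : Cmod (u - (h u - w) / D - l) <= 2 * c * (1 - / 2 ^ S n)).
      { replace (u - (h u - w) / D - l)%C with ((u - l) - (h u - w) / D)%C by ring.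
        apply Rle_trans with (1 := Cmod_sub_add _ _).
        apply Rle_trans with (2 * c * (1 - / 2 ^ n) + c / 2 ^ n); [lra | ].
        right. simpl. field. apply pow_nonzero; lra. }
      split; [exact V1 | ].
      assert (L1 : 2 * c * (1 - / 2 ^ n) <= 2 * c) by nra.
      assert (P2' : 0 < / 2 ^ S n) by (apply Rinv_0_lt_compat, pow_lt; lra).
      assert (L2 : 2 * c * (1 - / 2 ^ S n) <= 2 * c) by nra.
      specialize (K1 (u - (h u - w) / D)%C u ltac:(lra) ltac:(lra)).
      replace (u - (h u - w) / D - u)%C with (- ((h u - w) / D))%C in K1 by ring.
      replace (h (u - (h u - w) / D) - h u - D * - ((h u - w) / D))%C
        with (h (u - (h u - w) / D) - w)%C in K1 by (field; exact HD).
      rewrite Cmod_opp in K1. apply Rle_trans with (1 := K1).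
      apply Rle_trans with (Cmod D / 2 * (c / 2 ^ n)); [apply Rmult_le_compat_l; lra | ].
      right. simpl. field. apply pow_nonzero; lra. }
  destruct (compact_disc_uniform (fun z e => e <= Cmod (h (l + z)%C - w)) (d / 2)) as [e [He Ke]].
  + intros z e e' _ L1 L2. lra.
  + lra.
  + intros z Hz.
    assert (Lz : Cmod (l + z) < R0).
    { apply Rle_lt_trans with (1 := Cmod_triangle _ _). lra. }
    assert (N : h (l + z)%C <> w).
    { intros E. apply No. exists (l + z)%C. split; [ | exact E].
      replace (l + z - l)%C with z by ring. lra. }
    assert (PN := proj1 (Cmod_gt_0 _) (Csub_neq0 _ _ N)).
    destruct (Hc _ Lz (Cmod (h (l + z)%C - w) / 2) ltac:(lra)) as [e [He K]].
    exists (Rmin e (Cmod (h (l + z)%C - w) / 2)). split; [apply Rmin_pos; lra | ].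
    assert (A := Rmin_l e (Cmod (h (l + z)%C - w) / 2)). assert (B := Rmin_r e (Cmod (h (l + z)%C - w) / 2)).
    intros v Hv. specialize (K (l + v)%C).
    replace (l + v - (l + z))%C with (v - z)%C in K by ring. specialize (K ltac:(lra)).
    assert (T := Cmod_sub (h (l + z)%C) (h (l + v)%C) w). rewrite (Cmod_minus_sym (h (l + z)%C) (h (l + v)%C)) in T. lra.
  + destruct (small_pow2 (Cmod D * c) e He) as [N HN']. specialize (HN' N (le_n N)).
    destruct (HN N) as [u [U1 U2]].
    assert (P2 : 0 < / 2 ^ N) by (apply Rinv_0_lt_compat, pow_lt; lra).
    specialize (Ke (u - l)%C). replace (l + (u - l))%C with u in Ke by ring.
    assert (L1 : 2 * c * (1 - / 2 ^ N) <= 2 * c) by nra.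
    specialize (Ke ltac:(lra)). lra.
Qed.

Definition is_fibre (h : C -> C) (w : C) (l : list C) : Prop :=
  NoDup l /\ forall z, In z l <-> unit_disk z /\ h z = w.

Definition regular_value (h : C -> C) (w : C) : Prop :=
  (forall z, Cmod z = 1 -> h z <> w) /\
  (forall z, Cmod z < 1 -> h z = w -> forall D, cdiff h z D -> D <> 0%C).

Definition C_eq_dec (x y : C) : {x = y} + {x <> y} := excluded_middle_informative (x = y).

Lemma finite_list_exact (P : C -> Prop) (l : list C) : (forall z, P z -> In z l) ->
  exists l', NoDup l' /\ forall z, In z l' <-> P z.
Proof.
intros H.
exists (nodup C_eq_dec (filter (fun z => if excluded_middle_informative (P z) then true else false) l)).
split; [apply NoDup_nodup | ]. intros z. rewrite nodup_In, filter_In.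
destruct (excluded_middle_informative (P z)) as [Y | N]; split.
- tauto.
- intros _. split; [apply H, Y | reflexivity].
- intros [_ E]; discriminate.
- tauto.
Qed.

Lemma fibre_length h w l1 l2 : is_fibre h w l1 -> is_fibre h w l2 -> length l1 = length l2.
Proof.
intros [N1 H1] [N2 H2]. apply Nat.le_antisymm; apply NoDup_incl_length; try assumption;
  intros z Hz; [apply H2, H1 | apply H1, H2]; exact Hz.
Qed.

Section Fibres.

Variables (h : C -> C) (R0 : R).
Hypothesis HR : 1 < R0.
Hypothesis Hh : forall z, Cmod z < R0 -> ex_cdiff h z.

Lemma regular_strict w z : regular_value h w -> Cmod z < 1 -> h z = w ->
  exists D : C, D <> 0%C /\ strict_cdiff h z D.
Proof.
intros [_ HD] Hz E. destruct (holomorphic_strict h R0 z Hh) as [D HS]; [lra | ].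
exists D; split; [ | exact HS]. apply (HD z Hz E), strict_cdiff_cdiff, HS.
Qed.

(** Over [w], a nonzero strict derivative separates [z] from other preimages; elsewhere continuity
    keeps [h] away from [w]. Both cases are stated together to feed the compactness arguments. *)
Lemma regular_isolated w z : regular_value h w -> Cmod z <= 1 ->
  exists d, 0 < d /\ forall v, Cmod (v - z) < d -> h v = w -> v = z /\ Cmod z < 1.
Proof.
intros HG Hz. destruct (classic (h z = w)) as [E | N].
- assert (Z1 : Cmod z < 1).
  { destruct (Req_dec (Cmod z) 1) as [E1 | N1]; [ | lra]. destruct (proj1 HG z E1 E). }
  destruct (regular_strict w z HG Z1 E) as [D [HD HS]].
  assert (PD := proj1 (Cmod_gt_0 _) HD).
  destruct (HS (Cmod D / 2) ltac:(lra)) as [d [Hd K]].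
  exists d; split; [exact Hd | ]. intros v Hv Ev. split; [ | exact Z1].
  specialize (K v z Hv ltac:(rewrite Cmod_self; exact Hd)). rewrite Ev, E in K.
  replace (w - w - D * (v - z))%C with (- (D * (v - z)))%C in K by ring.
  rewrite Cmod_opp, Cmod_mult in K. assert (P := Cmod_ge_0 (v - z)).
  apply Csub_eq0, Cmod_eq_0. nra.
- assert (PN := proj1 (Cmod_gt_0 _) (Csub_neq0 _ _ N)).
  destruct (ex_cdiff_ccont _ _ (Hh z ltac:(lra)) _ PN) as [d [Hd K]].
  exists d; split; [exact Hd | ]. intros v Hv Ev. specialize (K v Hv). rewrite Ev in K.
  rewrite Cmod_minus_sym in K. lra.
Qed.

Lemma fibre_exists w : regular_value h w -> exists l, is_fibre h w l.
Proof.
intros HG.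
destruct (compact_disc (fun A => exists l, forall z, A z -> h z = w -> Cmod z < 1 -> In z l) 1) as [l Hl].
- intros A B S [l H]. exists l. auto.
- intros A B [l1 H1] [l2 H2]. exists (l1 ++ l2). intros z [Z | Z] E L; apply in_or_app; auto.
- lra.
- intros z Hz. destruct (regular_isolated w z HG Hz) as [d [Hd K]].
  exists d; split; [exact Hd | ]. exists (z :: nil). intros v Hv E _.
  left. symmetry. apply (K v Hv E).
- destruct (finite_list_exact (fun z => unit_disk z /\ h z = w) l) as [l' H'].
  + intros z [Z E]. apply Hl; [ | exact E | exact Z]. apply Rlt_le, Z.
  + exists l'. exact H'.
Qed.

(** The contours have radius greater than 1, so preimages just outside the closed unit disc have to
    be excluded too. *)
Lemma zeros_near_disc w l : regular_value h w -> is_fibre h w l ->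
  exists R', 1 < R' /\ R' <= R0 /\ forall z, Cmod z < R' -> h z = w -> In z l.
Proof.
intros HG [_ Hl].
destruct (compact_disc_uniform (fun z d => forall v, Cmod (v - z) < d -> h v = w -> In v l) 1) as [d [Hd K]].
- intros z d d' _ L K v Hv. apply K. lra.
- lra.
- intros z Hz. destruct (regular_isolated w z HG Hz) as [d [Hd K]].
  exists (d / 2). split; [lra | ]. intros u Hu v Hv E.
  destruct (K v) as [-> Z1]; [ | exact E | ].
  + apply Rle_lt_trans with (1 := Cmod_sub _ u _). lra.
  + apply Hl. split; [exact Z1 | exact E].
- exists (Rmin R0 (1 + d)). split; [apply Rmin_glb_lt; lra | ].
  assert (A := Rmin_l R0 (1 + d)). assert (B := Rmin_r R0 (1 + d)).
  split; [exact A | ]. intros z Hz E.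
  destruct (radial_projection 1 d z) as [z0 [Z1 Z2]]; try lra.
  apply (K z0 Z1 z Z2 E).
Qed.

(** Each point of the fibre has a disc on which [h] is injective and covers a neighbourhood of [w0];
    [g z] is the inverse branch there. The expansion estimate of [h] makes the branches Lipschitz,
    from which their differentiability will follow. *)
Lemma fibre_local w0 l : regular_value h w0 -> is_fibre h w0 l ->
  exists eta (g : C -> C -> C), 0 < eta /\
    (forall w, Cmod (w - w0) < eta -> is_fibre h w (map (fun z => g z w) l)) /\
    (forall z, In z l -> exists k, 0 < k /\ forall w w', Cmod (w - w0) < eta -> Cmod (w' - w0) < eta ->
       Cmod (g z w - g z w') <= k * Cmod (w - w')).
Proof.
intros HG [Nd Hl].
set (P := fun (z : C) (d : R) =>
  (forall v, Cmod (v - z) < d -> Cmod v < 1) /\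
  (forall z', In z' l -> z' = z \/ 2 * d <= Cmod (z' - z)) /\
  (exists c, 0 < c /\ forall u v, Cmod (u - z) < d -> Cmod (v - z) < d -> c * Cmod (u - v) <= Cmod (h u - h v)) /\
  (exists eta, 0 < eta /\ forall w, Cmod (w - w0) < eta -> exists v, Cmod (v - z) < d /\ h v = w)).
destruct (list_uniform C P l) as [d [Hd HP]].
{ intros z Hz. destruct (proj1 (Hl z) Hz) as [Z1 E]. unfold unit_disk in Z1.
  destruct (regular_strict w0 z HG Z1 E) as [D [HD HS]]. assert (PD := proj1 (Cmod_gt_0 _) HD).
  destruct (local_inverse h z D R0 HS HD) as [d0 [D0 K0]].
  { intros v Hv. apply ex_cdiff_ccont, Hh, Hv. }
  { lra. }
  destruct (list_uniform C (fun z' d => z' = z \/ 2 * d <= Cmod (z' - z)) l) as [d1 [D1 K1]].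
  { intros z' _. destruct (classic (z' = z)) as [-> | N].
    - exists 1. split; [lra | ]. intros d' _ _. now left.
    - assert (PN := proj1 (Cmod_gt_0 _) (Csub_neq0 _ _ N)).
      exists (Cmod (z' - z) / 2). split; [lra | ]. intros d' _ L. right. lra. }
  exists (Rmin (1 - Cmod z) (Rmin d0 d1)). split.
  { apply Rmin_pos; [lra | apply Rmin_pos; assumption]. }
  assert (M1 := Rmin_l (1 - Cmod z) (Rmin d0 d1)). assert (M2 := Rmin_r (1 - Cmod z) (Rmin d0 d1)).
  assert (M3 := Rmin_l d0 d1). assert (M4 := Rmin_r d0 d1).
  intros d' Pd' Ld'. destruct (K0 d' Pd' ltac:(lra)) as [KA KB]. rewrite E in KB.
  repeat split.
  - intros v Hv. assert (T := Cmod_le_sub v z). lra.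
  - intros z' Hz'. apply K1; [exact Hz' | exact Pd' | lra].
  - exists (Cmod D / 2). split; [lra | exact KA].
  - exact KB. }
specialize (fun z Hz => HP z Hz d Hd (Rle_refl d)).
destruct (list_uniform C (fun z e => forall w, Cmod (w - w0) < e -> exists v, Cmod (v - z) < d /\ h v = w) l)
  as [e1 [E1 K1]].
{ intros z Hz. destruct (HP z Hz) as [_ [_ [_ [e [He K]]]]].
  exists e; split; [exact He | ]. intros e' _ L w Hw. apply K. lra. }
specialize (fun z Hz => K1 z Hz e1 E1 (Rle_refl e1)).
(* Off the discs of radius [d] about the fibre, [|h - w0|] has a lower bound [m > 0] on the closed
   unit disc, so values closer than [m] to [w0] have no stray preimages. Near a fibre point the
   premise fails and the bound is vacuous. *)
destruct (compact_disc_uniform (fun z e => (forall z', In z' l -> d <= Cmod (z - z')) -> e <= Cmod (h z - w0)) 1)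
  as [m [Hm Km]].
{ intros z e e' _ L K Hz. specialize (K Hz). lra. }
{ lra. }
{ intros z Hz. destruct (classic (h z = w0)) as [E | N].
  - assert (Iz : In z l).
    { apply Hl. split; [ | exact E]. unfold unit_disk.
      destruct (Req_dec (Cmod z) 1) as [E' | N']; [destruct (proj1 HG z E' E) | lra]. }
    exists d; split; [exact Hd | ]. intros v Hv K. specialize (K z Iz). lra.
  - assert (PN := proj1 (Cmod_gt_0 _) (Csub_neq0 _ _ N)).
    destruct (ex_cdiff_ccont _ _ (Hh z ltac:(lra)) (Cmod (h z - w0) / 2) ltac:(lra)) as [e [He K]].
    exists (Rmin e (Cmod (h z - w0) / 2)). split; [apply Rmin_pos; lra | ].
    assert (A := Rmin_l e (Cmod (h z - w0) / 2)). assert (B := Rmin_r e (Cmod (h z - w0) / 2)).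
    intros v Hv _. specialize (K v ltac:(lra)).
    assert (T := Cmod_sub (h z) (h v) w0). rewrite (Cmod_minus_sym (h z) (h v)) in T. lra. }
set (g := fun z w => epsilon (inhabits (RtoC 0)) (fun v => Cmod (v - z) < d /\ h v = w)).
assert (Hg : forall z w, In z l -> Cmod (w - w0) < e1 -> Cmod (g z w - z) < d /\ h (g z w) = w).
{ intros z w Hz Hw. apply (epsilon_spec (inhabits (RtoC 0)) (fun v => Cmod (v - z) < d /\ h v = w)).
  apply K1; assumption. }
exists (Rmin e1 m), g. split; [apply Rmin_pos; assumption | ].
assert (A := Rmin_l e1 m). assert (B := Rmin_r e1 m).
split.
- intros w Hw. split.
  + apply NoDup_map_NoDup_ForallPairs; [ | exact Nd]. intros z z' Hz Hz' Eg.
    destruct (Hg z w Hz ltac:(lra)) as [G1 _]. destruct (Hg z' w Hz' ltac:(lra)) as [G2 _].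
    destruct (HP z' Hz') as [_ [Sep _]]. destruct (Sep z Hz) as [S | S]; [exact S | ].
    rewrite <- Eg in G2. assert (T := Cmod_sub z (g z w) z').
    rewrite (Cmod_minus_sym z (g z w)) in T. lra.
  + intros v. rewrite in_map_iff. split.
    * intros [z [<- Hz]]. destruct (Hg z w Hz ltac:(lra)) as [G1 G2].
      split; [ | exact G2]. apply (HP z Hz), G1.
    * intros [V1 V2].
      destruct (classic (forall z', In z' l -> d <= Cmod (v - z'))) as [Far | Near].
      { specialize (Km v (Rlt_le _ _ V1) Far). rewrite V2 in Km. lra. }
      apply not_all_ex_not in Near. destruct Near as [z Near].
      apply imply_to_and in Near. destruct Near as [Hz Near].
      exists z. split; [ | exact Hz].
      destruct (Hg z w Hz ltac:(lra)) as [G1 G2].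
      destruct (HP z Hz) as [_ [_ [[c [Hc K]] _]]].
      specialize (K (g z w) v G1 ltac:(lra)). rewrite G2, V2, Cmod_self in K.
      assert (P0 := Cmod_ge_0 (g z w - v)). apply Csub_eq0, Cmod_eq_0. nra.
- intros z Hz. destruct (HP z Hz) as [_ [_ [[c [Hc K]] _]]].
  exists (/ c). split; [apply Rinv_0_lt_compat, Hc | ]. intros w w' Hw Hw'.
  destruct (Hg z w Hz ltac:(lra)) as [G1 G2]. destruct (Hg z w' Hz ltac:(lra)) as [G1' G2'].
  specialize (K _ _ G1 G1'). rewrite G2, G2' in K.
  apply Rmult_le_reg_l with c; [exact Hc | ]. rewrite <- Rmult_assoc, Rinv_r by lra. lra.
Qed.

End Fibres.

(** * Functionals vanishing on multiples of a function *)

Fixpoint psum (c : nat -> C) (n : nat) (a : C) : C :=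
  match n with O => 0%C | S m => (psum c m a + c m * a ^ m)%C end.

Lemma ccont_psum c n a : ccont (psum c n) a.
Proof.
induction n as [ | n IH]; [exact (ccont_const 0 a) | ].
apply (ccont_plus (psum c n) (fun a => c n * a ^ n)%C); [exact IH | ].
apply ccont_mult; [apply ccont_const | apply ccont_pow].
Qed.

Lemma J_psum r c n G : 0 <= r -> ccont_circle G r ->
  (forall k, J r (fun z => z ^ k * G z)%C = 0%C) -> J r (fun z => psum c n z * G z)%C = 0%C.
Proof.
intros Hr HG H.
assert (Ck : forall k, ccont_circle (fun z => z ^ k * G z)%C r).
{ intros k z Hz. apply ccont_mult; [apply ccont_pow | apply HG, Hz]. }
assert (Cp : forall k, ccont_circle (fun z => psum c k z * G z)%C r).
{ intros k z Hz. apply ccont_mult; [apply ccont_psum | apply HG, Hz]. }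
induction n as [ | n IH].
- rewrite (J_ext r _ (fun _ => 0%C)); [rewrite J_const; ring | exact Hr | ].
  intros z _. simpl. ring.
- rewrite (J_ext r _ (fun z => psum c n z * G z + c n * (z ^ n * G z))%C); [ | exact Hr | ].
  + rewrite (J_plus r (fun z => psum c n z * G z)%C (fun z => c n * (z ^ n * G z))%C), IH.
    * rewrite J_scal, H; [ring | exact Hr | apply Ck].
    * exact Hr.
    * apply Cp.
    * intros z Hz. apply ccont_mult; [apply ccont_const | apply Ck, Hz].
  + intros z _. simpl. ring.
Qed.

Lemma Cpow_neq0 (z : C) n : z <> 0%C -> (z ^ n)%C <> 0%C.
Proof. intros H. apply Cpow_nz. exact H. Qed.

(* Expand the Cauchy kernel on a larger circle into a finite geometric sum. *)
Lemma polynomial_approximation F R0 L r eps :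
  (forall z, Cmod z < R0 -> ccont F z) ->
  (forall z, Cmod z < R0 -> ~ In z L -> ex_cdiff F z) ->
  0 < r < R0 -> (forall z, Cmod z = r -> ~ In z L) -> 0 < eps ->
  exists c n, forall a, Cmod a = r -> Cmod (F a - psum c n a) <= eps.
Proof.
intros HF HL Hr Hr' He. assert (TP := two_PI_pos).
set (s := (r + R0) / 2). assert (Hs : r < s < R0) by (unfold s; lra).
destruct (ccont_circle_bounded F s) as [M [HM BM]]; [lra | intros z Hz; apply HF; lra | ].
assert (TPC : RtoC (2 * PI) <> 0%C) by (apply Cmod_gt_0; rewrite Cmod_R, Rabs_pos_eq; lra).
(* [c n] is Cauchy's integral for the Taylor coefficient, and [T n a] carries what remains of the
   kernel after [n] terms of its geometric expansion. *)
set (c := fun n => (/ RtoC (2 * PI) * J s (fun z => F z * / (z ^ n)))%C).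
set (T := fun n a => J s (fun z => F z * (/ (z ^ n) * (z * / (z - a))))%C).
assert (Z0 : forall z, Cmod z = s -> z <> 0%C) by (intros z Hz; apply Cmod_gt_0; lra).
assert (ZN : forall z a, Cmod z = s -> Cmod a = r -> z <> a).
{ intros z a Hz Ha. apply Cmod_neq. lra. }
assert (Cn : forall n, ccont_circle (fun z => F z * / (z ^ n))%C s).
{ intros n z Hz. apply ccont_mult; [apply HF; lra | ].
  apply ccont_inv; [apply ccont_pow | apply Cpow_neq0, Z0, Hz]. }
assert (CT : forall n a, Cmod a = r -> ccont_circle (fun z => F z * (/ (z ^ n) * (z * / (z - a))))%C s).
{ intros n a Ha z Hz. apply ccont_mult; [apply HF; lra | apply ccont_mult].
  - apply ccont_inv; [apply ccont_pow | apply Cpow_neq0, Z0, Hz].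
  - apply ccont_mult; [apply ccont_id | apply ccont_kernel, ZN; assumption]. }
assert (E : forall n a, Cmod a = r -> (F a = psum c n a + a ^ n * (/ RtoC (2 * PI) * T n a))%C).
{ intros n a Ha. induction n as [ | n IH].
  - simpl. unfold T. rewrite (J_ext s _ (fun z => F z * (z * / (z - a)))%C); [ | lra | ].
    + rewrite (Cauchy_formula F R0 L a s HF HL); [field; exact TPC | | lra | lra].
      apply HL; [lra | apply Hr', Ha].
    + intros z Hz. simpl. field. apply Csub_neq0, ZN; assumption.
  - rewrite IH at 1. simpl.
    assert (ET : T n a = (J s (fun z => F z * / (z ^ n)) + a * T (S n) a)%C).
    { unfold T. rewrite <- J_scal by (lra || apply CT, Ha).
      rewrite <- J_plus; [ | lra | apply Cn | ].
      - apply J_ext; [lra | ]. intros z Hz. simpl. field.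
        repeat split; first [apply (Z0 z Hz) | apply (Cpow_neq0 z n), Z0, Hz | apply Csub_neq0, ZN; assumption].
      - intros z Hz. apply ccont_mult; [apply ccont_const | apply CT; assumption]. }
    rewrite ET. unfold c. ring. }
(* This bounds [F z * (z / (z - a))] for [|z| = s] and [|a| = r], so that the remainder is at most
   [(r / s) ^ n * B]. *)
set (B := M * (s * / (s - r))).
assert (PB : 0 < B).
{ unfold B. apply Rmult_lt_0_compat; [lra | ]. apply Rmult_lt_0_compat; [lra | ].
  apply Rinv_0_lt_compat; lra. }
destruct (pow_lt_1_zero (r / s)) with (y := eps / B) as [n Hn].
{ rewrite Rabs_pos_eq; [ | apply Rlt_le, Rdiv_lt_0_compat; lra].
  apply Rmult_lt_reg_r with s; [lra | ]. unfold Rdiv. rewrite Rmult_assoc, Rinv_l; lra. }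
{ apply Rdiv_lt_0_compat; assumption. }
exists c, n. intros a Ha. specialize (Hn n (le_n n)).
rewrite (E n a Ha).
replace (psum c n a + a ^ n * (/ RtoC (2 * PI) * T n a) - psum c n a)%C
  with (a ^ n * (/ RtoC (2 * PI) * T n a))%C by ring.
rewrite !Cmod_mult, Cmod_pow, Ha, Cmod_inv, Cmod_R, (Rabs_pos_eq (2 * PI)) by (assumption || lra).
assert (BT : Cmod (T n a) <= 2 * PI * (/ s ^ n * B)).
{ apply J_bound; [lra | apply CT, Ha | ]. intros z Hz.
  rewrite !Cmod_mult, !Cmod_inv, Cmod_pow, Hz.
  2: { apply Csub_neq0, ZN; assumption. } 2: { apply Cpow_neq0, Z0, Hz. }
  assert (P1 : 0 < / s ^ n) by (apply Rinv_0_lt_compat, pow_lt; lra).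
  assert (P2 : s - r <= Cmod (z - a)) by (assert (Q := Cmod_sub_le z a); lra).
  assert (P3 : / Cmod (z - a) <= / (s - r)) by (apply Rinv_le_contravar; lra).
  assert (P4 : 0 < / Cmod (z - a)) by (apply Rinv_0_lt_compat; lra).
  unfold B. replace (/ s ^ n * (M * (s * / (s - r)))) with (M * (/ s ^ n * (s * / (s - r)))) by ring.
  apply Rmult_le_compat; [apply Cmod_ge_0 | | apply BM, Hz | ].
  - apply Rmult_le_pos; [lra | apply Rmult_le_pos; lra].
  - apply Rmult_le_compat_l; [lra | ]. apply Rmult_le_compat_l; lra. }
assert (Pr : 0 < r ^ n) by (apply pow_lt; lra).
apply Rle_trans with (r ^ n * (/ (2 * PI) * (2 * PI * (/ s ^ n * B)))).
- apply Rmult_le_compat_l; [lra | ]. apply Rmult_le_compat_l; [ | exact BT].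
  apply Rlt_le, Rinv_0_lt_compat, TP.
- replace (r ^ n * (/ (2 * PI) * (2 * PI * (/ s ^ n * B)))) with ((r / s) ^ n * B).
  + rewrite Rabs_pos_eq in Hn by (apply pow_le, Rlt_le, Rdiv_lt_0_compat; lra).
    apply Rle_trans with (eps / B * B); [apply Rmult_le_compat_r; lra | ].
    right. field. lra.
  + unfold Rdiv. rewrite Rpow_mult_distr, pow_inv. field.
    split; [apply pow_nonzero; lra | assert (P := PI_RGT_0); lra].
Qed.

(** The functional [f |-> J r (f G)] is continuous for the supremum norm on the circle, so it kills
    uniform limits of polynomials once it kills all powers. *)
Lemma J_annihilates F R0 L r G :
  (forall z, Cmod z < R0 -> ccont F z) ->
  (forall z, Cmod z < R0 -> ~ In z L -> ex_cdiff F z) ->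
  0 < r < R0 -> (forall z, Cmod z = r -> ~ In z L) -> ccont_circle G r ->
  (forall k, J r (fun z => z ^ k * G z)%C = 0%C) -> J r (fun z => F z * G z)%C = 0%C.
Proof.
intros HF HL Hr Hr' HG H. assert (TP := two_PI_pos).
destruct (ccont_circle_bounded G r) as [M [HM BM]]; [lra | exact HG | ].
apply Cmod_le_eps_0. intros eps He.
destruct (polynomial_approximation F R0 L r (eps / (2 * PI * M)) HF HL Hr Hr') as [c [n K]].
{ apply Rdiv_lt_0_compat; [exact He | apply Rmult_lt_0_compat; lra]. }
assert (CF : ccont_circle (fun z => F z * G z)%C r).
{ intros z Hz. apply ccont_mult; [apply HF; lra | apply HG, Hz]. }
assert (CP : ccont_circle (fun z => psum c n z * G z)%C r).
{ intros z Hz. apply ccont_mult; [apply ccont_psum | apply HG, Hz]. }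
replace (J r (fun z => F z * G z)%C)
  with (J r (fun z => F z * G z)%C - J r (fun z => psum c n z * G z)%C)%C
  by (rewrite (J_psum r c n G); [ring | lra | exact HG | exact H]).
rewrite <- J_minus by (assumption || lra).
replace eps with (2 * PI * (eps / (2 * PI * M) * M))
  by (field; assert (P := PI_RGT_0); lra).
apply J_bound; [lra | intros z Hz; apply ccont_minus; [apply CF, Hz | apply CP, Hz] | ].
intros z Hz. replace (F z * G z - psum c n z * G z)%C with ((F z - psum c n z) * G z)%C by ring.
rewrite Cmod_mult. apply Rmult_le_compat; try apply Cmod_ge_0; [apply K, Hz | apply BM, Hz].
Qed.

(** * Lagrange interpolation and division by simple zeros *)

Definition csum (f : C -> C) (l : list C) : C := fold_right (fun x acc => f x + acc)%C 0%C l.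

Lemma csum_ext (f g : C -> C) l : (forall x, In x l -> f x = g x) -> csum f l = csum g l.
Proof.
induction l as [ | x l IH]; intros H; [reflexivity | ].
simpl. rewrite H by now left. f_equal. apply IH. intros y Hy. apply H. now right.
Qed.

Lemma csum_mult_r (c e : C -> C) (a : C) l :
  csum (fun x => c x * (e x * a))%C l = (csum (fun x => c x * e x)%C l * a)%C.
Proof. induction l as [ | y l IH]; simpl; [ring | rewrite IH; ring]. Qed.

Lemma csum_zero (f : C -> C) l : (forall x, In x l -> f x = 0%C) -> csum f l = 0%C.
Proof.
induction l as [ | x l IH]; intros H; [reflexivity | ].
simpl. rewrite H, IH; [ring | intros y Hy; apply H; now right | now left].
Qed.

Lemma csum_single (f : C -> C) l y : NoDup l -> In y l -> (forall x, In x l -> x <> y -> f x = 0%C) ->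
  csum f l = f y.
Proof.
induction l as [ | x l IH]; intros N I H; [destruct I | ].
inversion N as [ | ? ? N1 N2]; subst. simpl. destruct I as [<- | I].
- rewrite csum_zero; [ring | ]. intros y Hy. apply H; [now right | ]. intros ->. auto.
- rewrite IH; [ | exact N2 | exact I | intros z Hz; apply H; now right].
  rewrite H; [ring | now left | ]. intros ->. auto.
Qed.

Lemma J_csum r (c : C -> C) (e : C -> C -> C) l : 0 <= r ->
  (forall x, ccont_circle (e x) r) ->
  J r (fun z => csum (fun x => c x * e x z)%C l) = csum (fun x => c x * J r (e x))%C l.
Proof.
intros Hr He. induction l as [ | x l IH].
- simpl. rewrite J_const. ring.
- simpl. rewrite <- IH, <- J_scal by auto. rewrite <- J_plus; [reflexivity | exact Hr | | ].
  + intros z Hz. apply ccont_mult; [apply ccont_const | apply He, Hz].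
  + intros z Hz. clear IH. induction l as [ | y l IH]; [exact (ccont_const 0 z) | ].
    apply (ccont_plus (fun z => c y * e y z)%C (fun z => csum (fun x => c x * e x z)%C l)); [ | exact IH].
    apply ccont_mult; [apply ccont_const | apply He, Hz].
Qed.

Definition lagrange (l : list C) (x z : C) : C :=
  fold_right (fun y acc => (z - y) * / (x - y) * acc)%C 1%C (remove C_eq_dec x l).

Lemma lagrange_same l x : lagrange l x x = 1%C.
Proof.
unfold lagrange. assert (H := remove_In C_eq_dec l x).
induction (remove C_eq_dec x l) as [ | y l' IH]; [reflexivity | ].
simpl. rewrite IH.
- field. apply Csub_neq0. intros ->. apply H. now left.
- intros I. apply H. now right.
Qed.

Lemma lagrange_other l x y : In y l -> y <> x -> lagrange l x y = 0%C.
Proof.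
intros I N. unfold lagrange. assert (H := in_in_remove C_eq_dec l N I).
induction (remove C_eq_dec x l) as [ | u l' IH]; [destruct H | ].
simpl. destruct H as [-> | H]; [ring | ]. rewrite IH by exact H. ring.
Qed.

Lemma ex_cdiff_lagrange l x z : ex_cdiff (lagrange l x) z.
Proof.
unfold lagrange. induction (remove C_eq_dec x l) as [ | y l' IH]; [exact (ex_cdiff_const 1 z) | ].
apply (ex_cdiff_mult (fun z => (z - y) * / (x - y))%C); [ | exact IH].
apply ex_cdiff_mult; [ | apply ex_cdiff_const].
apply ex_cdiff_minus; [apply ex_cdiff_id | apply ex_cdiff_const].
Qed.

Lemma ex_cdiff_csum (c : C -> C) (e : C -> C -> C) l z : (forall x, ex_cdiff (e x) z) ->
  ex_cdiff (fun z => csum (fun x => c x * e x z)%C l) z.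
Proof.
intros He. induction l as [ | y l IH]; [exact (ex_cdiff_const 0 z) | ].
apply (ex_cdiff_plus (fun z => c y * e y z)%C (fun z => csum (fun x => c x * e x z)%C l)); [ | exact IH].
apply ex_cdiff_mult; [apply ex_cdiff_const | apply He].
Qed.

Lemma lagrange_interpolates (f : C -> C) l y : NoDup l -> In y l ->
  csum (fun x => f x * lagrange l x y)%C l = f y.
Proof.
intros N I. rewrite (csum_single (fun x => f x * lagrange l x y)%C l y N I).
- change (f y * lagrange l y y = f y)%C. rewrite lagrange_same. ring.
- intros x Hx Hn. change (f x * lagrange l x y = 0)%C. rewrite lagrange_other; [ring | exact I | auto].
Qed.

(** At a simple zero of [u] both functions factor through continuous slopes, and the quotient of the
    slopes extends [N / u]. Only continuity is claimed at these points, which is what Cauchy's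
    formula with exceptions accepts. *)
Lemma removable_quotient N u l R0 :
  (forall z, Cmod z < R0 -> ex_cdiff N z) -> (forall z, Cmod z < R0 -> ex_cdiff u z) ->
  (forall z, Cmod z < R0 -> u z = 0%C -> In z l) ->
  (forall z, In z l -> u z = 0%C /\ N z = 0%C /\ forall D, cdiff u z D -> D <> 0%C) ->
  exists F, (forall z, Cmod z < R0 -> ccont F z) /\
    (forall z, Cmod z < R0 -> ~ In z l -> ex_cdiff F z) /\
    (forall z, Cmod z < R0 -> (F z * u z = N z)%C).
Proof.
intros HN Hu Hz Hl.
assert (Lim : forall z, Cmod z < R0 -> In z l -> exists v, exists p, ccont p z /\ p z = v /\
  exists e, 0 < e /\ forall w, Cmod (w - z) < e -> w <> z -> u w <> 0%C /\ (N w * / u w)%C = p w).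
{ intros z Lz Iz. destruct (Hl z Iz) as [u0 [N0 D0]].
  destruct (proj1 (ex_cdiff_slope N z) (HN z Lz)) as [p [Hp Ep]].
  destruct (proj1 (ex_cdiff_slope u z) (Hu z Lz)) as [q [Hq Eq]].
  assert (Q0 : q z <> 0%C).
  { apply D0. apply cdiff_eps. intros eps He. destruct (Hq eps He) as [d [Hd K]].
    exists d; split; [exact Hd | ]. intros w Hw. rewrite Eq.
    replace ((w - z) * q w - q z * (w - z))%C with ((q w - q z) * (w - z))%C by ring.
    rewrite Cmod_mult. apply Rmult_le_compat_r; [apply Cmod_ge_0 | apply Rlt_le, K, Hw]. }
  destruct (Hq _ (proj1 (Cmod_gt_0 _) Q0)) as [e [He K]].
  exists (p z * / q z)%C, (fun w => p w * / q w)%C.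
  split; [apply ccont_mult; [exact Hp | apply ccont_inv; assumption] | ].
  split; [reflexivity | ]. exists e; split; [exact He | ]. intros w Hw Nw.
  assert (Qw : q w <> 0%C).
  { intros E. specialize (K w Hw). rewrite E, Cmod_minus_sym in K.
    unfold Cminus in K. rewrite Copp_0, Cplus_0_r in K. lra. }
  specialize (Ep w). specialize (Eq w). rewrite N0 in Ep. rewrite u0 in Eq.
  replace (N w) with ((w - z) * p w)%C by (rewrite <- Ep; ring).
  replace (u w) with ((w - z) * q w)%C by (rewrite <- Eq; ring).
  assert (W := Csub_neq0 _ _ Nw). split; [apply Cmult_neq_0; assumption | ].
  field. split; assumption. }
(* [v z] picks the limit of [N / u] at the zero [z]. *)
set (v := fun z => epsilon (inhabits (RtoC 0)) (fun v => exists p, ccont p z /\ p z = v /\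
  exists e, 0 < e /\ forall w, Cmod (w - z) < e -> w <> z -> u w <> 0%C /\ (N w * / u w)%C = p w)).
set (F := fun z => if excluded_middle_informative (In z l) then v z else (N z * / u z)%C).
assert (F0 : forall z, ~ In z l -> F z = (N z * / u z)%C).
{ intros z Hn. unfold F. destruct (excluded_middle_informative (In z l)); tauto. }
assert (Loc : forall z, Cmod z < R0 -> ~ In z l -> exists e, 0 < e /\
  forall w, Cmod (w - z) < e -> (N w * / u w)%C = F w).
{ intros z Lz Hn.
  assert (Uz : u z <> 0%C) by (intros E; apply Hn, Hz; assumption).
  destruct (ex_cdiff_ccont _ _ (Hu z Lz) _ (proj1 (Cmod_gt_0 _) Uz)) as [e [He K]].
  exists e; split; [exact He | ]. intros w Hw. symmetry. apply F0. intros Iw.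
  specialize (K w Hw). destruct (Hl w Iw) as [E _]. rewrite E, Cmod_minus_sym in K.
  unfold Cminus in K. rewrite Copp_0, Cplus_0_r in K. lra. }
assert (Dq : forall z, Cmod z < R0 -> ~ In z l -> ex_cdiff F z).
{ intros z Lz Hn. destruct (Loc z Lz Hn) as [e [He E]].
  apply ex_cdiff_ext_loc with (1 := He) (2 := E).
  apply ex_cdiff_mult; [apply HN, Lz | apply ex_cdiff_inv; [apply Hu, Lz | ]].
  intros E0. apply Hn, Hz; assumption. }
exists F. split; [ | split; [exact Dq | ]].
- intros z Lz. destruct (classic (In z l)) as [Iz | Hn]; [ | apply ex_cdiff_ccont, Dq; assumption].
  destruct (epsilon_spec (inhabits (RtoC 0)) _ (Lim z Lz Iz)) as [p [Hp [Ev [e [He K]]]]].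
  apply ccont_ext_loc with (1 := He) (3 := Hp). intros w Hw.
  destruct (classic (w = z)) as [-> | Nw].
  + unfold F. destruct (excluded_middle_informative (In z l)) as [_ | Hn]; [exact Ev | tauto].
  + destruct (K w Hw Nw) as [Uw <-]. symmetry. apply F0. intros Iw. now destruct (Hl w Iw).
- intros z Lz. destruct (classic (In z l)) as [Iz | Hn].
  + destruct (Hl z Iz) as [-> [-> _]]. ring.
  + rewrite F0 by exact Hn. field. intros E. apply Hn, Hz; assumption.
Qed.

(* [z ^ k] minus its Lagrange interpolant at the simple zeros [l] of [u] is divisible
   by [u], hence annihilated by the functional [f |-> J r (f G)]. *)
Lemma moments_interpolate u l R0 r G :
  0 < r < R0 -> (forall z, Cmod z < R0 -> ex_cdiff u z) -> NoDup l ->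
  (forall z, Cmod z < R0 -> u z = 0%C -> In z l) ->
  (forall z, In z l -> Cmod z < r /\ u z = 0%C /\ forall D, cdiff u z D -> D <> 0%C) ->
  ccont_circle G r ->
  (forall k, J r (fun z => z ^ k * (u z * G z))%C = 0%C) ->
  forall k, J r (fun z => z ^ k * G z)%C = csum (fun x => x ^ k * J r (fun z => lagrange l x z * G z))%C l.
Proof.
intros Hr Hu Nd Hz Hl HG H k.
set (Lk := fun z => csum (fun x => x ^ k * lagrange l x z)%C l).
assert (DL : forall z, ex_cdiff Lk z).
{ intros z. apply (ex_cdiff_csum (fun x => x ^ k)%C (lagrange l)). intros x. apply ex_cdiff_lagrange. }
destruct (removable_quotient (fun z => z ^ k - Lk z)%C u l R0) as [F [F1 [F2 F3]]].
- intros z _. apply ex_cdiff_minus; [apply ex_cdiff_pow | apply DL].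
- exact Hu.
- exact Hz.
- intros z Iz. destruct (Hl z Iz) as [_ [U0 D0]]. split; [exact U0 | split; [ | exact D0]].
  unfold Lk. rewrite (lagrange_interpolates (fun x => x ^ k)%C l z Nd Iz). ring.
- assert (Cu : ccont_circle (fun z => u z * G z)%C r).
  { intros z Ez. apply ccont_mult; [apply ex_cdiff_ccont, Hu; lra | apply HG, Ez]. }
  assert (A : J r (fun z => F z * (u z * G z))%C = 0%C).
  { apply (J_annihilates F R0 l r (fun z => u z * G z)%C F1 F2 Hr); try assumption.
    intros z Ez Iz. destruct (Hl z Iz) as [L _]. lra. }
  assert (Ck : ccont_circle (fun z => z ^ k * G z)%C r).
  { intros z Ez. apply ccont_mult; [apply ccont_pow | apply HG, Ez]. }
  assert (Cl : forall x, ccont_circle (fun z => lagrange l x z * G z)%C r).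
  { intros x z Ez. apply ccont_mult; [apply ex_cdiff_ccont, ex_cdiff_lagrange | apply HG, Ez]. }
  rewrite <- (J_csum r (fun x => x ^ k)%C (fun x z => lagrange l x z * G z)%C l) by (assumption || lra).
  cbv beta.
  assert (EL : forall z, csum (fun x => x ^ k * (lagrange l x z * G z))%C l = (Lk z * G z)%C).
  { intros z. apply (csum_mult_r (fun x => x ^ k)%C (fun x => lagrange l x z)). }
  rewrite (J_ext r (fun z => csum (fun x => x ^ k * (lagrange l x z * G z))%C l) (fun z => Lk z * G z)%C);
    [ | lra | intros z _; apply EL].
  apply Csub_eq0. rewrite <- J_minus; [ | lra | exact Ck | ].
  + rewrite <- A. apply J_ext; [lra | ]. intros z Ez.
    rewrite Cmult_assoc, F3 by lra. ring.
  + intros z Ez. apply ccont_mult; [apply ex_cdiff_ccont, DL | apply HG, Ez].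
Qed.

(** * The backward shift and its eigenvectors *)

(** Finitely many initial terms only cost a constant; the induction on [N] removes the first term of
    the sequence. *)
Lemma eventually_increasing_quotient (u : nat -> R) (N : nat) :
  (forall k, 0 < u k) -> (forall k, (N <= k)%nat -> u k <= u (S k)) ->
  exists B, 0 < B /\ forall k m, u k <= B * u (k + m)%nat.
Proof.
revert u. induction N as [ | N IH]; intros u Hu Hm.
- exists 1. split; [lra | ]. intros k m. induction m as [ | m IHm].
  + rewrite Nat.add_0_r. lra.
  + rewrite Nat.add_succ_r. specialize (Hm (k + m)%nat ltac:(lia)). lra.
- destruct (IH (fun k => u (S k))) as [B [HB H]].
  + intros k; apply Hu.
  + intros k Hk. apply Hm. lia.
  + assert (P0 := Hu O). assert (P1 := Hu 1%nat).
    assert (Q : 0 < u O / u 1%nat) by (apply Rdiv_lt_0_compat; assumption).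
    assert (QB : 0 < u O / u 1%nat * B) by (apply Rmult_lt_0_compat; assumption).
    (* The summand 1 settles [k = m = 0], [B] the shifted sequence, and the last term passes from
       [u 0] to [u 1]. *)
    exists (1 + B + u O / u 1%nat * B). split; [lra | ]. intros [ | k] m.
    * destruct m as [ | m]; [simpl; nra | ]. specialize (H O m). specialize (Hu (S m)).
      change (0 + S m)%nat with (S m). change (S (0 + m)) with (S m) in H.
      replace (u O) with (u O / u 1%nat * u 1%nat) at 1 by (field; lra).
      apply Rle_trans with (u O / u 1%nat * (B * u (S m))); [apply Rmult_le_compat_l; lra | ].
      rewrite <- Rmult_assoc. apply Rmult_le_compat_r; lra.
    * specialize (H k m). specialize (Hu (S (k + m))). simpl in *.
      apply Rle_trans with (1 := H). apply Rmult_le_compat_r; lra.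
Qed.

Section WeightedShift.

Variable b : weight_seq.
Hypothesis Hw : is_lim_seq (weight b) 1.

Lemma weight_eventually e : 0 < e ->
  exists N, forall k, (N <= k)%nat -> (1 - e) * b k <= b (S k) /\ b (S k) <= (1 + e) * b k.
Proof.
intros He. destruct (proj2 (is_lim_seq_spec _ _) Hw (mkposreal e He)) as [N HN].
exists N. intros k Hk. specialize (HN (S k) ltac:(lia)). simpl in HN. unfold weight in HN. simpl pred in HN.
apply Rabs_def2 in HN. assert (P := beta_pos b k).
replace (b (S k)) with (b (S k) / b k * b k) by (field; lra).
split; apply Rmult_le_compat_r; lra.
Qed.

(** The sequence [s ^ k / b k] is eventually increasing. The bound lets geometric sequences of ratio
    less than 1 belong to the space. *)
Lemma weight_upper s : 1 < s -> exists B, 0 < B /\ forall k, b k <= B * s ^ k.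
Proof.
intros Hs. destruct (weight_eventually (s - 1)) as [N HN]; [lra | ].
destruct (eventually_increasing_quotient (fun k => s ^ k / b k) N) as [B [HB H]].
- intros k. apply Rdiv_lt_0_compat; [apply pow_lt; lra | apply beta_pos].
- intros k Hk. destruct (HN k Hk) as [_ L]. assert (P := beta_pos b k). assert (P' := beta_pos b (S k)).
  assert (Q : 0 < s ^ k) by (apply pow_lt; lra).
  apply Rmult_le_reg_r with (b k * b (S k)); [apply Rmult_lt_0_compat; assumption | ].
  replace (s ^ k / b k * (b k * b (S k))) with (s ^ k * b (S k)) by (field; lra).
  replace (s ^ S k / b (S k) * (b k * b (S k))) with (s ^ k * (s * b k)) by (simpl; field; lra).
  apply Rmult_le_compat_l; [lra | ]. replace (1 + (s - 1)) with s in L by ring. exact L.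
- exists B. split; [exact HB | ]. intros k. specialize (H O k). simpl in H. rewrite beta_0 in H.
  assert (P := beta_pos b k).
  apply Rmult_le_reg_r with (/ b k); [apply Rinv_0_lt_compat, P | ].
  rewrite Rinv_r by lra. unfold Rdiv in H. lra.
Qed.

(** The sequence [s ^ k * b k] is eventually increasing. The bound controls the powers of the
    backward shift. *)
Lemma weight_lower s : 1 < s -> exists B, 0 < B /\ forall k m, b k <= B * s ^ m * b (k + m)%nat.
Proof.
intros Hs. assert (I : 0 < / s) by (apply Rinv_0_lt_compat; lra).
assert (I1 : / s < 1) by (rewrite <- Rinv_1; apply Rinv_lt_contravar; lra).
destruct (weight_eventually (1 - / s)) as [N HN]; [lra | ].
destruct (eventually_increasing_quotient (fun k => s ^ k * b k) N) as [B [HB H]].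
- intros k. apply Rmult_lt_0_compat; [apply pow_lt; lra | apply beta_pos].
- intros k Hk. destruct (HN k Hk) as [L _]. assert (Q : 0 < s ^ k) by (apply pow_lt; lra).
  simpl. replace (s * s ^ k * b (S k)) with (s ^ k * (s * b (S k))) by ring.
  apply Rmult_le_compat_l; [lra | ].
  replace (1 - (1 - / s)) with (/ s) in L by ring.
  replace (b k) with (s * (/ s * b k)) by (field; lra). apply Rmult_le_compat_l; lra.
- exists B. split; [exact HB | ]. intros k m. specialize (H k m). cbv beta in H.
  rewrite pow_add in H. assert (Q : 0 < s ^ k) by (apply pow_lt; lra).
  apply Rmult_le_reg_l with (s ^ k); [exact Q | ].
  replace (s ^ k * (B * s ^ m * b (k + m)%nat)) with (B * (s ^ k * s ^ m * b (k + m)%nat)) by ring.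
  exact H.
Qed.

Definition cf (x : H2 b) (k : nat) : C := @coef b x k.

Lemma cf_ext (x y : H2 b) : (forall k, cf x k = cf y k) -> x = y.
Proof. apply (@H2_ext b). Qed.

Lemma cf_plus (x y : H2 b) k : cf (plus x y) k = (cf x k + cf y k)%C.
Proof. reflexivity. Qed.

Lemma cf_scal (c : C) (x : H2 b) k : cf (scal c x) k = (c * cf x k)%C.
Proof. reflexivity. Qed.

Lemma cf_minus (x y : H2 b) k : cf (minus x y) k = (cf x k - cf y k)%C.
Proof. reflexivity. Qed.

Lemma cf_zero k : cf zero k = 0%C.
Proof. reflexivity. Qed.

Lemma cf_S x k : cf (S_beta Hw x) k = cf x (S k).
Proof. reflexivity. Qed.

Lemma cf_norm (x : H2 b) k : Cmod (cf x k) * b k <= norm x.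
Proof. exact (@H2_coef_norm b x k). Qed.

Lemma H2_norm_sqr (x : H2 b) : norm x * norm x = Series (fun k => Cmod (cf x k) ^ 2 * b k ^ 2).
Proof.
rewrite <- (@H2_inner_diag b x : _ = Series (fun k => Cmod (cf x k) ^ 2 * b k ^ 2)).
exact (@ip_norm_sqr (H2_ModuleSpace b) (@H2_inner b) (@H2_inner_pos b) x).
Qed.

Lemma H2_partial_le (x : H2 b) K : sum_n (fun k => Cmod (cf x k) ^ 2 * b k ^ 2) K <= norm x * norm x.
Proof.
rewrite H2_norm_sqr. apply partial_sum_le; [apply (@H2_term_pos b) | exact (proj2_sig x)].
Qed.

Lemma H2_norm_ge0 (x : H2 b) : 0 <= norm x.
Proof. exact (@ip_norm_ge0 (H2_ModuleSpace b) (@H2_inner b) x). Qed.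

Lemma H2_norm_le (x : H2 b) M : 0 <= M ->
  (forall K, sum_n (fun k => Cmod (cf x k) ^ 2 * b k ^ 2) K <= M * M) -> norm x <= M.
Proof.
intros HM H. apply Rsqr_incr_0_var; [ | exact HM]. unfold Rsqr. rewrite H2_norm_sqr.
refine (is_lim_seq_le _ _ (Finite _) (Finite (M * M)) H
          (Series_correct _ (proj2_sig x)) (is_lim_seq_const _)).
Qed.

Lemma sum_n_shift_le (u : nat -> R) m : (forall k, 0 <= u k) ->
  forall K, sum_n (fun k => u (k + m)%nat) K <= sum_n u (K + m)%nat.
Proof.
intros Hu. induction K as [ | K IH].
- rewrite sum_O. apply term_le_sum, Hu.
- rewrite sum_Sn. change (S K + m)%nat with (S (K + m)). rewrite sum_Sn.
  change plus with Rplus. lra.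
Qed.

Lemma cf_iter m x k : cf (Nat.iter m (S_beta Hw) x) k = cf x (k + m)%nat.
Proof.
revert k. induction m as [ | m IH]; intros k.
- rewrite Nat.add_0_r. reflexivity.
- simpl Nat.iter. rewrite cf_S, IH. f_equal. lia.
Qed.

(** As [s] is arbitrarily close to 1, this amounts to a spectral radius of at most 1. *)
Lemma shift_norm s : 1 < s -> exists B, 0 < B /\ forall m x,
  norm (Nat.iter m (S_beta Hw) x) <= B * s ^ m * norm x.
Proof.
intros Hs. destruct (weight_lower s Hs) as [B [HB H]]. exists B. split; [exact HB | ].
intros m x. assert (Q : 0 < s ^ m) by (apply pow_lt; lra).
assert (PX := H2_norm_ge0 x).
assert (BQ : 0 < B * s ^ m) by (apply Rmult_lt_0_compat; assumption).
apply H2_norm_le; [apply Rmult_le_pos; lra | ].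
intros K.
apply Rle_trans with (sum_n (fun k => (B * s ^ m) ^ 2 * (Cmod (cf x (k + m)%nat) ^ 2 * b (k + m)%nat ^ 2)) K).
- apply sum_n_m_le. intros k. rewrite cf_iter.
  specialize (H k m). assert (P := beta_pos b k).
  assert (b k ^ 2 <= (B * s ^ m * b (k + m)%nat) ^ 2) by (apply pow_incr; lra).
  assert (0 <= Cmod (cf x (k + m)%nat) ^ 2) by apply pow2_ge_0.
  replace ((B * s ^ m) ^ 2 * (Cmod (cf x (k + m)%nat) ^ 2 * b (k + m)%nat ^ 2))
    with (Cmod (cf x (k + m)%nat) ^ 2 * (B * s ^ m * b (k + m)%nat) ^ 2) by ring.
  apply Rmult_le_compat_l; assumption.
- rewrite (sum_n_mult_l (K := R_Ring)). change mult with Rmult.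
  replace (B * s ^ m * norm x * (B * s ^ m * norm x)) with ((B * s ^ m) ^ 2 * (norm x * norm x)) by ring.
  apply Rmult_le_compat_l; [apply pow2_ge_0 | ].
  apply Rle_trans with (2 := H2_partial_le x (K + m)%nat).
  apply (sum_n_shift_le (fun k => Cmod (cf x k) ^ 2 * b k ^ 2) m).
  intros k. apply (@H2_term_pos b).
Qed.

Lemma geometric_weight q : 0 <= q < 1 -> ex_series (fun k => (q ^ k) ^ 2 * b k ^ 2).
Proof.
(* Any [s] strictly between 1 and [/ q] would do; this choice also makes sense for [q = 0]. *)
intros Hq. set (s := 2 / (1 + q)).
assert (Hs : 1 < s).
{ unfold s. apply Rmult_lt_reg_r with (1 + q); [lra | ].
  unfold Rdiv. rewrite Rmult_assoc, Rinv_l; lra. }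
assert (Hqs : q * s < 1).
{ unfold s. apply Rmult_lt_reg_r with (1 + q); [lra | ].
  replace (q * (2 / (1 + q)) * (1 + q)) with (2 * q) by (field; lra). lra. }
assert (Pqs : 0 <= q * s) by (apply Rmult_le_pos; lra).
destruct (weight_upper s Hs) as [B [HB H]].
apply (ex_series_le (K := R_AbsRing) (V := R_CompleteNormedModule) _
  (fun k => B ^ 2 * ((q * s) ^ 2) ^ k)).
- intros k. change norm with Rabs. rewrite Rabs_pos_eq by (apply Rmult_le_pos; apply pow2_ge_0).
  specialize (H k). assert (P := beta_pos b k).
  assert (b k ^ 2 <= (B * s ^ k) ^ 2) by (apply pow_incr; lra).
  replace (B ^ 2 * ((q * s) ^ 2) ^ k) with ((q ^ k) ^ 2 * (B * s ^ k) ^ 2).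
  + apply Rmult_le_compat_l; [apply pow2_ge_0 | assumption].
  + rewrite <- (pow_mult (q * s)), Nat.mul_comm, pow_mult, !Rpow_mult_distr. ring.
- apply ex_series_Rscal. apply ex_series_geom. rewrite Rabs_pos_eq by apply pow2_ge_0. simpl. nra.
Qed.

Lemma in_H2_geometric (a : nat -> C) M q : 0 <= q < 1 -> (forall k, Cmod (a k) <= M * q ^ k) -> in_H2 b a.
Proof.
intros Hq H.
apply (ex_series_le (K := R_AbsRing) (V := R_CompleteNormedModule) _
  (fun k => M ^ 2 * ((q ^ k) ^ 2 * b k ^ 2))).
- intros k. change norm with Rabs. rewrite Rabs_pos_eq by (apply Rmult_le_pos; apply pow2_ge_0).
  rewrite <- Rmult_assoc. apply Rmult_le_compat_r; [apply pow2_ge_0 | ].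
  rewrite <- Rpow_mult_distr. apply pow_incr. split; [apply Cmod_ge_0 | apply H].
- apply ex_series_Rscal, geometric_weight, Hq.
Qed.

Lemma norm_geometric q : 0 <= q < 1 -> exists B, 0 < B /\ forall (x : H2 b) M, 0 <= M ->
  (forall k, Cmod (cf x k) <= M * q ^ k) -> norm x <= M * B.
Proof.
intros Hq. assert (E := geometric_weight q Hq).
set (T := Series (fun k => (q ^ k) ^ 2 * b k ^ 2)).
assert (PT : forall K, sum_n (fun k => (q ^ k) ^ 2 * b k ^ 2) K <= T).
{ intros K. apply partial_sum_le; [ | exact E]. intros j. apply Rmult_le_pos; apply pow2_ge_0. }
assert (T0 : 0 <= T).
{ apply Rle_trans with (2 := PT O). rewrite sum_O. apply Rmult_le_pos; apply pow2_ge_0. }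
(* [T <= (T + 1) ^ 2] avoids the square root of [T]. *)
exists (T + 1). split; [lra | ]. intros x M HM H.
apply H2_norm_le; [apply Rmult_le_pos; lra | ]. intros K.
apply Rle_trans with (sum_n (fun k => M ^ 2 * ((q ^ k) ^ 2 * b k ^ 2)) K).
- apply sum_n_m_le. intros k. rewrite <- Rmult_assoc. apply Rmult_le_compat_r; [apply pow2_ge_0 | ].
  rewrite <- Rpow_mult_distr. apply pow_incr. split; [apply Cmod_ge_0 | apply H].
- rewrite (sum_n_mult_l (K := R_Ring)). change mult with Rmult.
  replace (M * (T + 1) * (M * (T + 1))) with (M ^ 2 * ((T + 1) * (T + 1))) by ring.
  apply Rmult_le_compat_l; [apply pow2_ge_0 | ]. apply Rle_trans with (1 := PT K). nra.
Qed.

Lemma in_H2_powers (l : C) : Cmod l < 1 -> in_H2 b (fun k => l ^ k)%C.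
Proof.
intros Hl. apply in_H2_geometric with (M := 1) (q := Cmod l).
- split; [apply Cmod_ge_0 | exact Hl].
- intros k. rewrite Cmod_pow. lra.
Qed.

(* Outside of the disc [kvec] takes the junk value [0]. *)
Definition kvec (l : C) : H2 b :=
  match Rlt_dec (Cmod l) 1 with
  | left H => exist _ _ (in_H2_powers l H)
  | right _ => zero
  end.

Lemma cf_kvec l k : Cmod l < 1 -> cf (kvec l) k = (l ^ k)%C.
Proof. intros Hl. unfold kvec. destruct (Rlt_dec (Cmod l) 1); [reflexivity | tauto]. Qed.

Lemma kvec_neq0 l : Cmod l < 1 -> kvec l <> zero.
Proof.
intros Hl E. assert (H := cf_kvec l 0 Hl). rewrite E, cf_zero in H. simpl in H.
apply (f_equal fst) in H. simpl in H. lra.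
Qed.

(* [dpow l n] is [n l^(n-1)], the derivative of [l^n]. *)
Fixpoint dpow (l : C) (n : nat) : C :=
  match n with O => 0%C | S m => (l * dpow l m + l ^ m)%C end.

(** The gap between [r] and [q] absorbs the factor [n] of [n l^(n-1)]. In the next bound the
    quadratic growth of the second order remainder costs a second factor [/ (q - r)]. *)
Lemma dpow_bound l r q : Cmod l <= r -> r < q -> forall n, Cmod (dpow l n) <= / (q - r) * q ^ n.
Proof.
intros Hl Hq. assert (Pl := Cmod_ge_0 l). assert (I : 0 < / (q - r)) by (apply Rinv_0_lt_compat; lra).
induction n as [ | n IH].
- simpl. rewrite Cmod_0. lra.
- simpl. apply Rle_trans with (1 := Cmod_triangle _ _). rewrite Cmod_mult, Cmod_pow.
  assert (A : Cmod l * Cmod (dpow l n) <= r * (/ (q - r) * q ^ n)).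
  { apply Rmult_le_compat; try apply Cmod_ge_0; assumption. }
  assert (B : Cmod l ^ n <= q ^ n) by (apply pow_incr; lra).
  replace (/ (q - r) * (q * q ^ n)) with (r * (/ (q - r) * q ^ n) + q ^ n) by (field; lra). lra.
Qed.

Lemma pow_remainder_bound (l m : C) r q : Cmod l <= r -> Cmod m <= r -> r < q -> forall n,
  Cmod (m ^ n - l ^ n - (m - l) * dpow l n)
  <= Cmod (m - l) * Cmod (m - l) * (/ (q - r) * / (q - r)) * q ^ n.
Proof.
intros Hl Hm Hq. assert (Pl := Cmod_ge_0 l). assert (I : 0 < / (q - r)) by (apply Rinv_0_lt_compat; lra).
assert (P := Cmod_ge_0 (m - l)). set (d := Cmod (m - l)) in *.
induction n as [ | n IH].
- simpl. replace (1 - 1 - (m - l) * 0)%C with (RtoC 0) by ring. rewrite Cmod_0.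
  repeat apply Rmult_le_pos; lra.
- replace (m ^ S n - l ^ S n - (m - l) * dpow l (S n))%C
    with (m * (m ^ n - l ^ n - (m - l) * dpow l n) + (m - l) * (m - l) * dpow l n)%C by (simpl; ring).
  apply Rle_trans with (1 := Cmod_triangle _ _). rewrite !Cmod_mult. fold d.
  assert (A := dpow_bound l r q Hl Hq n).
  set (X := d * d * (/ (q - r) * / (q - r)) * q ^ n) in *.
  assert (B1 : Cmod m * Cmod (m ^ n - l ^ n - (m - l) * dpow l n) <= r * X).
  { apply Rmult_le_compat; try apply Cmod_ge_0; assumption. }
  assert (B2 : d * d * Cmod (dpow l n) <= d * d * (/ (q - r) * q ^ n)).
  { apply Rmult_le_compat_l; [apply Rmult_le_pos; lra | exact A]. }
  replace (d * d * (/ (q - r) * / (q - r)) * q ^ S n) with (r * X + d * d * (/ (q - r) * q ^ n))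
    by (unfold X; simpl; field; lra).
  lra.
Qed.

(** The first order remainder is dominated coefficientwise by [|m - l|^2] times one geometric
    sequence of ratio [q < 1], hence in norm; [r] and [q] divide the interval from [|l|] to 1 into
    thirds. *)
Lemma kvec_holomorphic : holomorphic_on unit_disk kvec.
Proof.
intros l Hl. unfold unit_disk in Hl. assert (Pl := Cmod_ge_0 l).
set (r := (2 * Cmod l + 1) / 3). set (q := (Cmod l + 2) / 3).
assert (Hr : Cmod l < r) by (unfold r; lra). assert (Hq : r < q) by (unfold r, q; lra).
assert (Hq1 : 0 <= q < 1) by (unfold q; lra).
assert (I : 0 < / (q - r)) by (apply Rinv_0_lt_compat; lra).
assert (D : in_H2 b (dpow l)).
{ apply in_H2_geometric with (1 := Hq1) (M := / (q - r)). apply dpow_bound; lra. }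
exists (exist _ (dpow l) D : H2 b). apply is_derive_eps. intros eps He.
destruct (norm_geometric q Hq1) as [B [HB HN]].
set (K := / (q - r) * / (q - r)). assert (PK : 0 < K) by (apply Rmult_lt_0_compat; lra).
assert (PKB : 0 < K * B) by (apply Rmult_lt_0_compat; lra).
exists (Rmin (r - Cmod l) (eps / (K * B))). split.
{ apply Rmin_pos; [lra | apply Rdiv_lt_0_compat; assumption]. }
intros m Hm. assert (M1 := Rmin_l (r - Cmod l) (eps / (K * B))). assert (M2 := Rmin_r (r - Cmod l) (eps / (K * B))).
assert (Lm : Cmod m < r) by (assert (T := Cmod_le_sub m l); lra).
assert (P := Cmod_ge_0 (m - l)).
apply Rle_trans with (Cmod (m - l) * Cmod (m - l) * K * B).
- apply HN; [repeat apply Rmult_le_pos; lra | ]. intros k.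
  rewrite !cf_minus, cf_scal, !cf_kvec by lra.
  change (cf (exist _ (dpow l) D : H2 b) k) with (dpow l k).
  apply pow_remainder_bound; lra.
- replace (Cmod (m - l) * Cmod (m - l) * K * B) with (Cmod (m - l) * (K * B) * Cmod (m - l)) by ring.
  apply Rmult_le_compat_r; [exact P | ].
  apply Rle_trans with (eps / (K * B) * (K * B)); [apply Rmult_le_compat_r; lra | ].
  right. field. lra.
Qed.

Lemma ker_S l x : ker_bundle (S_beta Hw) l x <-> forall k, cf x (S k) = (l * cf x k)%C.
Proof.
unfold ker_bundle. split.
- intros H k. apply Csub_eq0. exact (f_equal (fun y => cf y k) H).
- intros H. apply cf_ext. intros k. rewrite cf_minus, cf_S, cf_scal, H, cf_zero. ring.
Qed.

Lemma ker_S_kvec l x : Cmod l < 1 ->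
  (ker_bundle (S_beta Hw) l x <-> exists c : C, x = scal c (kvec l)).
Proof.
intros Hl. rewrite ker_S. split.
- intros H. exists (cf x 0). apply cf_ext. intros k. rewrite cf_scal, cf_kvec by exact Hl.
  induction k as [ | k IH]; [simpl; ring | ]. rewrite H, IH. simpl. ring.
- intros [c ->] k. rewrite !cf_scal, !cf_kvec by exact Hl. simpl. ring.
Qed.

End WeightedShift.

Arguments cf {b} x k.

(** * The resolvent of the backward shift *)

Section Resolvent.

Variable b : weight_seq.
Hypothesis Hw : is_lim_seq (weight b) 1.

Local Notation T := (S_beta Hw).
Local Notation Res z := (resolvent T z).

Lemma norm_scal_H2 (c : C) (x : H2 b) : norm (scal c x) <= Cmod c * norm x.
Proof. exact (norm_scal c x). Qed.

Lemma norm_triangle_H2 (x y : H2 b) : norm (plus x y) <= norm x + norm y.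
Proof. exact (norm_triangle x y). Qed.

Lemma S_linear : is_linear (K := C_AbsRing) T.
Proof.
split.
- intros x y. apply cf_ext. intros k. reflexivity.
- intros c x. apply cf_ext. intros k. reflexivity.
- destruct (shift_norm b Hw 2 ltac:(lra)) as [B [HB H]].
  exists (B * 2). split; [lra | ]. intros x. specialize (H 1%nat x). simpl in H.
  rewrite !Rmult_1_r in H. exact H.
Qed.

Lemma scal_linear_H2 (z : C) : is_linear (K := C_AbsRing) (fun x : H2 b => scal z x : H2 b).
Proof.
split.
- intros x y. apply cf_ext. intros k. rewrite cf_scal, !cf_plus, !cf_scal. ring.
- intros c x. apply cf_ext. intros k. rewrite !cf_scal. ring.
- exists (Cmod z + 1). assert (P := Cmod_ge_0 z). split; [lra | ]. intros x.
  apply Rle_trans with (1 := norm_scal_H2 z x). assert (Q := H2_norm_ge0 b x). nra.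
Qed.

Lemma H2_lim_unique (u : nat -> H2 b) (x y : H2 b) :
  filterlim u eventually (locally x) -> filterlim u eventually (locally y) -> x = y.
Proof. intros Hx Hy. exact (filterlim_locally_unique u x y Hx Hy). Qed.

(* Iterate [y = (v + S y) / z] where [v = z y - S y], until the remainder is at most
   half of [norm y]. *)
Lemma shift_bounded_below z : 1 < Cmod z -> exists M, 0 < M /\
  forall y, norm y <= M * norm (minus (scal z y) (T y)).
Proof.
intros Hz. set (s := (1 + Cmod z) / 2).
destruct (shift_norm b Hw s ltac:(unfold s; lra)) as [B [HB H]].
assert (Z0 : z <> 0%C) by (apply Cmod_gt_0; lra).
assert (Iz : 0 < / Cmod z) by (apply Rinv_0_lt_compat; lra).
assert (Hs : 0 <= s * / Cmod z < 1).
{ split; [apply Rmult_le_pos; unfold s; lra | ].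
  apply Rmult_lt_reg_r with (Cmod z); [lra | ]. rewrite Rmult_assoc, Rinv_l by lra. unfold s; lra. }
assert (HN : forall N, exists M, 0 <= M /\ forall y,
  norm y <= M * norm (minus (scal z y) (T y)) + (/ Cmod z) ^ N * norm (Nat.iter N T y)).
{ induction N as [ | N [M [HM IH]]].
  - exists 0. split; [lra | ]. intros y. simpl. lra.
  - assert (Q : 0 < (/ Cmod z) ^ N) by (apply pow_lt, Iz).
    assert (Q' : 0 < s ^ N) by (apply pow_lt; unfold s; lra).
    exists (M + (/ Cmod z) ^ S N * (B * s ^ N)). split.
    { simpl. assert (0 <= / Cmod z * (/ Cmod z) ^ N * (B * s ^ N)) by (repeat apply Rmult_le_pos; lra). lra. }
    intros y. specialize (IH y). set (v := minus (scal z y) (T y)) in *.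
    assert (E : Nat.iter N T y = scal (/ z)%C (plus (Nat.iter N T v) (Nat.iter (S N) T y))).
    { apply cf_ext. intros k. rewrite cf_scal, cf_plus, !cf_iter. unfold v.
      rewrite cf_minus, cf_scal, cf_S. replace (k + S N)%nat with (S (k + N)) by lia. field. exact Z0. }
    assert (L : norm (Nat.iter N T y) <= / Cmod z * (B * s ^ N * norm v + norm (Nat.iter (S N) T y))).
    { rewrite E at 1. apply Rle_trans with (1 := norm_scal_H2 _ _). rewrite Cmod_inv by exact Z0.
      apply Rmult_le_compat_l; [lra | ]. apply Rle_trans with (1 := norm_triangle_H2 _ _).
      specialize (H N v). lra. }
    apply Rle_trans with (1 := IH).
    apply Rle_trans with (M * norm v + (/ Cmod z) ^ N *
      (/ Cmod z * (B * s ^ N * norm v + norm (Nat.iter (S N) T y)))).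
    + apply Rplus_le_compat_l, Rmult_le_compat_l; lra.
    + right. simpl. ring. }
destruct (pow_lt_1_zero (s * / Cmod z)) with (y := / (2 * B)) as [N HsN].
{ rewrite Rabs_pos_eq; lra. }
{ apply Rinv_0_lt_compat. lra. }
specialize (HsN N (le_n N)). rewrite Rabs_pos_eq in HsN by (apply pow_le; lra).
destruct (HN N) as [M [HM K]]. exists (2 * M + 1). split; [lra | ].
intros y. specialize (K y). set (v := minus (scal z y) (T y)) in *.
assert (Py := H2_norm_ge0 b y). assert (Pv := H2_norm_ge0 b v).
assert (L : (/ Cmod z) ^ N * norm (Nat.iter N T y) <= / 2 * norm y).
{ apply Rle_trans with ((/ Cmod z) ^ N * (B * s ^ N * norm y)).
  - apply Rmult_le_compat_l; [apply pow_le; lra | apply H].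
  - replace ((/ Cmod z) ^ N * (B * s ^ N * norm y)) with (B * (s * / Cmod z) ^ N * norm y)
      by (rewrite Rpow_mult_distr; ring).
    apply Rmult_le_compat_r; [exact Py | ].
    apply Rle_trans with (B * / (2 * B)); [apply Rmult_le_compat_l; lra | ]. right. field. lra. }
lra.
Qed.

Lemma shift_injective z x : 1 < Cmod z -> minus (scal z x) (T x) = zero -> x = zero.
Proof.
intros Hz E. destruct (shift_bounded_below z Hz) as [M [HM H]].
assert (H' : norm x <= M * norm (zero : H2 b)) 
  by exact (Rle_trans _ _ _ (H x) (Req_le _ _ (f_equal (fun v : H2 b => M * norm v) E))).
cut (norm x = 0); [exact (norm_eq_zero x) | ].
assert (N0 : norm (zero : H2 b) = 0) by exact (norm_zero (V := H2 b)).
assert (P := H2_norm_ge0 b x). rewrite N0 in H'. lra.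
Qed.

Lemma Neumann_series z x : 1 < Cmod z ->
  exists y, minus (scal z y) (T y) = x.
Proof.
intros Hz. set (s := (1 + Cmod z) / 2).
destruct (shift_norm b Hw s ltac:(unfold s; lra)) as [B [HB H]].
assert (Z0 : z <> 0%C) by (apply Cmod_gt_0; lra).
set (a := fun m => scal (/ z ^ S m)%C (Nat.iter m T x) : H2 b).
assert (P := H2_norm_ge0 b x).
assert (Ea : ex_series a).
{ apply ex_series_le with (fun m => (/ Cmod z * (B * norm x)) * (s / Cmod z) ^ m).
  - intros m. unfold a. apply Rle_trans with (1 := norm_scal_H2 _ _).
    rewrite Cmod_inv, Cmod_pow by (apply Cpow_neq0, Z0).
    assert (Q : 0 < Cmod z ^ S m) by (apply pow_lt; lra).
    apply Rle_trans with (/ Cmod z ^ S m * (B * s ^ m * norm x)).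
    + apply Rmult_le_compat_l; [apply Rlt_le, Rinv_0_lt_compat, Q | apply H].
    + unfold Rdiv. rewrite Rpow_mult_distr, pow_inv. right. simpl. field.
      split; [apply pow_nonzero; lra | lra].
  - apply ex_series_Rscal, ex_series_geom.
    rewrite Rabs_pos_eq; [ | apply Rlt_le, Rdiv_lt_0_compat; unfold s; lra].
    apply Rmult_lt_reg_r with (Cmod z); [lra | ]. unfold Rdiv. rewrite Rmult_assoc, Rinv_l by lra.
    unfold s; lra. }
destruct Ea as [y Hy]. exists y.
(* With one term more in the first partial sum the telescoping is exact, and only a passage to the
   limit remains. *)
assert (U : forall n, minus (scal z (sum_n a (S n))) (T (sum_n a n)) = x).
{ induction n as [ | n IH].
  - rewrite sum_Sn, !sum_O. apply cf_ext. intros k. unfold a.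
    rewrite cf_minus, cf_S, !cf_scal, cf_plus, !cf_scal, !cf_iter.
    replace (k + 1)%nat with (S k) by lia. replace (k + 0)%nat with k by lia.
    rewrite Nat.add_0_r. simpl. field. exact Z0.
  - rewrite sum_Sn. rewrite (sum_Sn a n) at 2.
    transitivity (plus (minus (scal z (sum_n a (S n))) (T (sum_n a n)))
       (minus (scal z (a (S (S n)))) (T (a (S n))))).
    + apply cf_ext. intros k. rewrite cf_plus, !cf_minus, !cf_S, !cf_scal, !cf_plus. ring.
    + rewrite IH. apply cf_ext. intros k. rewrite cf_plus, cf_minus, cf_S. unfold a.
      rewrite !cf_scal, !cf_iter. replace (k + S (S n))%nat with (S k + S n)%nat by lia.
      simpl. field. split; first [exact Z0 | apply Cpow_neq0, Z0]. }
assert (Hy' : filterlim (fun n => sum_n a (S n)) eventually (locally y)).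
{ apply (filterlim_comp _ _ _ S (sum_n a) eventually eventually); [ | exact Hy].
  apply eventually_subseq. intros n. lia. }
apply (H2_lim_unique (fun _ => x)); [ | apply filterlim_const].
apply filterlim_ext with (1 := U).
refine (filterlim_comp_2 (fun n => scal z (sum_n a (S n)) : H2 b) (fun n => opp (T (sum_n a n)) : H2 b)
  plus _ _ (filterlim_plus (scal z y : H2 b) (opp (T y) : H2 b))).
- apply (filterlim_comp _ _ _ _ (fun v : H2 b => scal z v) _ _ _ Hy').
  apply (linear_cont (K := C_AbsRing) (fun v : H2 b => scal z v) y).
  apply scal_linear_H2.
- apply (filterlim_comp _ _ _ _ (fun v : H2 b => opp v) _ (locally (T y))).
  + apply (filterlim_comp _ _ _ _ T _ _ _ Hy). apply (linear_cont T y S_linear).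
  + exact (filterlim_opp (K := C_AbsRing) (V := hilb_space (H2 b)) (T y)).
Qed.

(** Surjectivity is the Neumann series; injectivity and the bound on the inverse both come from
    [shift_bounded_below]. *)
Lemma resolvent_exists z : 1 < Cmod z -> exists Rz, is_resolvent T z Rz.
Proof.
intros Hz.
set (Rz := fun x => epsilon (inhabits (zero : H2 b)) (fun y => minus (scal z y) (T y) = x)).
assert (HR : forall x, minus (scal z (Rz x)) (T (Rz x)) = x).
{ intros x. apply (epsilon_spec (inhabits (zero : H2 b)) (fun y => minus (scal z y) (T y) = x)).
  apply Neumann_series, Hz. }
assert (U : forall x y, minus (scal z x) (T x) = minus (scal z y) (T y) -> x = y).
{ intros x y E. apply cf_ext. intros k. apply Csub_eq0.
  cut (minus x y = zero); [intros E0; exact (f_equal (fun v => cf v k) E0) | ].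
  apply (shift_injective z (minus x y) Hz).
  apply cf_ext. intros j. apply (f_equal (fun v => cf v j)) in E.
  rewrite cf_minus, cf_scal, cf_S in E.
  rewrite cf_minus, cf_scal, cf_S, !cf_minus, cf_zero.
  replace (z * (cf x j - cf y j) - (cf x (S j) - cf y (S j)))%C
    with ((z * cf x j - cf x (S j)) - (z * cf y j - cf y (S j)))%C by ring.
  rewrite E, cf_minus, cf_scal, cf_S. ring. }
exists Rz. split; [ | split; [ | exact HR]].
- split.
  + intros x y. apply U. rewrite HR. rewrite <- (HR x) at 1. rewrite <- (HR y) at 1.
    apply cf_ext. intros k. rewrite cf_plus, !cf_minus, !cf_scal, !cf_S, !cf_plus. ring.
  + intros c x. apply U. rewrite HR. rewrite <- (HR x) at 1.
    apply cf_ext. intros k. rewrite cf_scal, !cf_minus, !cf_scal, !cf_S, !cf_scal. ring.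
  + destruct (shift_bounded_below z Hz) as [M [HM H]]. exists M. split; [exact HM | ].
    intros x. specialize (H (Rz x)). rewrite HR in H. exact H.
- intros x. apply U. apply HR.
Qed.

Lemma resolvent_spec z : 1 < Cmod z -> is_resolvent T z (Res z).
Proof. intros Hz. exact (epsilon_spec (inhabits (fun x => x)) (is_resolvent T z) (resolvent_exists z Hz)). Qed.

(* [(1 - S) k_l = (1 - l) k_l] with [l] close to [1] contradicts a bounded inverse; hence
   the contour of the calculus has radius [> 1]. *)
Lemma one_in_spectrum : spectrum T 1%C.
Proof.
intros [Rz [HL [HR _]]].
destruct (linear_norm _ HL) as [M [HM B]].
(* Chosen so that [M * (1 - l) <= / 2], which forces the eigenvector to vanish. *)
set (l := (RtoC (1 - / (2 * M + 2)))%C).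
assert (I : 0 < / (2 * M + 2)) by (apply Rinv_0_lt_compat; lra).
assert (I1 : / (2 * M + 2) < 1) by (rewrite <- Rinv_1; apply Rinv_lt_contravar; lra).
assert (Hl : Cmod l < 1) by (unfold l; rewrite Cmod_R, Rabs_pos_eq; lra).
assert (E : minus (scal (RtoC 1) (kvec b Hw l)) (T (kvec b Hw l)) = scal (1 - l)%C (kvec b Hw l)).
{ apply cf_ext. intros k. rewrite cf_minus, !cf_scal, cf_S, !cf_kvec by exact Hl. simpl. ring. }
assert (X := HR (kvec b Hw l)). rewrite E in X.
assert (Y := B (scal (1 - l)%C (kvec b Hw l))). rewrite X in Y.
assert (N := norm_scal_H2 (1 - l)%C (kvec b Hw l)).
replace (1 - l)%C with (RtoC (/ (2 * M + 2))) in N by (unfold l; rewrite RtoC_minus; ring).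
rewrite Cmod_R, Rabs_pos_eq in N by lra.
replace (1 - l)%C with (RtoC (/ (2 * M + 2))) in Y by (unfold l; rewrite RtoC_minus; ring).
apply (kvec_neq0 b Hw l Hl). cut (norm (kvec b Hw l) = 0); [exact (norm_eq_zero (kvec b Hw l)) | ].
assert (P := H2_norm_ge0 b (kvec b Hw l)). set (n := norm (kvec b Hw l)) in *.
assert (n <= M * (/ (2 * M + 2) * n)).
{ apply Rle_trans with (1 := Y). apply Rmult_le_compat_l; [lra | exact N]. }
assert (M * (/ (2 * M + 2) * n) <= / 2 * n).
{ rewrite <- Rmult_assoc. apply Rmult_le_compat_r; [exact P | ].
  apply Rmult_le_reg_r with (2 * M + 2); [lra | ]. rewrite Rmult_assoc, Rinv_l by lra. lra. }
lra.
Qed.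

Lemma admissible_radius_exists h : hol_closed_disk 1 h -> exists r, admissible_radius T h r.
Proof.
intros Hh. destruct (hol_closed_disk_extend 1 h ltac:(lra) Hh) as [R0 [HR H]].
exists ((1 + R0) / 2). split; [lra | split].
- intros z Hz. apply Rnot_le_lt. intros L. apply Hz. apply resolvent_exists. lra.
- exists (fun z => Cmod z < R0). split; [ | split].
  + apply open_C_ball. intros z Hz. exists (R0 - Cmod z). split; [lra | ].
    intros w Hw'. assert (E := Cmod_le_sub w z). lra.
  + intros z Hz. lra.
  + intros z Hz. apply H, Hz.
Qed.

(** The radius that [hol_calculus] picks among the admissible ones. What is drawn from it is that it
    exceeds 1 and that [h] is holomorphic up to it. *)
Definition calculus_radius h : R := epsilon (inhabits 0) (admissible_radius T h).

Lemma calculus_radius_spec h : hol_closed_disk 1 h ->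
  1 < calculus_radius h /\ hol_closed_disk (calculus_radius h) h.
Proof.
intros Hh.
destruct (epsilon_spec (inhabits 0) (admissible_radius T h) (admissible_radius_exists h Hh)) as [_ [H1 H2]].
split; [ | exact H2]. specialize (H1 _ one_in_spectrum). rewrite Cmod_1 in H1. exact H1.
Qed.

Lemma Res_eq z x : 1 < Cmod z -> minus (scal z (Res z x)) (T (Res z x)) = x.
Proof. intros Hz. apply (resolvent_spec z Hz). Qed.

Lemma Res_unique z x y : 1 < Cmod z -> minus (scal z y) (T y) = x -> Res z x = y.
Proof. intros Hz <-. apply (resolvent_spec z Hz). Qed.

Lemma Res_linear z : 1 < Cmod z -> is_linear (K := C_AbsRing) (Res z).
Proof. intros Hz. apply (resolvent_spec z Hz). Qed.

(** The resolvent identity, source of both the continuity and the derivative of the resolvent. *)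
Lemma Res_minus z w x : 1 < Cmod z -> 1 < Cmod w ->
  minus (Res w x) (Res z x) = scal (z - w)%C (Res z (Res w x)).
Proof.
intros Hz Hw'.
assert (L := Res_linear z Hz).
transitivity (Res z (scal (z - w)%C (Res w x))).
- symmetry. apply Res_unique; [exact Hz | ].
  assert (E1 := Res_eq z x Hz). assert (E2 := Res_eq w x Hw').
  apply cf_ext. intros k.
  apply (f_equal (fun v => cf v k)) in E1. apply (f_equal (fun v => cf v k)) in E2.
  rewrite cf_minus, cf_scal, cf_S in E1, E2.
  rewrite cf_minus, !cf_scal, cf_S, !cf_minus.
  transitivity ((z - w) * cf (Res w x) k + (w * cf (Res w x) k - cf (Res w x) (S k))
    - (z * cf (Res z x) k - cf (Res z x) (S k)))%C; [ring | ].
  rewrite E1, E2. ring.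
- apply (linear_scal _ L).
Qed.

(** A bound [M] at the fixed point [z] suffices: for [|w - z| * M <= / 2] the resolvent identity
    gives [norm (Res w x) <= 2 * norm (Res z x)], and then a small difference. *)
Lemma Res_continuous z x : 1 < Cmod z -> forall eps, 0 < eps -> exists d, 0 < d /\
  forall w, Cmod (w - z) < d -> 1 < Cmod w /\ norm (minus (Res w x) (Res z x)) < eps.
Proof.
intros Hz eps He. destruct (linear_norm _ (Res_linear z Hz)) as [M [HM B]].
assert (Px := H2_norm_ge0 b (Res z x)). set (n := norm (Res z x)) in *.
set (d := Rmin (Cmod z - 1) (Rmin (/ (2 * M)) (eps / (2 * M * (n + 1))))).
assert (I : 0 < / (2 * M)) by (apply Rinv_0_lt_compat; lra).
assert (PMn : 0 < 2 * M * (n + 1)) by (apply Rmult_lt_0_compat; lra).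
exists d. split.
{ apply Rmin_pos; [lra | apply Rmin_pos; [exact I | apply Rdiv_lt_0_compat; assumption]]. }
intros w Hwd.
assert (D1 : d <= Cmod z - 1) by apply Rmin_l.
assert (D2 : d <= / (2 * M)) by (apply Rle_trans with (1 := Rmin_r _ _), Rmin_l).
assert (D3 : d <= eps / (2 * M * (n + 1))) by (apply Rle_trans with (1 := Rmin_r _ _), Rmin_r).
assert (Lw : 1 < Cmod w).
{ assert (E := Cmod_le_sub z w). rewrite Cmod_minus_sym in E. lra. }
split; [exact Lw | ].
assert (X : norm (minus (Res w x) (Res z x)) <= Cmod (w - z) * (M * norm (Res w x))).
{ rewrite Res_minus by assumption. apply Rle_trans with (1 := norm_scal_H2 _ _).
  rewrite Cmod_minus_sym. apply Rmult_le_compat_l; [apply Cmod_ge_0 | apply B]. }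
assert (Y : norm (Res w x) <= norm (minus (Res w x) (Res z x)) + n).
{ replace (Res w x) with (plus (minus (Res w x) (Res z x)) (Res z x)) at 1.
  - apply norm_triangle_H2.
  - apply cf_ext. intros k. rewrite cf_plus, cf_minus. ring. }
set (u := norm (minus (Res w x) (Res z x))) in *.
assert (Pu : 0 <= u) by apply H2_norm_ge0.
assert (Pw := H2_norm_ge0 b (Res w x)). set (m := norm (Res w x)) in *.
assert (Pd := Cmod_ge_0 (w - z)). set (t := Cmod (w - z)) in *.
assert (tM : t * M <= / 2).
{ apply Rle_trans with (/ (2 * M) * M); [apply Rmult_le_compat_r; lra | ]. right. field. lra. }
assert (X2 : u <= / 2 * m).
{ apply Rle_trans with (1 := X). rewrite <- Rmult_assoc. apply Rmult_le_compat_r; lra. }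
assert (m2 : m <= 2 * n) by lra.
apply Rle_lt_trans with (1 := X).
apply Rle_lt_trans with (t * (M * (2 * n))).
{ apply Rmult_le_compat_l; [exact Pd | ]. apply Rmult_le_compat_l; lra. }
apply Rle_lt_trans with (t * (2 * M * (n + 1)) - t * (2 * M)); [right; ring | ].
assert (T1 : t * (2 * M * (n + 1)) < eps).
{ apply Rlt_le_trans with (eps / (2 * M * (n + 1)) * (2 * M * (n + 1))).
  - apply Rmult_lt_compat_r; lra.
  - right. field. split; lra. }
assert (0 <= t * (2 * M)) by (apply Rmult_le_pos; lra). lra.
Qed.

(** By the resolvent identity the slope is the coefficient of [- Res z (Res w x)], which converges
    by continuity. *)
Lemma ex_cdiff_Res z x k : 1 < Cmod z -> ex_cdiff (fun z => cf (Res z x) k) z.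
Proof.
intros Hz. destruct (linear_norm _ (Res_linear z Hz)) as [M [HM B]].
assert (Pb := beta_pos b k).
exists (- cf (Res z (Res z x)) k)%C. apply cdiff_eps. intros eps He.
destruct (Res_continuous z x Hz (eps * b k / M)) as [d [Hd K]].
{ apply Rdiv_lt_0_compat; [apply Rmult_lt_0_compat; lra | exact HM]. }
exists d; split; [exact Hd | ]. intros w Hwd. destruct (K w Hwd) as [Lw N].
assert (E := f_equal (fun v => cf v k) (Res_minus z w x Hz Lw)). cbv beta in E.
rewrite cf_minus, cf_scal in E. rewrite E.
set (v := minus (Res w x) (Res z x)) in *.
assert (E2 : (cf (Res z (Res w x)) k - cf (Res z (Res z x)) k = cf (Res z v) k)%C).
{ assert (L := Res_linear z Hz).
  assert (E3 : Res w x = plus v (Res z x)).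
  { apply cf_ext. intros j. unfold v. rewrite cf_plus, cf_minus. ring. }
  rewrite E3 at 1. rewrite (linear_plus _ L), cf_plus. ring. }
replace ((z - w) * cf (Res z (Res w x)) k - - cf (Res z (Res z x)) k * (w - z))%C
  with ((z - w) * (cf (Res z (Res w x)) k - cf (Res z (Res z x)) k))%C by ring.
rewrite E2, Cmod_mult, Cmod_minus_sym, Rmult_comm. apply Rmult_le_compat_r; [apply Cmod_ge_0 | ].
apply Rmult_le_reg_r with (b k); [exact Pb | ]. apply Rle_trans with (1 := cf_norm b _ k).
apply Rle_trans with (1 := B v).
apply Rle_trans with (M * (eps * b k / M)); [apply Rmult_le_compat_l; lra | ]. right. field. lra.
Qed.

Lemma Res_step z x k : 1 < Cmod z -> (z * cf (Res z x) k = cf x k + cf (Res z x) (S k))%C.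
Proof.
intros Hz. assert (E := f_equal (fun v => cf v k) (Res_eq z x Hz)). cbv beta in E.
rewrite cf_minus, cf_scal, cf_S in E. rewrite <- E. ring.
Qed.

(** Decay of order [/ |z|] lets integrals of coefficients be evaluated by pushing the circle to
    infinity. *)
Lemma Res_decay x : exists M, 0 < M /\ forall z, M < Cmod z ->
  norm (Res z x) <= norm x / (Cmod z - M).
Proof.
destruct (linear_norm _ S_linear) as [M [HM B]]. exists (M + 1). split; [lra | ].
intros z Hz. assert (L1 : 1 < Cmod z) by lra.
assert (E := Res_eq z x L1). set (y := Res z x) in *.
assert (Z0 : z <> 0%C) by (apply Cmod_gt_0; lra).
assert (X : y = scal (/ z)%C (plus x (T y))).
{ apply cf_ext. intros k. apply (f_equal (fun v => cf v k)) in E.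
  rewrite cf_minus, cf_scal in E. rewrite cf_scal, cf_plus, <- E. field. exact Z0. }
assert (N : norm y <= / Cmod z * (norm x + M * norm y)).
{ rewrite X at 1. apply Rle_trans with (1 := norm_scal_H2 _ _). rewrite Cmod_inv by exact Z0.
  apply Rmult_le_compat_l; [apply Rlt_le, Rinv_0_lt_compat; lra | ].
  apply Rle_trans with (1 := norm_triangle_H2 _ _). specialize (B y). lra. }
assert (Py := H2_norm_ge0 b y).
assert (N2 : Cmod z * norm y <= norm x + M * norm y).
{ apply Rmult_le_reg_l with (/ Cmod z); [apply Rinv_0_lt_compat; lra | ].
  rewrite <- Rmult_assoc, Rinv_l by lra. lra. }
apply Rmult_le_reg_r with (Cmod z - (M + 1)); [lra | ].
unfold Rdiv. rewrite Rmult_assoc, Rinv_l by lra. lra.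
Qed.

End Resolvent.

(** * Coefficients of the functional calculus *)

Section Calculus.

Variable b : weight_seq.
Hypothesis Hw : is_lim_seq (weight b) 1.

Local Notation T := (S_beta Hw).
Local Notation Res z := (resolvent T z).

Lemma cf_linear k : is_linear (K := R_AbsRing) (U := restrict_scalars (H2 b)) (V := C_R_NormedModule)
  (fun x => cf (x : H2 b) k).
Proof.
split.
- intros x y. reflexivity.
- intros t x. transitivity (Cmult (RtoC t) (cf (x : H2 b) k)); [reflexivity | ].
  destruct (cf (x : H2 b) k) as [u v].
  unfold scal; simpl. unfold prod_scal, scal; simpl. unfold mult; simpl.
  unfold RtoC, Cmult; simpl. f_equal; ring.
- assert (P := beta_pos b k). exists (/ b k). split; [apply Rinv_0_lt_compat, P | ].
  intros x. rewrite <- Cmod_norm. apply Rmult_le_reg_r with (b k); [exact P | ].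
  apply Rle_trans with (1 := cf_norm b x k). right.
  change (@norm R_AbsRing (restrict_scalars (H2 b)) x) with (norm (x : H2 b)). field. lra.
Qed.

Lemma calculus_integrand_continuous (g : C -> C) r x t : 1 < r -> ccont_circle g r ->
  continuous (T := R_UniformSpace) (U := restrict_scalars (H2 b))
    (fun t => scal (g (circle r t)) (Res (circle r t) x) : H2 b) t.
Proof.
intros Hr Hg.
assert (Cz : forall t, Cmod (circle r t) = r) by (intros s; apply Cmod_circle; lra).
apply filterlim_locally. intros [eps He].
set (z := circle r t). assert (Pn := H2_norm_ge0 b (Res z x)). assert (Pg := Cmod_ge_0 (g z)).
set (n := norm (Res z x)) in *.
destruct (Res_continuous b Hw z x ltac:(unfold z; rewrite Cz; exact Hr) (Rmin 1 (eps / (2 * (Cmod (g z) + 1)))))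
  as [d1 [D1 K1]].
{ apply Rmin_pos; [lra | apply Rdiv_lt_0_compat; lra]. }
destruct (Hg z (Cz t) (eps / (2 * (n + 1)))) as [d2 [D2 K2]]; [apply Rdiv_lt_0_compat; lra | ].
destruct (rcont_circle r t (Rmin d1 d2)) as [d [Hd K]]; [apply Rmin_pos; assumption | ].
exists (mkposreal d Hd). intros s Hs. specialize (K s Hs). fold z in K.
assert (M1 := Rmin_l d1 d2). assert (M2 := Rmin_r d1 d2).
set (w := circle r s) in *. destruct (K1 w ltac:(lra)) as [_ N1]. specialize (K2 w ltac:(lra)).
assert (N2 := Rlt_le_trans _ _ _ N1 (Rmin_r _ _)). assert (N3 := Rlt_le_trans _ _ _ N1 (Rmin_l _ _)).
set (v := minus (Res w x) (Res z x)) in *.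
(* The difference of the two products, written with the increments of [g] and of the resolvent; each
   summand gets [eps / 2]. *)
apply (Rle_lt_trans _ (norm (plus (scal (g w - g z)%C (plus v (Res z x))) (scal (g z) v) : H2 b))).
- apply Req_le. apply (f_equal (fun u : H2 b => norm u)).
  apply cf_ext. intros k. unfold v.
  rewrite cf_plus, !cf_minus, !cf_scal, cf_plus, cf_minus. ring.
- apply Rle_lt_trans with (1 := norm_triangle_H2 b _ _).
  set (nv := norm (v : H2 b)). set (nu := norm (plus v (Res z x) : H2 b)).
  assert (A1 : norm (scal (g w - g z)%C (plus v (Res z x)) : H2 b) <= Cmod (g w - g z) * nu)
    by exact (norm_scal_H2 b _ _).
  assert (A2 : norm (scal (g z) v : H2 b) <= Cmod (g z) * nv) by exact (norm_scal_H2 b _ _).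
  assert (A3 : nu <= nv + n) by exact (norm_triangle_H2 b v (Res z x)).
  assert (N2' : nv < eps / (2 * (Cmod (g z) + 1))) by exact N2.
  assert (N3' : nv < 1) by exact N3.
  assert (Pv : 0 <= nv) by exact (H2_norm_ge0 b v).
  assert (B1 : Cmod (g w - g z) * nu <= Cmod (g w - g z) * (n + 1)).
  { apply Rmult_le_compat_l; [apply Cmod_ge_0 | ]. lra. }
  assert (B2 : Cmod (g w - g z) * (n + 1) < eps / 2).
  { apply Rlt_le_trans with (eps / (2 * (n + 1)) * (n + 1)); [apply Rmult_lt_compat_r; lra | ].
    right. field. lra. }
  assert (B3 : Cmod (g z) * nv <= eps / 2).
  { apply Rle_trans with ((Cmod (g z) + 1) * (eps / (2 * (Cmod (g z) + 1)))).
    - apply Rmult_le_compat; lra.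
    - right. field. lra. }
  apply Rle_lt_trans with (Cmod (g w - g z) * nu + Cmod (g z) * nv).
  + exact (Rplus_le_compat _ _ _ _ A1 A2).
  + simpl. lra.
Qed.

(** Coefficient functionals are bounded, so they pass through the vector-valued integral; the [Ci]
    of [dz = i z dt] cancels the one in the normalizing constant. *)
Lemma calculus_coef h x k : hol_closed_disk 1 h ->
  cf (hol_calculus T h x) k =
  (/ RtoC (2 * PI) * J (calculus_radius b Hw h) (fun z => h z * (z * cf (Res z x) k)))%C.
Proof.
intros Hh. destruct (calculus_radius_spec b Hw h Hh) as [Hr1 Hr2].
change (hol_calculus T h x) with (cauchy_integral T h (calculus_radius b Hw h) x).
set (r := calculus_radius b Hw h) in *.
destruct (hol_closed_disk_extend r h ltac:(lra) Hr2) as [R0 [HR0 Dh]].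
assert (TP := two_PI_pos).
assert (CiN : Ci <> 0%C) by (apply Cmod_gt_0; rewrite Cmod_Ci; lra).
assert (TPC : RtoC (2 * PI) <> 0%C) by (apply Cmod_gt_0; rewrite Cmod_R, Rabs_pos_eq; lra).
assert (Cf : ccont_circle (fun z => h z * (z * cf (Res z x) k))%C r).
{ intros z Hz. apply ccont_mult; [apply ex_cdiff_ccont, Dh; lra | ].
  apply ccont_mult; [apply ccont_id | ]. apply ex_cdiff_ccont, ex_cdiff_Res. lra. }
assert (Cg : ccont_circle (fun z => h z * (Ci * z))%C r).
{ intros z Hz. apply ccont_mult; [apply ex_cdiff_ccont, Dh; lra | ].
  apply ccont_mult; [apply ccont_const | apply ccont_id]. }
assert (E : ex_RInt (V := restrict_scalars (H2 b))
  (fun t => scal (h (circle r t) * (Ci * circle r t))%C (Res (circle r t) x) : H2 b) 0 (2 * PI)).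
{ apply (ex_RInt_continuous (V := restrict_scalars (H2 b))). intros t _.
  apply (calculus_integrand_continuous (fun z => h z * (Ci * z))%C); assumption. }
apply RInt_correct in E.
apply (is_RInt_linear _ _ _ _ _ _ _ (cf_linear k)) in E.
apply CI_unique in E.
unfold cauchy_integral. rewrite cf_scal. rewrite <- E.
assert (E2 : CI (fun t => cf (scal (h (circle r t) * (Ci * circle r t))%C (Res (circle r t) x) : H2 b) k) 0 (2 * PI)
  = (Ci * J r (fun z => h z * (z * cf (Res z x) k)))%C).
{ rewrite <- J_scal by (lra || assumption). apply CI_ext; [lra | ].
  intros t _. rewrite cf_scal. ring. }
rewrite E2, RtoC_mult.
assert (N2 : RtoC 2 <> 0%C) by (intros E0; apply RtoC_inj in E0; lra).
assert (NP : RtoC PI <> 0%C) by (intros E0; apply RtoC_inj in E0; assert (P := PI_RGT_0); lra).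
field. repeat split; assumption.
Qed.

Lemma ex_cdiff_moment p x k z : 1 < Cmod z -> ex_cdiff p z ->
  ex_cdiff (fun z => p z * (z * cf (Res z x) k))%C z.
Proof.
intros Hz Hp. apply ex_cdiff_mult; [exact Hp | ].
apply ex_cdiff_mult; [apply ex_cdiff_id | apply ex_cdiff_Res, Hz].
Qed.

(* [z y_k = x_k + y_(k+1)] for the coefficients [y_k] of the resolvent, and Cauchy's
   theorem removes the contribution of the constant [x_k]. *)
Lemma moment_shift R0 r x k : 1 < r < R0 -> forall p, (forall z, Cmod z < R0 -> ex_cdiff p z) ->
  J r (fun z => p z * (z * cf (Res z x) k))%C = J r (fun z => z ^ k * p z * (z * cf (Res z x) 0))%C.
Proof.
intros Hr. induction k as [ | k IH]; intros p Hp.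
- apply J_ext; [lra | ]. intros z _. simpl. ring.
- assert (Hzp : forall z, Cmod z < R0 -> ex_cdiff (fun z => z * p z)%C z).
  { intros z Hz. apply ex_cdiff_mult; [apply ex_cdiff_id | apply Hp, Hz]. }
  transitivity (J r (fun z => (z * p z) * (z * cf (Res z x) k))%C).
  + assert (Z : J r (fun z => z * p z)%C = 0%C).
    { apply (Cauchy_disc p R0 nil); [ | | lra].
      - intros z Hz. apply ex_cdiff_ccont, Hp, Hz.
      - intros z Hz _. apply Hp, Hz. }
    rewrite (J_ext r (fun z => (z * p z) * (z * cf (Res z x) k))%C
      (fun z => cf x k * (z * p z) + p z * (z * cf (Res z x) (S k)))%C).
    * assert (C1 : ccont_circle (fun z => z * p z)%C r).
      { intros z Hz. apply ex_cdiff_ccont, Hzp. lra. }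
      rewrite J_plus, J_scal, Z; try lra; try assumption.
      -- ring.
      -- intros z Hz. apply ccont_mult; [apply ccont_const | apply C1, Hz].
      -- intros z Hz. apply ex_cdiff_ccont, ex_cdiff_moment; [lra | apply Hp; lra].
    * lra.
    * intros z Hz. rewrite Res_step by lra. ring.
  + rewrite (IH (fun z => z * p z)%C Hzp). apply J_ext; [lra | ]. intros z _. simpl. ring.
Qed.

(** The resolvent decays at infinity, and the integral does not depend on the radius; [rho] is large
    enough to beat [eps]. *)
Lemma moment_vanish r x k : 1 < r -> J r (fun z => cf (Res z x) (S k)) = 0%C.
Proof.
intros Hr. assert (TP := two_PI_pos). apply Cmod_le_eps_0. intros eps He.
destruct (Res_decay b Hw x) as [M [HM D]]. assert (Px := H2_norm_ge0 b x).
assert (Pb := beta_pos b (S k)).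
set (K := 2 * PI * norm x / (eps * b (S k))).
assert (Peb : 0 < eps * b (S k)) by (apply Rmult_lt_0_compat; assumption).
assert (PK : 0 <= K).
{ apply Rmult_le_pos; [apply Rmult_le_pos; lra | apply Rlt_le, Rinv_0_lt_compat, Peb]. }
set (rho := r + M + K + 1).
rewrite (J_annulus _ r rho); [ | lra | unfold rho; lra | ].
- replace eps with (2 * PI * (eps / (2 * PI))) by (field; assert (P := PI_RGT_0); lra).
  apply J_bound; [unfold rho; lra | | ].
  + intros z Hz. apply ex_cdiff_ccont, ex_cdiff_Res. unfold rho in Hz. lra.
  + intros z Hz. apply Rmult_le_reg_r with (b (S k)); [exact Pb | ].
    apply Rle_trans with (1 := cf_norm b _ _).
    apply Rle_trans with (1 := D z ltac:(unfold rho in Hz; lra)).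
    assert (L : 0 < Cmod z - M) by (unfold rho in Hz; lra).
    apply Rmult_le_reg_r with ((Cmod z - M) * (2 * PI)); [apply Rmult_lt_0_compat; assumption | ].
    replace (norm x / (Cmod z - M) * ((Cmod z - M) * (2 * PI))) with (K * (eps * b (S k))).
    * replace (eps / (2 * PI) * b (S k) * ((Cmod z - M) * (2 * PI))) with ((Cmod z - M) * (eps * b (S k)))
        by (field; assert (P := PI_RGT_0); lra).
      apply Rmult_le_compat_r; [lra | ]. unfold rho in Hz. lra.
    * unfold K. field. repeat split; lra.
- intros z Hz. apply ex_cdiff_Res. lra.
Qed.

Lemma moment_coef r x k : 1 < r -> J r (fun z => z ^ k * (z * cf (Res z x) 0))%C = (RtoC (2 * PI) * cf x k)%C.
Proof.
intros Hr.
assert (E := moment_shift (r + 1) r x k ltac:(lra) (fun _ => 1%C) ltac:(intros; apply ex_cdiff_const)).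
cbv beta in E.
transitivity (J r (fun z => z ^ k * 1 * (z * cf (Res z x) 0))%C).
{ apply J_ext; [lra | ]. intros z _. ring. }
rewrite <- E.
rewrite (J_ext r _ (fun z => cf x k + cf (Res z x) (S k))%C); [ | lra | ].
- rewrite J_plus; [ | lra | | ].
  + rewrite J_const, moment_vanish by exact Hr. ring.
  + intros z _. apply ccont_const.
  + intros z Hz. apply ex_cdiff_ccont, ex_cdiff_Res. lra.
- intros z Hz. rewrite Res_step by lra. ring.
Qed.

(** The radius picked by the calculus may enclose zeros of [h - w] outside the unit disc; holomorphy
    in the annulus lets the circle shrink to any [r > 1] below it. *)
Lemma calculus_moment h R0 x k r : hol_closed_disk 1 h ->
  (forall z, Cmod z < R0 -> ex_cdiff h z) -> 1 < r < R0 -> r <= calculus_radius b Hw h ->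
  cf (hol_calculus T h x) k = (/ RtoC (2 * PI) * J r (fun z => z ^ k * (h z * (z * cf (Res z x) 0))))%C.
Proof.
intros Hh Dh Hr Lr. rewrite calculus_coef by exact Hh. f_equal.
destruct (calculus_radius_spec b Hw h Hh) as [Hr1 Hr2].
destruct (hol_closed_disk_extend (calculus_radius b Hw h) h ltac:(lra) Hr2) as [R1 [HR1 Dh1]].
rewrite (moment_shift R1) by (lra || assumption).
rewrite <- (J_annulus _ r); [ | lra | exact Lr | ].
- apply J_ext; [lra | ]. intros z _. ring.
- intros z Hz.
  apply (ex_cdiff_moment (fun z => z ^ k * h z)%C x 0 z); [lra | ].
  apply ex_cdiff_mult; [apply ex_cdiff_pow | ]. apply Dh1. lra.
Qed.

Lemma calculus_plus h x y : hol_closed_disk 1 h ->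
  hol_calculus T h (plus x y) = plus (hol_calculus T h x) (hol_calculus T h y).
Proof.
intros Hh. apply cf_ext. intros k. rewrite cf_plus, !calculus_coef by exact Hh.
destruct (calculus_radius_spec b Hw h Hh) as [Hr1 Hr2].
destruct (hol_closed_disk_extend (calculus_radius b Hw h) h ltac:(lra) Hr2) as [R1 [HR1 Dh1]].
assert (Cx : forall x, ccont_circle (fun z => h z * (z * cf (Res z x) k))%C (calculus_radius b Hw h)).
{ intros u z Hz. apply ex_cdiff_ccont, ex_cdiff_moment; [lra | apply Dh1; lra]. }
rewrite <- Cmult_plus_distr_l, <- J_plus by (lra || apply Cx). f_equal.
apply J_ext; [lra | ]. intros z Hz.
rewrite (linear_plus _ (Res_linear b Hw z ltac:(lra))), cf_plus. ring.
Qed.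

Lemma calculus_scal h (c : C) x : hol_closed_disk 1 h ->
  hol_calculus T h (scal c x) = scal c (hol_calculus T h x).
Proof.
intros Hh. apply cf_ext. intros k. rewrite cf_scal, !calculus_coef by exact Hh.
destruct (calculus_radius_spec b Hw h Hh) as [Hr1 Hr2].
destruct (hol_closed_disk_extend (calculus_radius b Hw h) h ltac:(lra) Hr2) as [R1 [HR1 Dh1]].
assert (Cx : ccont_circle (fun z => h z * (z * cf (Res z x) k))%C (calculus_radius b Hw h)).
{ intros z Hz. apply ex_cdiff_ccont, ex_cdiff_moment; [lra | apply Dh1; lra]. }
transitivity (/ RtoC (2 * PI) * (c * J (calculus_radius b Hw h) (fun z => h z * (z * cf (Res z x) k))))%C; [ | ring].
rewrite <- (J_scal (calculus_radius b Hw h) c _ ltac:(lra) Cx). f_equal.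
apply J_ext; [lra | ]. intros z Hz.
rewrite (linear_scal _ (Res_linear b Hw z ltac:(lra))), cf_scal. ring.
Qed.

(** On an eigenvector the resolvent acts as the scalar [/ (z - l)], and the calculus becomes
    Cauchy's formula for [h] at [l]. *)
Lemma calculus_kvec h l : hol_closed_disk 1 h -> Cmod l < 1 ->
  hol_calculus T h (kvec b Hw l) = scal (h l) (kvec b Hw l).
Proof.
intros Hh Hl. apply cf_ext. intros k. rewrite cf_scal, calculus_coef by exact Hh.
destruct (calculus_radius_spec b Hw h Hh) as [Hr1 Hr2].
destruct (hol_closed_disk_extend (calculus_radius b Hw h) h ltac:(lra) Hr2) as [R1 [HR1 Dh1]].
assert (TP := two_PI_pos).
assert (TPC : RtoC (2 * PI) <> 0%C) by (apply Cmod_gt_0; rewrite Cmod_R, Rabs_pos_eq; lra).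
rewrite (J_ext _ _ (fun z => cf (kvec b Hw l) k * (h z * (z * / (z - l))))%C); [ | lra | ].
- rewrite J_scal; [ | lra | ].
  + rewrite (Cauchy_formula h R1 nil l); try lra.
    * field. exact TPC.
    * intros z Hz. apply ex_cdiff_ccont, Dh1, Hz.
    * intros z Hz _. apply Dh1, Hz.
    * apply Dh1. lra.
  + intros z Hz. apply ccont_mult; [apply ex_cdiff_ccont, Dh1; lra | ].
    apply ccont_mult; [apply ccont_id | apply ccont_kernel, Cmod_neq; lra].
- intros z Hz.
  assert (N : (z - l)%C <> 0%C) by (apply Csub_neq0, Cmod_neq; lra).
  rewrite (Res_unique b Hw z (kvec b Hw l) (scal (/ (z - l))%C (kvec b Hw l))) by
    (try lra; apply cf_ext; intros j; rewrite cf_minus, !cf_scal, cf_S, !cf_scal, !cf_kvec by exact Hl;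
     simpl; field; exact N).
  rewrite cf_scal. field. exact N.
Qed.

(* The coefficients of an eigenvector are the moments of [z |-> z * y_0(z)]; they
   are determined by interpolation at the points of the fibre. *)
Lemma ker_calculus_coef h w l x : hol_closed_disk 1 h -> regular_value h w -> is_fibre h w l ->
  ker_bundle (hol_calculus T h) w x ->
  exists c : C -> C, forall k, cf x k = csum (fun z => z ^ k * c z)%C l.
Proof.
intros Hh HG Hl Hx. assert (TP := two_PI_pos).
assert (TPC : RtoC (2 * PI) <> 0%C) by (apply Cmod_gt_0; rewrite Cmod_R, Rabs_pos_eq; lra).
destruct (hol_closed_disk_extend 1 h ltac:(lra) Hh) as [R0 [HR0 Dh]].
destruct (zeros_near_disc h R0 HR0 Dh w l HG Hl) as [R' [HR1 [HR2 HZ]]].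
destruct (calculus_radius_spec b Hw h Hh) as [Hr1 _].
(* Below [R'], so that only zeros in the fibre are enclosed, and at most the radius of the calculus,
   so that its circle can be moved inwards. *)
set (r := Rmin (calculus_radius b Hw h) ((1 + R') / 2)).
assert (A := Rmin_l (calculus_radius b Hw h) ((1 + R') / 2)).
assert (B := Rmin_r (calculus_radius b Hw h) ((1 + R') / 2)).
fold r in A, B.
assert (Hr : 1 < r) by (apply Rmin_glb_lt; lra).
set (G := fun z => (z * cf (Res z x) 0)%C).
assert (CG : ccont_circle G r).
{ intros z Hz. apply ccont_mult; [apply ccont_id | apply ex_cdiff_ccont, ex_cdiff_Res; lra]. }
assert (Eg : forall k, cf (hol_calculus T h x) k = (w * cf x k)%C).
{ intros k. apply Csub_eq0. exact (f_equal (fun y => cf y k) Hx). }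
exists (fun z => / RtoC (2 * PI) * J r (fun v => lagrange l z v * G v))%C. intros k.
transitivity (/ RtoC (2 * PI) * J r (fun z => z ^ k * G z))%C.
{ unfold G. rewrite moment_coef by exact Hr. field. exact TPC. }
rewrite (moments_interpolate (fun z => h z - w)%C l R' r G).
- rewrite Cmult_comm, <- (csum_mult_r (fun z => z ^ k)%C (fun z => J r (fun v => lagrange l z v * G v))%C).
  apply csum_ext. intros z _. ring.
- lra.
- intros z Hz. apply ex_cdiff_minus; [apply Dh; lra | apply ex_cdiff_const].
- apply Hl.
- intros z Hz E. apply HZ; [exact Hz | apply Csub_eq0, E].
- intros z Hz. apply Hl in Hz. destruct Hz as [Z1 Z2]. unfold unit_disk in Z1.
  split; [lra | split; [rewrite Z2; ring | ]].
  intros D HD. apply (proj2 HG z Z1 Z2). apply cdiff_eps. intros eps He.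
  rewrite cdiff_eps in HD. destruct (HD eps He) as [d [Hd K]]. exists d; split; [exact Hd | ].
  intros v Hv. specialize (K v Hv).
  replace (h v - h z - D * (v - z))%C with (h v - w - (h z - w) - D * (v - z))%C by ring. exact K.
- exact CG.
(* The eigenvector equation in moments: those of [h * G] are [2 PI] times the coefficients of
   [h(S) x], those of [G] are [2 PI] times the coefficients of [x]. *)
- intros j.
  assert (Cj : ccont_circle (fun z => z ^ j * G z)%C r).
  { intros z Hz. apply ccont_mult; [apply ccont_pow | apply CG, Hz]. }
  rewrite (J_ext r _ (fun z => z ^ j * (h z * G z) - w * (z ^ j * G z))%C); [ | lra | intros z _; ring].
  rewrite (J_minus r (fun z => z ^ j * (h z * G z))%C (fun z => w * (z ^ j * G z))%C); [ | lra | | ].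
  + rewrite J_scal by (lra || exact Cj). unfold G. rewrite moment_coef by exact Hr.
    specialize (Eg j). rewrite (calculus_moment h R0 x j r Hh Dh ltac:(lra) A) in Eg.
    transitivity (RtoC (2 * PI) * (/ RtoC (2 * PI) * J r (fun z => z ^ j * (h z * (z * cf (Res z x) 0))))
      - w * (RtoC (2 * PI) * cf x j))%C; [field; exact TPC | ].
    rewrite Eg. ring.
  + intros z Hz. apply ccont_mult; [apply ccont_pow | ].
    apply ccont_mult; [apply ex_cdiff_ccont, Dh; lra | apply CG, Hz].
  + intros z Hz. apply ccont_mult; [apply ccont_const | apply Cj, Hz].
Qed.

End Calculus.

(** * The bundles *)

(** For connectedness, membership in [U] is carried along the segment from [u] to [w] in finitely
    many equal steps. *)
Lemma unit_disk_domain : planar_domain unit_disk.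
Proof.
split; [ | split].
- exists 0%C. unfold unit_disk. rewrite Cmod_0. lra.
- apply open_C_ball. intros z Hz. unfold unit_disk in Hz. exists (1 - Cmod z). split; [lra | ].
  intros w Hw. unfold unit_disk. assert (E := Cmod_le_sub w z). lra.
- intros U W HU HW Cov [u [Du Uu]] [w [Dw Ww]]. apply NNPP. intros No.
  rewrite open_C_ball in HU, HW. unfold unit_disk in *.
  set (p := fun t : R => (u + RtoC t * (w - u))%C).
  assert (Pd : forall t, 0 <= t <= 1 -> Cmod (p t) < 1).
  { intros t Ht. unfold p.
    replace (u + RtoC t * (w - u))%C with (RtoC (1 - t) * u + RtoC t * w)%C by (rewrite RtoC_minus; ring).
    apply Rle_lt_trans with (1 := Cmod_triangle _ _). rewrite !Cmod_mult, !Cmod_R, !Rabs_pos_eq by lra.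
    assert (P1 := Cmod_ge_0 u). assert (P2 := Cmod_ge_0 w).
    destruct (Rle_dec t (/ 2)); nra. }
  assert (Pc : forall s t, Cmod (p s - p t) <= Rabs (s - t) * 2).
  { intros s t. unfold p.
    replace (u + RtoC s * (w - u) - (u + RtoC t * (w - u)))%C with (RtoC (s - t) * (w - u))%C
      by (rewrite RtoC_minus; ring).
    rewrite Cmod_mult, Cmod_R. apply Rmult_le_compat_l; [apply Rabs_pos | ].
    apply Rle_trans with (1 := Cmod_sub_add _ _). lra. }
  (* A uniform step: near a parameter with [p t] in [U] openness of [U] applies, and near any other
     one the points lie in [W], hence not in [U]. *)
  destruct (compact_interval_uniform (fun t d => 0 <= t <= 1 ->
     forall s, 0 <= s <= 1 -> Rabs (s - t) < d -> U (p t) -> U (p s)) 0 1) as [d [Hd K]].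
  + intros t d d' _ L H Ht s Hs Hst. apply H; try assumption. lra.
  + lra.
  + intros t Ht. destruct (classic (U (p t))) as [Ut | Nt].
    * destruct (HU _ Ut) as [e [He B]]. exists (e / 4). split; [lra | ].
      intros s Hs _ s' Hs' Hss _. apply B. apply Rle_lt_trans with (1 := Pc _ _).
      assert (Tr := Rabs_triang (s' - s) (s - t)). replace (s' - s + (s - t)) with (s' - t) in Tr by ring. lra.
    * assert (Wt : W (p t)) by (destruct (Cov (p t) (Pd t Ht)); tauto).
      destruct (HW _ Wt) as [e [He B]]. exists (e / 2). split; [lra | ].
      intros s Hs Hs0 s' Hs' Hss Us. exfalso. apply No. exists (p s).
      split; [apply Pd, Hs0 | split; [exact Us | ]]. apply B. apply Rle_lt_trans with (1 := Pc _ _). lra.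
  + destruct (archimed_cor1 d Hd) as [N [HN N0]].
    assert (PN : 0 < INR N) by (apply lt_0_INR; lia).
    assert (HU' : forall k, (k <= N)%nat -> U (p (INR k / INR N))).
    { induction k as [ | k IH]; intros Hk.
      - unfold p. simpl INR. replace (0 / INR N) with 0 by (field; lra).
        replace (u + 0 * (w - u))%C with u by ring. exact Uu.
      - assert (Lk : INR (S k) <= INR N) by (apply le_INR; lia).
        assert (L0 : 0 <= INR k) by apply pos_INR. rewrite S_INR in *.
        assert (R0 : forall x, 0 <= x <= INR N -> 0 <= x / INR N <= 1).
        { intros x Hx. split; [apply Rmult_le_pos; [lra | apply Rlt_le, Rinv_0_lt_compat, PN] | ].
          apply Rmult_le_reg_r with (INR N); [exact PN | ]. unfold Rdiv. rewrite Rmult_assoc, Rinv_l; lra. }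
        apply (K (INR k / INR N)); [apply R0; lra | apply R0; lra | apply R0; lra | | apply IH; lia].
        replace ((INR k + 1) / INR N - INR k / INR N) with (/ INR N) by (field; lra).
        rewrite Rabs_pos_eq; [exact HN | apply Rlt_le, Rinv_0_lt_compat, PN]. }
    apply No. exists w. split; [exact Dw | split; [ | exact Ww]].
    specialize (HU' N (le_n N)). unfold p in HU'. replace (INR N / INR N) with 1 in HU' by (field; lra).
    replace (u + 1 * (w - u))%C with w in HU' by ring. exact HU'.
Qed.

(** * Linear independence of geometric sequences *)

Lemma csum_linear (x y : C) (f g : C -> C) l :
  csum (fun z => x * f z + y * g z)%C l = (x * csum f l + y * csum g l)%C.
Proof. induction l as [ | z l IH]; simpl; [ring | rewrite IH; ring]. Qed.

(* Lagrange polynomials in place of the Vandermonde determinant. *)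
Lemma powers_independent (c : C -> C) l : NoDup l ->
  (forall k, csum (fun z => z ^ k * c z)%C l = 0%C) -> forall y, In y l -> c y = 0%C.
Proof.
intros Nd H y Hy.
(* Stated for all [k], since multiplying by [z - u] raises the exponent by one. *)
assert (P : forall m k, csum (fun z => z ^ k *
  (fold_right (fun u acc => (z - u) * / (y - u) * acc) 1 m * c z))%C l = 0%C).
{ induction m as [ | u m IH]; intros k.
  - rewrite <- (H k). apply csum_ext. intros z _. simpl. ring.
  - assert (E := csum_linear (/ (y - u))%C (- (u * / (y - u)))%C
      (fun z => z ^ S k * (fold_right (fun u acc => (z - u) * / (y - u) * acc) 1 m * c z))%C
      (fun z => z ^ k * (fold_right (fun u acc => (z - u) * / (y - u) * acc) 1 m * c z))%C l).
    rewrite !IH in E. rewrite !Cmult_0_r, Cplus_0_l in E. rewrite <- E.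
    apply csum_ext. intros z _. simpl. ring. }
specialize (P (remove C_eq_dec y l) O).
rewrite (csum_single _ l y Nd Hy) in P.
- change (y ^ 0 * (lagrange l y y * c y) = 0)%C in P. rewrite lagrange_same in P.
  rewrite <- P. simpl. ring.
- intros x Hx Hn. change (x ^ 0 * (lagrange l y x * c x) = 0)%C.
  rewrite lagrange_other by assumption. ring.
Qed.

Lemma lin_comb_closed (H : HilbertSpace) (E : H -> Prop) n c v :
  E zero -> (forall x y, E x -> E y -> E (plus x y)) -> (forall (a : C) x, E x -> E (scal a x)) ->
  (forall i, (1 <= i <= n)%nat -> E (v i)) -> E (lin_comb n c v).
Proof.
intros E0 Ep Es. induction n as [ | n IH]; intros Hv.
- unfold lin_comb. rewrite sum_n_m_zero by lia. exact E0.
- unfold lin_comb. rewrite sum_n_Sm by lia. apply Ep.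
  + apply IH. intros i Hi. apply Hv. lia.
  + apply Es, Hv. lia.
Qed.

Lemma lin_comb_ext (H : HilbertSpace) n c c' (v v' : nat -> H) :
  (forall i, (1 <= i <= n)%nat -> c i = c' i) -> (forall i, (1 <= i <= n)%nat -> v i = v' i) ->
  lin_comb n c v = lin_comb n c' v'.
Proof.
intros Hc Hv. apply sum_n_m_ext_loc. intros i Hi. rewrite Hc, Hv by lia. reflexivity.
Qed.

(** Coefficients indexed by positions become a function of the points, as no point occurs twice;
    [csum] requires this form. *)
Lemma index_function (l : list C) (c : nat -> C) : NoDup l ->
  exists e : C -> C, forall i, (1 <= i <= length l)%nat -> c i = e (nth (pred i) l 0%C).
Proof.
intros Nd.
exists (fun z => c (epsilon (inhabits O) (fun i => (1 <= i <= length l)%nat /\ nth (pred i) l 0%C = z))).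
intros i Hi. f_equal.
destruct (epsilon_spec (inhabits O) (fun j => (1 <= j <= length l)%nat /\ nth (pred j) l 0%C = nth (pred i) l 0%C))
  as [J1 J2]; [exists i; tauto | ].
revert J1 J2. generalize (epsilon (inhabits O)
  (fun j => (1 <= j <= length l)%nat /\ nth (pred j) l 0%C = nth (pred i) l 0%C)). intros j J1 J2.
assert (E : pred j = pred i) by (apply (proj1 (NoDup_nth l 0%C) Nd); [lia | lia | exact J2]). lia.
Qed.

(** * Bases of the kernels, constancy of the rank and frames *)

Section Bundle.

Variable b : weight_seq.
Hypothesis Hw : is_lim_seq (weight b) 1.

Local Notation T := (S_beta Hw).
Local Notation kv := (kvec b Hw).

(** Positions start at 1 in [lin_comb] and at 0 in [nth], hence the [pred]. *)
Lemma cf_lin_comb (e : C -> C) l k : (forall z, In z l -> Cmod z < 1) ->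
  cf (lin_comb (H := H2 b) (length l) (fun i => e (nth (pred i) l 0%C)) (fun i => kv (nth (pred i) l 0%C))) k
  = csum (fun z => z ^ k * e z)%C l.
Proof.
induction l as [ | x l IH]; intros Hl.
- unfold lin_comb. rewrite sum_n_m_zero by (simpl; lia). apply cf_zero.
- unfold lin_comb. simpl length. rewrite sum_Sn_m by lia. rewrite cf_plus.
  rewrite <- (sum_n_m_S (fun i => scal (e (nth (pred i) (x :: l) 0%C)) (kv (nth (pred i) (x :: l) 0%C)) : H2 b)).
  simpl csum. rewrite <- IH by (intros z Hz; apply Hl; now right).
  rewrite cf_scal. simpl (nth (pred 1) (x :: l) 0%C). rewrite cf_kvec by (apply Hl; now left).
  f_equal; [ring | ].
  apply (f_equal (fun v => cf v k)). apply sum_n_m_ext_loc. intros i Hi.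
  simpl pred. destruct i as [ | i]; [lia | reflexivity].
Qed.

Lemma S_bundle : hermitian_bundle 1 unit_disk (ker_bundle T).
Proof.
split; [lia | split; [apply unit_disk_domain | ]].
intros l0 Hl0. exists unit_disk, (fun _ => kv). repeat split.
- apply unit_disk_domain.
- exact Hl0.
- tauto.
- intros i _. apply kvec_holomorphic.
- intros Hx. apply ker_S_kvec in Hx; [ | exact H]. destruct Hx as [c ->].
  exists (fun _ => c). unfold lin_comb. rewrite sum_n_n. reflexivity.
- intros [c ->]. unfold lin_comb. rewrite sum_n_n. apply ker_S_kvec; [exact H | ].
  exists (c 1%nat). reflexivity.
- intros c E i Hi. replace i with 1%nat by lia. unfold lin_comb in E. rewrite sum_n_n in E.
  apply (f_equal (fun v => cf v 0)) in E. rewrite cf_scal, cf_kvec, cf_zero in E by exact H.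
  rewrite <- E. simpl. ring.
Qed.

Variable h : C -> C.
Hypothesis Hh : hol_closed_disk 1 h.

Lemma ker_calculus_kvec z w : Cmod z < 1 -> h z = w -> ker_bundle (hol_calculus T h) w (kv z).
Proof.
intros Hz <-. unfold ker_bundle. rewrite calculus_kvec by assumption.
apply cf_ext. intros k. rewrite cf_minus, cf_zero. ring.
Qed.

Lemma ker_calculus_plus w x y : ker_bundle (hol_calculus T h) w x -> ker_bundle (hol_calculus T h) w y ->
  ker_bundle (hol_calculus T h) w (plus x y).
Proof.
unfold ker_bundle. intros Hx Hy. rewrite calculus_plus by exact Hh. apply cf_ext. intros k.
apply (f_equal (fun v => cf v k)) in Hx. apply (f_equal (fun v => cf v k)) in Hy.
rewrite cf_minus, cf_scal, cf_zero in Hx, Hy.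
rewrite cf_minus, cf_scal, !cf_plus, cf_zero.
transitivity ((cf (hol_calculus T h x) k - w * cf x k) + (cf (hol_calculus T h y) k - w * cf y k))%C; [ring | ].
rewrite Hx, Hy. ring.
Qed.

Lemma ker_calculus_scal w (c : C) x : ker_bundle (hol_calculus T h) w x ->
  ker_bundle (hol_calculus T h) w (scal c x).
Proof.
unfold ker_bundle. intros Hx. rewrite calculus_scal by exact Hh. apply cf_ext. intros k.
apply (f_equal (fun v => cf v k)) in Hx. rewrite cf_minus, cf_scal, cf_zero in Hx.
rewrite cf_minus, !cf_scal, cf_zero.
transitivity (c * (cf (hol_calculus T h x) k - w * cf x k))%C; [ring | ].
rewrite Hx. ring.
Qed.

Lemma ker_calculus_lin_comb w n c v :
  (forall i, (1 <= i <= n)%nat -> ker_bundle (hol_calculus T h) w (v i)) ->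
  ker_bundle (hol_calculus T h) w (lin_comb n c v).
Proof.
intros Hv. apply (lin_comb_closed (H2 b) (ker_bundle (hol_calculus T h) w)).
- unfold ker_bundle. assert (E : (zero : H2 b) = scal (RtoC 0) (zero : H2 b)).
  { apply cf_ext. intros k. rewrite cf_scal, cf_zero. ring. }
  rewrite E. rewrite calculus_scal by exact Hh. apply cf_ext. intros k.
  rewrite cf_minus, !cf_scal. transitivity (RtoC 0); [ring | reflexivity].
- apply ker_calculus_plus.
- apply ker_calculus_scal.
- exact Hv.
Qed.

(** Spanning is the interpolation of moments; independence is that of the geometric sequences with
    distinct ratios. *)
Lemma fibre_basis w l : regular_value h w -> is_fibre h w l ->
  is_basis (H := H2 b) (length l) (fun i => kv (nth (pred i) l 0%C)) (ker_bundle (hol_calculus T h) w).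
Proof.
intros HG Hl. assert (Hl' := Hl). destruct Hl' as [Nd Hz].
assert (Lz : forall z, In z l -> Cmod z < 1) by (intros z I; apply Hz, I).
split.
- intros x. split.
  + intros Hx. destruct (ker_calculus_coef b Hw h w l x Hh HG Hl Hx) as [c Hc].
    exists (fun i => c (nth (pred i) l 0%C)). apply cf_ext. intros k.
    rewrite (cf_lin_comb c l k Lz). apply Hc.
  + intros [c ->]. apply ker_calculus_lin_comb. intros i Hi.
    assert (I : In (nth (pred i) l 0%C) l) by (apply nth_In; lia).
    apply ker_calculus_kvec; apply Hz, I.
- intros c E i Hi. destruct (index_function l c Nd) as [e He].
  rewrite (lin_comb_ext (H2 b) _ c (fun i => e (nth (pred i) l 0%C)) _ (fun i => kv (nth (pred i) l 0%C)) He
    (fun _ _ => eq_refl)) in E.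
  rewrite He by exact Hi. apply (powers_independent e l Nd); [ | apply nth_In; lia].
  intros k. rewrite <- (cf_lin_comb e l k Lz). exact (f_equal (fun v => cf v k) E).
Qed.

Variable Omega : C -> Prop.
Hypothesis HOmega : planar_domain Omega.
Hypothesis Hreg : forall w, Omega w -> regular_value h w.
Hypothesis Himage : forall w, Omega w -> image h unit_disk w.

(** By [fibre_local] any condition on the number of preimages defines an open subset of [Omega], so
    connectedness excludes two different numbers. The number is positive because [Omega] lies in the
    image. *)
Lemma fibre_length_constant : exists n, (1 <= n)%nat /\
  forall w, Omega w -> exists l, is_fibre h w l /\ length l = n.
Proof.
destruct (hol_closed_disk_extend 1 h ltac:(lra) Hh) as [R0 [HR0 Dh]].
destruct HOmega as [[w0 Hw0] [Op Con]]. rewrite open_C_ball in Op.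
destruct (fibre_exists h R0 HR0 Dh w0 (Hreg w0 Hw0)) as [l0 Hl0].
assert (Loc : forall (P : nat -> Prop), open (T := C_UniformSpace)
  (fun w => Omega w /\ exists l, is_fibre h w l /\ P (length l))).
{ intros P. apply open_C_ball. intros w [Ow [l [Fl Pl]]].
  destruct (fibre_local h R0 HR0 Dh w l (Hreg w Ow) Fl) as [eta [g [He [Fg _]]]].
  destruct (Op w Ow) as [d [Hd Kd]].
  exists (Rmin eta d). split; [apply Rmin_pos; assumption | ].
  assert (M1 := Rmin_l eta d). assert (M2 := Rmin_r eta d).
  intros v Hv. split; [apply Kd; lra | ].
  exists (map (fun z => g z v) l). split; [apply Fg; lra | ]. rewrite length_map. exact Pl. }
exists (length l0). split.
- destruct (Himage w0 Hw0) as [z [Z1 Z2]]. assert (I : In z l0) by (apply Hl0; tauto).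
  destruct l0; [destruct I | simpl; lia].
- intros w Ow. apply NNPP. intros No.
  destruct (Con _ _ (Loc (fun n => n = length l0)) (Loc (fun n => n <> length l0))) as [v [Ov [[_ [l1 [F1 E1]]] [_ [l2 [F2 E2]]]]]].
  + intros v Ov. destruct (fibre_exists h R0 HR0 Dh v (Hreg v Ov)) as [l Fl].
    destruct (Nat.eq_dec (length l) (length l0)); [left | right]; (split; [exact Ov | exists l; tauto]).
  + exists w0. split; [exact Hw0 | split; [exact Hw0 | exists l0; tauto]].
  + exists w. split; [exact Ow | split; [exact Ow | ]].
    destruct (fibre_exists h R0 HR0 Dh w (Hreg w Ow)) as [l Fl]. exists l. split; [exact Fl | ].
    intros E. apply No. exists l. tauto.
  + apply E2. rewrite <- E1. apply (fibre_length h v); assumption.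
Qed.

(** The Lipschitz bound converts the first order remainder of [h] at [g w] into one for [g] at
    [w]. *)
Lemma inverse_branch_cdiff (g : C -> C) w k e D : 0 < e ->
  (forall v, Cmod (v - w) < e -> h (g v) = v) -> 0 < k ->
  (forall v, Cmod (v - w) < e -> Cmod (g v - g w) <= k * Cmod (v - w)) ->
  cdiff h (g w) D -> D <> 0%C -> cdiff g w (/ D).
Proof.
intros He Hg Hk Lip HD HD0. assert (PD := proj1 (Cmod_gt_0 _) HD0).
assert (Gw : h (g w) = w) by (apply Hg; rewrite Cmod_self; exact He).
apply cdiff_eps. intros eps Heps. rewrite cdiff_eps in HD.
destruct (HD (eps * Cmod D / k)) as [d [Hd K]].
{ apply Rdiv_lt_0_compat; [apply Rmult_lt_0_compat; assumption | exact Hk]. }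
exists (Rmin e (d / k)). split; [apply Rmin_pos; [exact He | apply Rdiv_lt_0_compat; assumption] | ].
assert (M1 := Rmin_l e (d / k)). assert (M2 := Rmin_r e (d / k)).
intros v Hv. assert (L := Lip v ltac:(lra)).
specialize (K (g v)). rewrite (Hg v ltac:(lra)), Gw in K.
assert (Lt : Cmod (g v - g w) < d).
{ apply Rle_lt_trans with (1 := L). apply Rlt_le_trans with (k * (d / k)).
  - apply Rmult_lt_compat_l; lra.
  - right. field. lra. }
specialize (K Lt).
replace (g v - g w - / D * (v - w))%C with (- (/ D * (v - w - D * (g v - g w))))%C by (field; exact HD0).
rewrite Cmod_opp, Cmod_mult, Cmod_inv by exact HD0.
apply Rmult_le_reg_l with (Cmod D); [exact PD | ]. rewrite <- Rmult_assoc, Rinv_r, Rmult_1_l by lra.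
apply Rle_trans with (1 := K).
apply Rle_trans with (eps * Cmod D / k * (k * Cmod (v - w))).
- apply Rmult_le_compat_l; [ | exact L].
  apply Rlt_le, Rdiv_lt_0_compat; [apply Rmult_lt_0_compat; assumption | exact Hk].
- right. field. lra.
Qed.

(** The frame consists of [kvec] composed with the inverse branches of [h]. *)
Lemma calculus_bundle : exists n, hermitian_bundle n Omega (ker_bundle (hol_calculus T h)).
Proof.
destruct (hol_closed_disk_extend 1 h ltac:(lra) Hh) as [R0 [HR0 Dh]].
destruct fibre_length_constant as [n [Hn HF]].
exists n. split; [exact Hn | split; [exact HOmega | ]]. intros w0 Hw0.
destruct HOmega as [_ [Op _]]. rewrite open_C_ball in Op.
destruct (HF w0 Hw0) as [l [Fl <-]].
destruct (fibre_local h R0 HR0 Dh w0 l (Hreg w0 Hw0) Fl) as [eta [g [He [Fg Lg]]]].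
destruct (Op w0 Hw0) as [d [Hd Kd]].
set (e := Rmin eta d). assert (Pe : 0 < e) by (apply Rmin_pos; assumption).
assert (M1 : e <= eta) by apply Rmin_l. assert (M2 : e <= d) by apply Rmin_r.
exists (fun w => Cmod (w - w0) < e), (fun i w => kv (nth (pred i) (map (fun z => g z w) l) 0%C)).
split; [ | split; [ | split; [ | split]]].
- apply open_C_ball. intros w Hww. exists (e - Cmod (w - w0)). split; [lra | ].
  intros v Hv. apply Rle_lt_trans with (1 := Cmod_sub v w w0). lra.
- rewrite Cmod_self. exact Pe.
- intros w Hww. apply Kd. lra.
- intros i Hi w Hww. set (z := nth (pred i) l 0%C).
  assert (Iz : In z l) by (apply nth_In; lia).
  assert (En : forall v, nth (pred i) (map (fun z => g z v) l) 0%C = g z v).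
  { intros v. rewrite (nth_indep _ (RtoC 0) (g (RtoC 0) v)) by (rewrite length_map; lia).
    exact (map_nth (fun z => g z v) l (RtoC 0) (pred i)). }
  assert (Ig : forall v, Cmod (v - w0) < e -> unit_disk (g z v) /\ h (g z v) = v).
  { intros v Hv. apply (Fg v ltac:(lra)). apply (in_map (fun z => g z v)), Iz. }
  apply (ex_derive_ext (K := C_AbsRing) (fun v => kv (g z v))).
  { intros v. now rewrite En. }
  destruct (Ig w Hww) as [G1 G2].
  apply (ex_derive_comp (K := C_AbsRing) kv (g z) w); [apply kvec_holomorphic, G1 | ].
  destruct (Lg z Iz) as [k [Hk Lip]].
  destruct (Dh (g z w)) as [D HD]; [unfold unit_disk in G1; lra | ].
  assert (Ow : Omega w) by (apply Kd; lra).
  assert (HD0 : D <> RtoC 0) by exact (proj2 (Hreg w Ow) (g z w) G1 G2 D HD).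
  exists (/ D)%C.
  assert (X : cdiff (g z) w (/ D)).
  { apply (inverse_branch_cdiff (g z) w k (e - Cmod (w - w0)) D); try assumption.
    - lra.
    - intros v Hv. apply Ig. apply Rle_lt_trans with (1 := Cmod_sub v w w0). lra.
    - intros v Hv. apply Lip; [ | lra]. apply Rle_lt_trans with (1 := Cmod_sub v w w0). lra. }
  (* The chain rule wants the inner function valued in [C] as an absolute value ring; the epsilon
     form transfers the derivative between the two structures. *)
  apply (is_derive_eps (AbsRing_NormedModule C_AbsRing)).
  exact (proj1 (is_derive_eps C_NormedModule (g z) w (/ D)%C) X).
- intros w Hww. assert (Ow : Omega w) by (apply Kd; lra).
  rewrite <- (length_map (fun z => g z w) l). apply fibre_basis; [apply Hreg, Ow | apply Fg; lra].
Qed.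

Lemma calculus_kernel_span w x : Omega w ->
  ker_bundle (hol_calculus T h) w x <->
  span (fun y => exists l, unit_disk l /\ h l = w /\ ker_bundle T l y) x.
Proof.
intros Ow. destruct fibre_length_constant as [n [_ HF]]. destruct (HF w Ow) as [l [Fl _]].
split.
- intros Hx. apply (fibre_basis w l (Hreg w Ow) Fl) in Hx. destruct Hx as [c Hc].
  exists (length l), c, (fun i => kv (nth (pred i) l 0%C)). split; [ | exact Hc].
  intros i Hi. assert (I : In (nth (pred i) l 0%C) l) by (apply nth_In; lia).
  exists (nth (pred i) l 0%C). apply Fl in I. destruct I as [I1 I2].
  split; [exact I1 | split; [exact I2 | ]]. apply ker_S_kvec; [exact I1 | ].
  exists (RtoC 1). symmetry. exact (scal_one (kv (nth (pred i) l 0%C))).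
- intros [m [c [v [Hv ->]]]]. apply ker_calculus_lin_comb. intros i Hi.
  destruct (Hv i Hi) as [z [Z1 [Z2 Z3]]]. apply ker_S_kvec in Z3; [ | exact Z1].
  destruct Z3 as [a ->]. apply ker_calculus_scal, ker_calculus_kvec; assumption.
Qed.

End Bundle.

Theorem proposition2p7 (b : weight_seq) (Hw : is_lim_seq (weight b) 1%R)
  (h : C -> C) (Hh : hol_closed_disk 1%R h)
  (Omega : C -> Prop) (HOmega : planar_domain Omega)
  (Hsub : forall w, Omega w ->
    image h unit_disk w /\
    ~ (image h unit_circle w \/ image h (critical_points h) w)) :
  push_forward unit_disk h Omega
    (ker_bundle (S_beta Hw))
    (ker_bundle (hol_calculus (S_beta Hw) h)).
Proof.
destruct (hol_closed_disk_extend 1 h ltac:(lra) Hh) as [R0 [HR0 Dh]].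
assert (Hreg : forall w, Omega w -> regular_value h w).
{ intros w Ow. destruct (Hsub w Ow) as [_ N]. split.
  - intros z Hz E. apply N. left. exists z. tauto.
  - intros z Hz E D HD E0. apply N. right. exists z. split; [ | exact E]. split; [exact Hz | ].
    rewrite <- E0. apply is_C_derive_unique. exact HD. }
assert (Himage : forall w, Omega w -> image h unit_disk w) by (intros w Ow; apply Hsub, Ow).
split; [apply unit_disk_domain | ].
split; [intros z Hz; apply Dh; unfold unit_disk in Hz; lra | ].
split.
(* A constant [h] would have derivative 0 at a preimage of a point of [Omega], against
   regularity. *)
{ intros [c Hc]. destruct HOmega as [[w Ow] _]. destruct (Himage w Ow) as [z [Z1 Z2]].
  apply (proj2 (Hreg w Ow) z Z1 Z2 0%C); [ | reflexivity].
  apply cdiff_eps. intros eps He. unfold unit_disk in Z1. exists (1 - Cmod z). split; [lra | ].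
  intros v Hv. rewrite (Hc z Z1), (Hc v).
  - replace (c - c - 0 * (v - z))%C with (RtoC 0) by ring. rewrite Cmod_0.
    apply Rmult_le_pos; [lra | apply Cmod_ge_0].
  - unfold unit_disk. assert (E := Cmod_le_sub v z). lra. }
split; [exact HOmega | split; [exact Himage | ]].
split; [exists 1%nat; apply S_bundle | ].
split; [apply calculus_bundle; assumption | ].
intros w Ow x. apply (calculus_kernel_span b Hw h Hh Omega HOmega Hreg Himage w x Ow).
Qed.
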